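(* Suppose that $\mathfrak p=(p_d)_{d\ge1}$ and $\mathfrak q=(q_d)_{d\ge1}$, with $p_d,q_d\in\mathcal P_d(\mathbb R)$, are two sequences of polynomials with infinitesimal distributions $(\mu,\mu')$ and $(\nu,\nu')$, respectively. Then the finite-free additive convolution $\mathfrak p\boxplus\mathfrak q=(p_d\boxplus_d q_d)_{d\ge1}$ has infinitesimal distribution $(\rho,\rho')$, where $\rho=\mu\boxplus\nu$ and $\rho'$ has Cauchy transform $G_{\rho'}$ given by $$G_{\rho'}=-(\widehat R_{\mathfrak p}\circ G_{\mu\boxplus\nu})\cdot G'_{\mu\boxplus\nu}-(\widehat R_{\mathfrak q}\circ G_{\mu\boxplus\nu})\cdot G'_{\mu\boxplus\nu}-H_{\mu\boxplus\nu}.$$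
   Context: $\mathcal P_d(\mathbb R)$ is the set of monic real polynomials of degree $d$ with only real roots. For $p_d\in\mathcal P_d(\mathbb R)$ with roots $\lambda_1,\dots,\lambda_d$ (with multiplicity), $m_n(p_d)=\frac1d\sum_k\lambda_k^n$. Write $p_d(x)=\sum_{k=0}^d x^{d-k}(-1)^k\binom dk\mathsf e_k(p_d)$. The finite-free additive convolution is $[p_d\boxplus_d q_d](x)=\sum_{k=0}^d x^{d-k}(-1)^k\binom dk\bigl[\sum_{i=0}^k\binom ki\mathsf e_i(p_d)\mathsf e_{k-i}(q_d)\bigr]$ (again in $\mathcal P_d(\mathbb R)$). The finite-free cumulants are $\kappa_n(p_d)=\frac{(-d)^{n-1}}{(n-1)!}\sum_{\pi\in P(n)}(-1)^{|\pi|-1}(|\pi|-1)!\prod_{V\in\pi}\mathsf e_{|V|}(p_d)$, $1\le n\le d$, with $P(n)$ the set of partitions of $[n]=\{1,\dots,n\}$ and $|\pi|$ the number of blocks. A sequence $\mathfrak p$ has infinitesimal distribution $(\mu,\mu')$ if $\mu$ is a probability distribution on $\mathbb R$ with finite moments $m_n(\mu)$ of all orders, $m_n(p_d)\to m_n(\mu)$ for all $n\ge0$, the limits $m_n'(\mathfrak p)=\lim_{d\to\infty}d\,(m_n(p_d)-m_n(\mu))$ exist for all $n\ge1$, and $\mu':\mathbb R[x]\to\mathbb R$ is the linear functional with $\mu'(1)=0$, $\mu'(x^n)=m_n'(\mathfrak p)$. The cumulant fluctuations of such $\mathfrak p$ are the numbers $\widehat r_n(\mathfrak p)$ with $\kappa_n(p_d)=r_n(\mu)+\frac1d\widehat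 r_n(\mathfrak p)+o(1/d)$ as $d\to\infty$ (they always exist). $NC(n)$ is the set of non-crossing partitions of $[n]$; for a sequence $(u_n)$, $u_\pi=\prod_{V\in\pi}u_{|V|}$ and $u_\sigma=\prod_c u_{|c|}$ over cycles $c$ (fixed points included) of a permutation $\sigma$. Free cumulants $r_n(\mu)$ are defined recursively by $m_n(\mu)=\sum_{\pi\in NC(n)}r_\pi(\mu)$. Throughout, only distributions determined by their moments are considered; $\mu\boxplus\nu$ is the probability measure with $r_n(\mu\boxplus\nu)=r_n(\mu)+r_n(\nu)$ for all $n\ge1$. Formal power series (all identities, compositions and derivatives are formal): $G_\mu(z)=\sum_{n\ge0}m_n(\mu)z^{-n-1}$; for a linear functional $\mu'$ on $\mathbb R[x]$, $G_{\mu'}(z)=\sum_{n\ge0}\mu'(x^n)z^{-n-1}$; $\widehat R_{\mathfrak p}(z)=\sum_{n\ge1}\widehat r_n(\mathfrak p)z^{n-1}$; and $H_\mu(z)=\sum_{n\ge2}h_n(\mu)z^{-n-1}$ with $h_n(\mu)=\frac n2\sum_{t+s=n,\ \sigma\in S_{NC}(t,s)}\frac{r_\sigma(\mu)}{ts}$, the sum over ordered pairs of integers $t,s\ge1$. Here, with $\gamma_{t,s}=(1,\dots,t)(t+1,\dots,t+s)\in S_{t+s}$, $S_{NC}(t,s)$ is the set of $\sigma\in S_{t+s}$ such that $\langle\sigma,\gamma_{t,s}\rangle$ acts transitively on $[t+s]$ and $|\sigma|+|\sigma^{-1}\gamma_{t,s}|=t+s$, $|\cdot|$ counting cycles including fixed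 points. *)

(* Defs.v *)
From HB Require Import structures.
From mathcomp Require Import all_boot all_order all_algebra all_fingroup.

Set Implicit Arguments.
Unset Strict Implicit.
Unset Printing Implicit Defensive.

Import Order.TTheory GRing.Theory Num.Theory.

Local Open Scope ring_scope.

(** * Partitions of [[n]] and permutations in the annulus *)

(* The set {1, ..., n} is represented by 'I_n = {0, ..., n-1}. *)
Definition partitions (n : nat) : {set {set {set 'I_n}}} :=
  [set P | partition P [set: 'I_n]].

Definition crossing (n : nat) (A B : {set 'I_n}) : bool :=
  [exists i in A, exists j in B, exists k in A, exists l in B,
     [&& i < j, j < k & k < l]%N].

Definition noncrossing_partitions (n : nat) : {set {set {set 'I_n}}} :=
  [set P in partitions n |
    [forall A in P, forall B in P, (A != B) ==> ~~ crossing A B]].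

Definition annulus_fun (t s : nat) (i : 'I_(t + s)) : 'I_(t + s) :=
  match split i with
  | inl j => lshift s (ordS j)
  | inr k => rshift t (ordS k)
  end.

Lemma annulus_fun_inj (t s : nat) : injective (@annulus_fun t s).
Proof.
move=> i j; rewrite /annulus_fun -{2}(splitK i) -{2}(splitK j).
case: (split i) => a; case: (split j) => b /= /eqP.
- by rewrite eq_lshift => /eqP/ordS_inj ->.
- by rewrite eq_lrshift.
- by rewrite eq_rlshift.
- by rewrite eq_rshift => /eqP/ordS_inj ->.
Qed.

(* gamma_{t,s} = (1, ..., t)(t+1, ..., t+s) *)
Definition annulus_perm (t s : nat) : 'S_(t + s) := perm (@annulus_fun_inj t s).

(* Permutations compose left to right in mathcomp, so that the product below is
   gamma \o sigma^-1 as functions; it is conjugate to sigma^-1 \o gamma, hence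
   it has the same number of cycles.  The set [porbits sigma] contains the
   singletons of the fixed points of sigma. *)
Definition annular_noncrossing (t s : nat) : {set 'S_(t + s)} :=
  [set sigma : 'S_(t + s) |
    [transitive <<[set sigma; annulus_perm t s]>>%g,
       on [set: 'I_(t + s)] | 'P] &&
    (#|porbits sigma| + #|porbits (sigma^-1 * annulus_perm t s)%g| == t + s)%N].

(** * Free cumulants *)

Section FreeCumulants.
Context {R : fieldType}.
Implicit Types (u m : nat -> R).

(* \prod over blocks of u_{|V|}: this is both u_pi and, through the set of
   orbits, u_sigma. *)
Definition block_prod (n : nat) u (P : {set {set 'I_n}}) : R :=
  \prod_(V in P) u #|V|.

(* The recursion m_n = \sum_(pi in NC(n)) r_pi solved for r_n: the one-block
   partition contributes r_n, the other ones only involve r_k with k < n.  The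
   argument [fuel] only makes the recursion structural. *)
Fixpoint free_cumulant_rec m (fuel n : nat) : R :=
  if fuel is f.+1 then
    m n - \sum_(P in noncrossing_partitions n | P != [set [set: 'I_n]])
            block_prod (free_cumulant_rec m f) P
  else 0.

Definition free_cumulant m (n : nat) : R := free_cumulant_rec m n n.

Let proper_block n (P : {set {set 'I_n}}) (V : {set 'I_n}) :
  (0 < n)%N -> P \in partitions n -> P != [set [set: 'I_n]] -> V \in P ->
  (0 < #|V| < n)%N.
Proof.
move=> n0; rewrite inE => partP neP VP; apply/andP; split.
  rewrite card_gt0; apply: contraTneq partP => V0.
  by rewrite /partition -V0 VP !andbF.
rewrite ltn_neqAle -[X in (_ <= X)%N]card_ord max_card andbT.
apply: contra neP => /eqP cV; apply/eqP.
have VT : V = [set: 'I_n].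
  by apply/eqP; rewrite eqEcard subsetT cardsT card_ord cV leqnn.
have /and3P[_ /trivIsetP tP P0] := partP.
apply/setP => W; rewrite inE; apply/idP/eqP => [WP|->]; last by rewrite -VT.
apply/eqP; apply: contraT => neW.
have := tP _ _ WP VP; rewrite VT => /(_ neW).
rewrite -setI_eq0 finset.setIT => /eqP W0.
by rewrite W0 (negPf P0) in WP.
Qed.

Let free_cumulant_rec_fuel m (f g n : nat) :
  (0 < n <= f)%N -> (n <= g)%N ->
  free_cumulant_rec m f n = free_cumulant_rec m g n.
Proof.
elim: f g n => [|f IH] [|g] n /andP[n0 nf] ng //=; try by case: n n0 nf ng.
congr (_ - _); apply: eq_bigr => P /andP[NP neP]; apply: eq_bigr => V VP.
have /andP[V0 Vn] : (0 < #|V| < n)%N.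
  by apply: proper_block VP => //; move: NP; rewrite inE => /andP[].
by apply: IH; rewrite ?V0 -ltnS (leq_trans Vn).
Qed.

Lemma moment_free_cumulant m (n : nat) : (0 < n)%N ->
  m n = \sum_(P in noncrossing_partitions n) block_prod (free_cumulant m) P.
Proof.
move=> n0; set T := [set [set: 'I_n]].
have TT V : V \in T -> V = [set: 'I_n] by rewrite inE => /eqP.
have NT : T \in noncrossing_partitions n.
  rewrite !inE; apply/andP; split.
    rewrite /partition cover1 eqxx trivIset1 inE /= eq_sym -card_gt0.
    by rewrite cardsT card_ord.
  apply/forall_inP => A /TT ->; apply/forall_inP => B /TT ->.
  by rewrite eqxx.
rewrite (bigD1 _ NT) /= {1}/block_prod /T big_set1 cardsT card_ord.
rewrite {1}/free_cumulant.
case: n n0 @T TT NT => // n _ T TT NT.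
rewrite [free_cumulant_rec _ _ _]/= -[LHS](subrK (\sum_(P in noncrossing_partitions n.+1 | P != T)
   block_prod (free_cumulant_rec m n) P)).
congr (_ + _); apply: eq_bigr => P /andP[NP neP]; apply: eq_bigr => V VP.
have /andP[V0 Vn] : (0 < #|V| < n.+1)%N.
  by apply: proper_block VP => //; move: NP; rewrite inE => /andP[].
by apply: free_cumulant_rec_fuel; rewrite ?V0 //= -ltnS.
Qed.

End FreeCumulants.

(* Not loaded earlier: its set notations mask those of finset. *)
From mathcomp Require Import all_classical all_reals all_analysis.

Import numFieldNormedType.Exports.

Local Open Scope classical_set_scope.
Local Open Scope ring_scope.

(** * Polynomials with only real roots and finite-free convolution *)

Section FiniteFree.
Context {R : realType}.
Implicit Types (p q : {poly R}).

Definition real_rooted (d : nat) p : Prop :=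
  exists2 s : seq R, size s = d & p = \prod_(x <- s) ('X - x%:P).

(* The roots with multiplicity: unique up to order when [p] is a product of
   monic linear factors, and irrelevant otherwise. *)
Definition root_seq p : seq R :=
  xget [::] [set s | p = \prod_(x <- s) ('X - x%:P)].

Definition poly_moment (d : nat) p (n : nat) : R :=
  d%:R^-1 * \sum_(x <- root_seq p) x ^+ n.

(* Solves p = \sum_(k <= d) (-1)^k 'C(d, k) e_k 'X^(d-k) for e_k, k <= d. *)
Definition ecoef (d : nat) p (k : nat) : R :=
  (-1) ^+ k * p`_(d - k) / 'C(d, k)%:R.

Definition finite_free_add (d : nat) p q : {poly R} :=
  \sum_(k < d.+1)
    ((-1) ^+ k * 'C(d, k)%:R *
      \sum_(i < k.+1) 'C(k, i)%:R * ecoef d p i * ecoef d q (k - i)%N)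
    *: 'X^(d - k).

Definition finite_free_cumulant (d : nat) p (n : nat) : R :=
  (- d%:R) ^+ n.-1 / (n.-1)`!%:R *
  \sum_(P in partitions n)
    (-1) ^+ (#|P|.-1) * ((#|P|.-1)`!)%:R * block_prod (ecoef d p) P.

End FiniteFree.

(** * Distributions *)

Section Distributions.
Context {R : realType}.
Implicit Types (mu nu rho : probability (measurableTypeR R) R).

Definition has_all_moments mu : Prop :=
  forall n : nat, mu.-integrable [set: R] (fun x : R => (x ^+ n)%:E).

Definition mu_moment mu (n : nat) : R := \int[mu]_x (x ^+ n).

Definition moment_determinate mu : Prop :=
  forall nu, has_all_moments nu -> mu_moment nu = mu_moment mu ->
    forall A : set (measurableTypeR R), measurable A -> nu A = mu A.

Definition mu_free_cumulant mu : nat -> R := free_cumulant (mu_moment mu).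

Definition free_add_convolution mu nu rho : Prop :=
  has_all_moments rho /\
  forall n : nat, (0 < n)%N ->
    mu_free_cumulant rho n = mu_free_cumulant mu n + mu_free_cumulant nu n.

(* Sequences of polynomials are indexed by d >= 1; the value at 0 is ignored. *)
Definition infinitesimal_distribution (p : nat -> {poly R}) mu
    (mu' : {scalar {poly R}}) : Prop :=
  [/\ has_all_moments mu,
      forall n : nat, poly_moment d (p d) n @[d --> \oo] --> mu_moment mu n,
      mu' 1 = 0 &
      forall n : nat, (0 < n)%N ->
        d%:R * (poly_moment d (p d) n - mu_moment mu n) @[d --> \oo]
          --> mu' 'X^n].

Definition cumulant_fluctuation (p : nat -> {poly R}) mu (n : nat) : R :=
  get [set c : R |
    (fun d : nat => finite_free_cumulant d (p d) n - mu_free_cumulant mu n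
                    - d%:R^-1 * c)
    =o_\oo (fun d : nat => d%:R^-1 : R)].

Definition annular_coef mu (n : nat) : R :=
  n%:R / 2 *
  \sum_(1 <= t < n) \sum_(sigma in annular_noncrossing t (n - t))
    block_prod (mu_free_cumulant mu) (porbits sigma) / (t%:R * (n - t)%:R).

End Distributions.

(** * Formal series *)

(* A sequence [a : nat -> R] stands for the series \sum_k a_k w^k, where the
   variable is w = z^-1 except for the left argument of [fs_comp]. *)
Section FormalSeries.
Context {R : realType}.
Implicit Types (a b : nat -> R).

Definition fs_one : nat -> R := fun k => (k == 0)%:R.

Definition fs_mul a b : nat -> R := fun k => \sum_(i < k.+1) a i * b (k - i)%N.

Definition fs_exp a (j : nat) : nat -> R := iter j (fs_mul a) fs_one.

(* a \o b, for b without constant term: then b^j has no term of degree < j. *)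
Definition fs_comp a b : nat -> R :=
  fun k => \sum_(j < k.+1) a j * fs_exp b j k.

(* The derivative with respect to z: (z^-k)' = - k z^-(k+1). *)
Definition fs_deriv_z a : nat -> R :=
  fun k => if k is j.+1 then - (j%:R * a j) else 0.

(* \sum_(n >= 0) c_n z^(-n-1) *)
Definition fs_cauchy (c : nat -> R) : nat -> R :=
  fun k => if k is n.+1 then c n else 0.

Definition cauchy_measure (mu : probability (measurableTypeR R) R) : nat -> R :=
  fs_cauchy (mu_moment mu).

Definition cauchy_functional (mu' : {scalar {poly R}}) : nat -> R :=
  fs_cauchy (fun n => mu' 'X^n).

(* Rhat(z) = \sum_(n >= 1) rhat_n z^(n-1) *)
Definition fluctuation_R_transform (p : nat -> {poly R})
    (mu : probability (measurableTypeR R) R) : nat -> R :=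
  fun k => cumulant_fluctuation p mu k.+1.

Definition annular_series (mu : probability (measurableTypeR R) R) : nat -> R :=
  fs_cauchy (fun n => if (2 <= n)%N then annular_coef mu n else 0).

End FormalSeries.

(* Main.v *)
Require Import Defs.
From HB Require Import structures.
From mathcomp Require Import all_boot all_order all_algebra all_fingroup.
From mathcomp Require Import complex reals.
From mathcomp Require Import ring lra zify.

(** The proof works with one exact equation, in which [1/d] is a parameter, and
 expands it to first order.

 Write [p_d = P(D) x^d]. The finite free cumulants are rescaled coefficients of
 [log P], and the moments are the coefficients of [p_d' / (d p_d)]. Commuting
 [P(D)] with [x] and dividing by [p_d] gives, with [M = \sum_n m_n z^n],
   [M = 1 + \sum_(k >= 1) kappa_k z^k M_k],
   [M_0 = 1],  [M_(k+1) = M M_k - (1/d) (k + z d/dz) M_k]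
 ([cumulant_equation], [finite_free_equation]). For [1/d = 0] it becomes
 [M = 1 + \sum_k kappa_k z^k M^k], the functional equation of free cumulants
 ([free_cumulant_equation]); the latter follows from the recursion for
 non-crossing partitions in which the first point is split off its block
 ([nc_total_recursion]).

 The equation determines the moments from the cumulants and conversely, one
 degree at a time, and both directions preserve expansions [x + y/d + o(1/d)]
 ([expands_moments], [expands_cumulants]). Hence the cumulant fluctuations of
 the two sequences exist. Finite free cumulants are additive
 ([finite_free_cumulant_add]), because [P] is multiplicative under convolution;
 so the cumulants, and then the moments, of the convolution have expansions.

 For the coefficient of [1/d] in the moments, compare with the solution of the
 same equation whose cumulants are the constants [r_n(rho)]. The difference of
 the two first-order terms solves a linear equation, and implicit
 differentiation of the limit equation identifies its solution as
 [- (Rhat o G) G'], where [Rhat] is the sum of the two fluctuation transforms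
 ([linear_response], [response_series]).

 The comparison solution is explicit ([genus_moment],
 [genus_cumulant_equation]): by the exponential formula it is a sum over pairs
 [(s, t)] of permutations of [n] points that generate a transitive group, with
 weight [r_s (-1/d)^(n+1-|s|-|t|)]. The genus bound [|s| + |t| + |st| <= n + 2]
 and the parity of the two sides show that the coefficient of [1/d] collects the
 pairs for which [st] has two cycles and the bound is attained ([genus_bound],
 [genus_parity]). Such an [st] is conjugate to a permutation [gamma] of the
 annulus, and counting the conjugators turns the sum into [- h_n]
 ([sum_planar_two_cycles], [genus_coef1]).

 Moments of polynomials are defined by their roots, so the argument also needs
 the convolution to have only real roots. This is Grace's theorem, by iteration
 of Laguerre's theorem on polar derivatives ([laguerre], [grace],
 [finite_free_add_real_rooted]). *)

Set Implicit Arguments.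
Unset Strict Implicit.
Unset Printing Implicit Defensive.

Import Order.TTheory GRing.Theory Num.Theory.
Local Open Scope ring_scope.

(** * Pairs of permutations and their orbits *)

Section PairOrbits.
Import GroupScope.
Local Open Scope ring_scope.
Variable T : finType.
Implicit Types (s t : {perm T}) (x y : T) (A B C : {set T}).

Definition pair_orbit s t x : {set T} := orbit 'P <<[set s; t]>>%g x.

Definition transitive_on B s t : bool :=
  [transitive <<[set s; t]>>%g, on B | 'P].

Lemma pair_orbit_refl s t x : x \in pair_orbit s t x.
Proof. exact: orbit_refl. Qed.

Lemma pair_orbit_stable s t x y :
  y \in pair_orbit s t x -> (s y \in pair_orbit s t x) && (t y \in pair_orbit s t x).
Proof.
move=> xy.
have H r : r \in [set s; t] -> r y \in pair_orbit s t x.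
  move=> rst; apply: (orbit_trans _ xy); rewrite -[r y]/(aperm y r) mem_orbit //.
  exact: mem_gen.
by rewrite !H // !inE eqxx ?orbT.
Qed.

Lemma stable_norm s C : {in C, forall y, s y \in C} -> s \in 'N(C | 'P).
Proof.
move=> sC; rewrite inE in_setT /= inE; apply/subsetP => y /sC.
by rewrite inE.
Qed.

Lemma pair_orbit_min s t x C : x \in C -> {in C, forall y, s y \in C} ->
  {in C, forall y, t y \in C} -> pair_orbit s t x \subset C.
Proof.
move=> xC sC tC; rewrite acts_sub_orbit // gen_subG subUset !sub1set.
by rewrite !stable_norm.
Qed.

Lemma transitive_onE B s t x : x \in B ->
  transitive_on B s t = (pair_orbit s t x == B).
Proof.
move=> xB; apply/idP/eqP => [trB|orbB]; first exact: atransP.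
by apply/imsetP; exists x.
Qed.

(** The orbit of [x] stays inside a stable set, so only the restrictions of the
 two permutations to that set matter. *)
Lemma pair_orbit_agree B s t s' t' x : x \in B ->
  {in B, s =1 s'} -> {in B, t =1 t'} ->
  {in B, forall y, s y \in B} -> {in B, forall y, t y \in B} ->
  pair_orbit s t x = pair_orbit s' t' x.
Proof.
move=> xB ss' tt' sB tB.
have sub (a b a' b' : {perm T}) : {in B, a =1 a'} -> {in B, b =1 b'} ->
    {in B, forall y, a y \in B} -> {in B, forall y, b y \in B} ->
    pair_orbit a b x \subset pair_orbit a' b' x.
  move=> aa' bb' aB bB.
  have OB : pair_orbit a' b' x \subset B.
    by apply: pair_orbit_min => // y yB; rewrite -?aa' -?bb' ?aB ?bB.
  apply: pair_orbit_min; first exact: pair_orbit_refl.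
    by move=> y yO; rewrite aa' ?(subsetP OB) //; case/andP: (pair_orbit_stable yO).
  by move=> y yO; rewrite bb' ?(subsetP OB) //; case/andP: (pair_orbit_stable yO).
apply/eqP; rewrite eqEsubset !sub //.
- by move=> y yB; rewrite ss'.
- by move=> y yB; rewrite tt'.
- by move=> y yB; rewrite -ss' ?sB.
- by move=> y yB; rewrite -tt' ?tB.
Qed.

Lemma porbit_agree B s s' x : x \in B -> {in B, s =1 s'} ->
  {in B, forall y, s y \in B} -> porbit s x = porbit s' x.
Proof.
move=> xB ss' sB.
have E i : ((s ^+ i)%g x \in B) && ((s ^+ i)%g x == (s' ^+ i)%g x).
  elim: i => [|i /andP[iB /eqP IH]]; first by rewrite !expg0 !perm1 xB eqxx.
  by rewrite !expgSr !permM -IH ss' // eqxx -ss' // sB.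
apply/setP => y; apply/porbitP/porbitP => -[i ->]; exists i;
  by case/andP: (E i) => _ /eqP.
Qed.

Section Split.
Import GroupScope.
Local Open Scope ring_scope.
Variables (A B : {set T}) (BA : B \subset A).

Lemma split_inB s1 s2 : perm_on B s1 -> perm_on (A :\: B) s2 ->
  {in B, (s1 * s2)%g =1 s1}.
Proof.
move=> s1B s2B y yB; rewrite permM (out_perm s2B) // inE perm_closed //.
by rewrite yB.
Qed.

Lemma split_inD s1 s2 : perm_on B s1 -> perm_on (A :\: B) s2 ->
  {in A :\: B, (s1 * s2)%g =1 s2}.
Proof.
by move=> s1B s2B y yB; rewrite permM (out_perm s1B) //; case/setDP: yB.
Qed.

Lemma split_on s1 s2 : perm_on B s1 -> perm_on (A :\: B) s2 ->
  perm_on A (s1 * s2)%g.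
Proof.
move=> s1B s2B; apply: perm_onM; first exact: subset_trans s1B BA.
by apply: subset_trans s2B _; apply: subsetDl.
Qed.

Lemma split_stableB s1 s2 : perm_on B s1 -> perm_on (A :\: B) s2 ->
  {in B, forall y, (s1 * s2)%g y \in B}.
Proof. by move=> s1B s2B y yB; rewrite split_inB // perm_closed. Qed.

Lemma split_stableD s1 s2 : perm_on B s1 -> perm_on (A :\: B) s2 ->
  {in A :\: B, forall y, (s1 * s2)%g y \in A :\: B}.
Proof. by move=> s1B s2B y yB; rewrite split_inD // perm_closed. Qed.

Lemma split_restrB s1 s2 : perm_on B s1 -> perm_on (A :\: B) s2 ->
  restr_perm B (s1 * s2)%g = s1.
Proof.
move=> s1B s2B; apply/permP => y; have [yB|yB] := boolP (y \in B).
  rewrite restr_permE ?stable_norm ?split_inB //; exact: split_stableB.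
by rewrite (out_perm (restr_perm_on _ _)) // (out_perm s1B).
Qed.

Lemma split_restrD s1 s2 : perm_on B s1 -> perm_on (A :\: B) s2 ->
  restr_perm (A :\: B) (s1 * s2)%g = s2.
Proof.
move=> s1B s2B; apply/permP => y; have [yB|yB] := boolP (y \in A :\: B).
  rewrite restr_permE ?stable_norm ?split_inD //; exact: split_stableD.
by rewrite (out_perm (restr_perm_on _ _)) // (out_perm s2B).
Qed.

Lemma restr_split s : perm_on A s -> {in B, forall y, s y \in B} ->
  (restr_perm B s * restr_perm (A :\: B) s)%g = s.
Proof.
move=> sA sB; have nB := stable_norm sB.
have nD : s \in 'N(A :\: B | 'P).
  apply: stable_norm => y /setDP[yA yB]; rewrite in_setD (perm_closed y sA) yA andbT.
  by have := astabs_act y nB; rewrite /= /aperm => ->.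
have rB := restr_perm_on B s; have rD := restr_perm_on (A :\: B) s.
apply/permP => y; have [yB|yB] := boolP (y \in B).
  by rewrite split_inB // restr_permE.
have [yD|yD] := boolP (y \in A :\: B); first by rewrite split_inD // restr_permE.
rewrite permM !(out_perm (restr_perm_on _ _)) // ?(out_perm sA) //.
by move: yD; rewrite inE yB.
Qed.

End Split.
End PairOrbits.

Section Weights.
Import GroupScope.
Local Open Scope ring_scope.
Variables (R : comNzRingType) (T : finType).
Implicit Types (u v : nat -> R) (s t : {perm T}) (A B C : {set T}).

Definition cycle_weight u B s : R := \prod_(V in porbit s @: B) u #|V|.

Definition perm_sum u B : R := \sum_(s | perm_on B s) cycle_weight u B s.

Definition transitive_sum u v B : R :=
  \sum_(st : {perm T} * {perm T}
        | [&& perm_on B st.1, perm_on B st.2 & transitive_on B st.1 st.2])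
    cycle_weight u B st.1 * cycle_weight v B st.2.

Lemma cycle_weight_agree u B s s' : {in B, s =1 s'} ->
  {in B, forall y, s y \in B} -> cycle_weight u B s = cycle_weight u B s'.
Proof.
move=> ss' sB; rewrite /cycle_weight; apply: eq_bigl => V; rewrite (_ : porbit s @: B = porbit s' @: B) //.
by apply: eq_in_imset => y yB; apply: porbit_agree yB ss' sB.
Qed.

Lemma cycle_weight_split u A B s : B \subset A -> perm_on A s ->
  {in B, forall y, s y \in B} ->
  cycle_weight u A s = cycle_weight u B s * cycle_weight u (A :\: B) s.
Proof.
move=> BA sA sB; rewrite /cycle_weight.
rewrite -[in LHS](setID A B) (setIidPr BA) imsetU.
rewrite (eq_bigl [predU porbit s @: B & porbit s @: (A :\: B)]); last first.
  by move=> V; rewrite !inE.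
rewrite bigU // disjoint_subset; apply/subsetP => V VB.
rewrite inE; apply/negP; move: VB.
move=> /imsetP[y yB ->] /imsetP[z /setDP[zA zB]] E.
case/negP: zB; have: z \in porbit s y by rewrite E porbit_id.
case/porbitP => i ->; elim: i => [|i IH]; first by rewrite perm1.
by rewrite expgSr permM sB.
Qed.

Lemma perm_sum0 u : perm_sum u set0 = 1.
Proof.
rewrite /perm_sum (bigD1 1%g) /= ?perm_on1 // big1 ?addr0.
  by rewrite /cycle_weight imset0 big_set0.
move=> s /andP[s0]; rewrite (perm_on_id s0) ?cards0 // eqxx //.
Qed.

(** A pair of permutations of [A] is the same as its orbit [B] through [x], a pair
 that is transitive on [B], and an arbitrary pair on the complement of [B]. *)
Lemma perm_sum_pair_split u v A x : x \in A ->
  perm_sum u A * perm_sum v A =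
  \sum_(B : {set T} | (B \subset A) && (x \in B))
    transitive_sum u v B * (perm_sum u (A :\: B) * perm_sum v (A :\: B)).
Proof.
move=> xA; rewrite /perm_sum big_distrlr /= pair_big /=.
rewrite (partition_big (fun p => pair_orbit p.1 p.2 x)
   (fun B => (B \subset A) && (x \in B))) /=; last first.
  move=> [s t] /= /andP[sA tA]; rewrite pair_orbit_refl andbT.
  by apply: pair_orbit_min => // y yA; rewrite perm_closed.
apply: eq_bigr => B /andP[BA xB].
rewrite /transitive_sum big_distrlr /= pair_big /= big_distrlr /= pair_big /=.
pose h (p : ({perm T} * {perm T}) * ({perm T} * {perm T})) :=
  ((p.1.1 * p.2.1)%g, (p.1.2 * p.2.2)%g).
pose h' (p : {perm T} * {perm T}) :=
  ((restr_perm B p.1, restr_perm B p.2),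
   (restr_perm (A :\: B) p.1, restr_perm (A :\: B) p.2)).
rewrite (reindex_onto h h') /=; last first.
  move=> [s t] /= /andP[/andP[sA tA] /eqP OB].
  by rewrite /h /h' /= !restr_split // => y; rewrite -OB => /pair_orbit_stable /andP[].
apply: eq_big => [[[s1 t1] [s2 t2]]|[[s1 t1] [s2 t2]]] /=.
  apply/idP/idP => [/andP[/andP[/andP[sA tA] /eqP OB] /eqP]|].
    case=> E1 E2 E3 E4.
    have s1B : perm_on B s1 by rewrite -E1 restr_perm_on.
    have t1B : perm_on B t1 by rewrite -E2 restr_perm_on.
    have s2B : perm_on (A :\: B) s2 by rewrite -E3 restr_perm_on.
    have t2B : perm_on (A :\: B) t2 by rewrite -E4 restr_perm_on.
    rewrite s1B t1B s2B t2B /= (transitive_onE _ _ xB) /= !andbT.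
    apply/eqP; rewrite -[RHS]OB; apply/esym/(pair_orbit_agree xB (split_inB s1B s2B)
      (split_inB t1B t2B) (split_stableB s1B s2B) (split_stableB t1B t2B)).
  case/andP => /and3P[s1B t1B tr] /andP[s2B t2B]; move: tr.
  rewrite (transitive_onE _ _ xB) /= => /eqP OB.
  rewrite (split_on BA s1B s2B) (split_on BA t1B t2B) /= /h' /h /=.
  rewrite (split_restrB s1B s2B) (split_restrB t1B t2B).
  rewrite (split_restrD s1B s2B) (split_restrD t1B t2B) eqxx andbT.
  apply/eqP; rewrite -[RHS]OB; apply: (pair_orbit_agree xB (split_inB s1B s2B)
      (split_inB t1B t2B) (split_stableB s1B s2B) (split_stableB t1B t2B)).
case/andP => /andP[/andP[sA tA] /eqP OB] /eqP [E1 E2 E3 E4].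
have s1B : perm_on B s1 by rewrite -E1 restr_perm_on.
have t1B : perm_on B t1 by rewrite -E2 restr_perm_on.
have s2B : perm_on (A :\: B) s2 by rewrite -E3 restr_perm_on.
have t2B : perm_on (A :\: B) t2 by rewrite -E4 restr_perm_on.
rewrite (cycle_weight_split u BA sA (split_stableB s1B s2B)).
rewrite (cycle_weight_split v BA tA (split_stableB t1B t2B)).
rewrite (cycle_weight_agree u (split_inB s1B s2B) (split_stableB s1B s2B)).
rewrite (cycle_weight_agree v (split_inB t1B t2B) (split_stableB t1B t2B)).
rewrite (cycle_weight_agree u (split_inD s1B s2B) (split_stableD s1B s2B)).
rewrite (cycle_weight_agree v (split_inD t1B t2B) (split_stableD t1B t2B)).
by rewrite mulrACA.
Qed.

End Weights.

(** * Decomposing sums along the block of a point *)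

Section ExponentialFormula.
Import GroupScope.
Local Open Scope ring_scope.
Variable R : comNzRingType.
Implicit Types (u v : nat -> R).

(** For a function of the cardinality, decomposing along the block of a point is
 the binomial convolution of exponential generating functions. *)
Lemma sum_subsets_through (T : finType) (f : nat -> R) (A : {set T}) x :
  x \in A ->
  \sum_(B : {set T} | (B \subset A) && (x \in B)) f #|B| =
  \sum_(k < #|A|) 'C(#|A|.-1, k)%:R * f k.+1.
Proof.
move=> xA; have Ax : #|A|.-1 = #|A :\ x| by rewrite (cardsD1 x A) xA.
have A0 : #|A| = #|A :\ x|.+1 by rewrite (cardsD1 x A) xA.
rewrite (reindex_onto (fun C => x |: C) (fun B => B :\ x)) /=; last first.
  by move=> B /andP[_ xB]; rewrite setD1K.
rewrite (eq_bigl (fun C : {set T} => C \subset A :\ x)); last first.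
  move=> C /=; rewrite subUset sub1set xA setU11 andbT /= subsetD1.
  have [xC|xC] := boolP (x \in C); last by rewrite setU1K // eqxx.
  rewrite andbF; apply/negP => /andP[_ /eqP E].
  by move: xC; rewrite -E !inE eqxx.
rewrite A0 /= (partition_big (fun C : {set T} => inord #|C| : 'I_#|A :\ x|.+1) predT) //=.
apply: eq_bigr => k _.
rewrite -cards_draws -[X in X%:R]sum1_card natr_sum mulr_suml.
apply: eq_big => [C|C /andP[CA /eqP <-]].
  rewrite inE; have [CA|] //= := boolP (C \subset A :\ x).
  by rewrite -val_eqE /= inordK // ltnS subset_leq_card.
rewrite mul1r cardsU1 inordK ?ltnS ?subset_leq_card //.
suff -> : x \notin C by [].
by apply: contraL CA => xC; apply/negP => /subsetP/(_ _ xC); rewrite !inE eqxx.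
Qed.

(** As a cycle weight this selects the identity permutation, so that statements on
 pairs of permutations specialize to single permutations. *)
Definition unit_at1 : nat -> R := fun k => (k == 1%N)%:R.

Lemma cycle_weight_at1 (T : finType) (A : {set T}) s : perm_on A s ->
  cycle_weight unit_at1 A s = (s == 1%g)%:R.
Proof.
move=> sA; have [->|s1] := eqVneq s 1%g.
  rewrite /cycle_weight big1 // => V /imsetP[x _ ->].
  rewrite /unit_at1 (_ : porbit 1 x = [set x]) ?cards1 //.
  apply/setP => y; rewrite inE; apply/porbitP/eqP => [[i ->]|->].
    by rewrite expg1n perm1.
  by exists 0%N; rewrite perm1.
have [x sx] : exists x, s x != x.
  apply/existsP; apply: contraR s1 => /existsPn H; apply/eqP/permP => x.
  by rewrite perm1; apply/eqP/negPn/H.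
have xA : x \in A by apply: contraR sx => /(out_perm sA)/eqP.
rewrite /cycle_weight (bigD1 (porbit s x)) ?imset_f //= /unit_at1.
have [/cards1P[y E]|_] := boolP (#|porbit s x| == 1%N); last by rewrite mul0r.
case/negP: sx; have := porbit_id s x; have := mem_porbit s 1 x.
by rewrite expg1 E !inE => /eqP -> /eqP ->.
Qed.

Lemma perm_sum_at1 (T : finType) (A : {set T}) : perm_sum unit_at1 A = 1 :> R.
Proof.
rewrite /perm_sum (bigD1 1%g) ?perm_on1 //= cycle_weight_at1 ?perm_on1 //.
rewrite eqxx big1 ?addr0 // => s /andP[sA s1].
by rewrite cycle_weight_at1 // (negPf s1).
Qed.

Lemma perm_sum_one (T : finType) (A : {set T}) :
  perm_sum (fun=> 1) A = (#|A|`!)%:R :> R.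
Proof.
rewrite -card_perm -sum1_card natr_sum; apply: eq_bigr => s _.
by rewrite /cycle_weight big1.
Qed.

(** The group generated by [s] and the identity is transitive exactly when [s] is a
 single cycle, whose weight is [u #|A|]. *)
Lemma transitive_sum_at1 (T : finType) u (A : {set T}) : A != set0 ->
  transitive_sum u unit_at1 A = transitive_sum (fun=> 1) unit_at1 A * u #|A|.
Proof.
case/set0Pn => x xA; rewrite /transitive_sum mulr_suml.
apply: eq_bigr => -[s t] /= /and3P[sA tA tr].
rewrite cycle_weight_at1 //; case: eqP tr => [->|]; rewrite ?mulr0 ?mul0r //.
rewrite !mulr1 (transitive_onE _ _ xA) => /eqP O.
rewrite [cycle_weight (fun=> 1) A s]big1 // mul1r.
have pE y : y \in A -> porbit s y = A.
  move=> yA; apply/eqP; rewrite eqEsubset; apply/andP; split.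
    apply/subsetP => z /porbitP[i ->]; elim: i => [|i IH]; first by rewrite perm1.
    by rewrite expgSr permM perm_closed.
  rewrite -{1}O; have: transitive_on A s 1 by rewrite (transitive_onE _ _ xA) O.
  rewrite (transitive_onE _ _ yA) => /eqP O'; rewrite O -{1}O'.
  apply: pair_orbit_min; rewrite ?porbit_id // => z; rewrite ?perm1 //.
  by case/porbitP => i ->; rewrite -permM -expgSr mem_porbit.
rewrite /cycle_weight (_ : porbit s @: A = [set A]) ?big_set1 //.
apply/setP => V; rewrite inE; apply/imsetP/eqP => [[y yA ->]|->]; first exact: pE.
by exists x; rewrite ?pE.
Qed.

Lemma card_setD_sub (T : finType) (A B : {set T}) n k : B \subset A ->
  #|A| = n -> #|B| = k -> #|A :\: B| = (n - k)%N.
Proof. by move=> BA <- <-; rewrite cardsD (setIidPr BA). Qed.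

(** The term [B = A] of the decomposition of [f A] contains [g A] with the factor
 1, and the other terms involve smaller sets. *)
Lemma sum_through_determines (T : finType) (f g : {set T} -> R)
    (phi ga : nat -> R) :
  f set0 = 1 -> (forall A, f A = phi #|A|) ->
  (forall (A : {set T}) x, x \in A ->
     f A = \sum_(B : {set T} | (B \subset A) && (x \in B)) g B * f (A :\: B)) ->
  (forall n, phi n.+1 = \sum_(k < n.+1) 'C(n, k)%:R * (ga k.+1 * phi (n - k)%N)) ->
  forall B : {set T}, B != set0 -> g B = ga #|B|.
Proof.
move=> f0 fphi frec phirec A; move: {2}#|A|.+1 (ltnSn #|A|) => m.
elim: m A => // m IH A Am /set0Pn[x xA].
have A0 : #|A| = #|A|.-1.+1 by rewrite (cardsD1 x A) xA.
have E1 := frec A x xA; have E2 := phirec #|A|.-1.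
have E3 := sum_subsets_through (fun k => ga k * phi (#|A| - k)%N) xA.
have E4 : \sum_(B : {set T} | (B \subset A) && (x \in B)) g B * f (A :\: B) =
  \sum_(B : {set T} | (B \subset A) && (x \in B)) ga #|B| * phi (#|A| - #|B|)%N.
  rewrite -E1 E3 fphi A0 E2; apply: eq_bigr => k _.
  by rewrite subSS.
move: E4; rewrite (bigD1 A) ?subxx //= [in RHS](bigD1 A) ?subxx //=.
rewrite setDv f0 mulr1 subnn.
have -> : phi 0%N = 1 by rewrite -f0 fphi cards0.
rewrite mulr1.
rewrite [X in _ + X](_ : _ = \sum_(B : {set T} | (B \subset A) && (x \in B) && (B != A))
   ga #|B| * phi (#|A| - #|B|)%N); first by move/addIr.
apply: eq_bigr => B /andP[/andP[BA xB] neB].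
rewrite fphi cardsD (setIidPr BA) IH //; last by apply/set0Pn; exists x.
by rewrite (leq_trans (proper_card _) (Am : (_ <= m)%N)) // properEneq neB.
Qed.

(** The number of cyclic permutations, read off from the total number of
 permutations: both families satisfy the same recursion. *)
Lemma transitive_sum_one_at1 (T : finType) (A : {set T}) : A != set0 ->
  transitive_sum (fun=> 1) unit_at1 A = ((#|A|.-1)`!)%:R :> R.
Proof.
move: A; apply: (@sum_through_determines T (fun A => perm_sum (fun=> 1) A)
  (transitive_sum (fun=> 1) unit_at1) (fun n => (n`!)%:R) (fun n => ((n.-1)`!)%:R)).
- exact: perm_sum0.
- exact: perm_sum_one.
- move=> A x xA; have := perm_sum_pair_split (fun=> 1) unit_at1 xA.
  rewrite perm_sum_at1 mulr1 => ->; apply: eq_bigr => B _.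
  by rewrite perm_sum_at1 mulr1.
move=> n; transitivity (\sum_(k < n.+1) (n`!)%:R : R).
  by rewrite sumr_const card_ord -mulrnA factS mulnC.
apply: eq_bigr => k _ /=.
by rewrite -!natrM bin_fact // -ltnS.
Qed.

Lemma perm_sum_split (T : finType) u (A : {set T}) x : x \in A ->
  perm_sum u A = \sum_(B : {set T} | (B \subset A) && (x \in B))
    ((#|B|.-1)`!)%:R * u #|B| * perm_sum u (A :\: B).
Proof.
move=> xA; have := perm_sum_pair_split u unit_at1 xA.
rewrite perm_sum_at1 mulr1 => ->; apply: eq_bigr => B /andP[_ xB].
have B0 : B != set0 by apply/set0Pn; exists x.
by rewrite perm_sum_at1 mulr1 transitive_sum_at1 // transitive_sum_one_at1.
Qed.

Definition perm_total u n : R := perm_sum u [set: 'I_n].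
Definition transitive_total u v n : R := transitive_sum u v [set: 'I_n].

Lemma perm_total0 u : perm_total u 0 = 1.
Proof.
rewrite /perm_total (_ : [set: _] = set0) ?perm_sum0 //.
by apply/setP => -[].
Qed.

(** The recursion along the cycle of a point involves nothing but cardinalities. *)
Lemma perm_sum_card (T : finType) u (A : {set T}) :
  perm_sum u A = perm_total u #|A|.
Proof.
move: {2}#|A|.+1 (ltnSn #|A|) => m; elim: m T A => // m IH T A Am.
have [->|/set0Pn[x xA]] := eqVneq A set0.
  by rewrite perm_sum0 cards0 perm_total0.
have step (T' : finType) (A' : {set T'}) y : #|A'| = #|A| -> y \in A' ->
   perm_sum u A' = \sum_(k < #|A|) 'C(#|A|.-1, k)%:R *
     ((k`!)%:R * u k.+1 * perm_total u (#|A| - k.+1)).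
  move=> A'A yA'; rewrite (perm_sum_split u yA').
  rewrite -A'A -(sum_subsets_through (fun k => ((k.-1)`!)%:R * u k
     * perm_total u (#|A'| - k)) yA').
  apply: eq_bigr => B /andP[BA yB]; congr (_ * _).
  rewrite IH; first by rewrite (card_setD_sub BA erefl erefl).
  have B0 : (0 < #|B|)%N by apply/card_gt0P; exists y.
  rewrite (card_setD_sub BA erefl erefl) (leq_trans _ (Am : (_ <= m)%N)) //.
  by rewrite -A'A ltn_subrL B0; apply/card_gt0P; exists y.
rewrite (step T A x) // /perm_total.
have A0 : (0 < #|A|)%N by apply/card_gt0P; exists x.
by rewrite (step _ _ (Ordinal A0)) ?cardsT ?card_ord ?inE.
Qed.

Lemma perm_totalS u n : perm_total u n.+1 =
  \sum_(k < n.+1) 'C(n, k)%:R * ((k`!)%:R * u k.+1 * perm_total u (n - k)).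
Proof.
rewrite {1}/perm_total (perm_sum_split u (in_setT (ord0 : 'I_n.+1))).
have := sum_subsets_through (fun k => ((k.-1)`!)%:R * u k
     * perm_total u (n.+1 - k)) (in_setT (ord0 : 'I_n.+1)).
rewrite cardsT card_ord /= => <-; apply: eq_bigr => B /andP[BT _].
congr (_ * _).
by rewrite perm_sum_card (card_setD_sub BT erefl erefl) cardsT card_ord.
Qed.

(** The decomposition determines [G T A] by induction on [#|A|], and hence as a
 function of [#|A|] alone; no transport of [G] along bijections is involved. *)
Lemma sum_through_recursion (G : forall T : finType, {set T} -> R)
    (phi : nat -> R) : phi 0%N = 1 ->
  (forall (T : finType) (A : {set T}) x, x \in A ->
     phi #|A| = \sum_(B : {set T} | (B \subset A) && (x \in B))
                   G T B * phi #|A :\: B|) ->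
  forall n, phi n.+1 =
    \sum_(k < n.+1) 'C(n, k)%:R * (G 'I_k.+1 [set: 'I_k.+1] * phi (n - k)%N).
Proof.
move=> phi0 phiE n.
pose ga m := if m is k.+1 then G 'I_k.+1 [set: 'I_k.+1] else 0.
have key (T : finType) (A : {set T}) m : #|A| = m.+1 ->
  (phi m.+1 = \sum_(k < m.+1) 'C(m, k)%:R * (ga k.+1 * phi (m - k)%N)) /\
  G T A = ga m.+1.
  have [N] := ubnP m; elim: N T A m => // N IH T A m mN Am.
  have sub (T' : finType) (B : {set T'}) : (0 < #|B| <= m)%N -> G T' B = ga #|B|.
    case/andP; case E : #|B| => [//|k] _ km.
    by case: (IH T' B k) => //; apply: leq_trans km _.
  have step (T' : finType) (A' : {set T'}) : #|A'| = m.+1 ->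
    phi m.+1 + ga m.+1 =
    \sum_(k < m.+1) 'C(m, k)%:R * (ga k.+1 * phi (m - k)%N) + G T' A'.
    move=> A'm; have /card_gt0P[x xA'] : (0 < #|A'|)%N by rewrite A'm.
    have := sum_subsets_through (fun k => ga k * phi (m.+1 - k)%N) xA'.
    rewrite A'm => <-; rewrite -{1}A'm (phiE _ _ _ xA').
    rewrite (bigD1 A') ?subxx //= [in RHS](bigD1 A') ?subxx //=.
    rewrite setDv cards0 A'm subnn phi0 !mulr1.
    rewrite [LHS]addrC addrA [RHS]addrAC; congr (_ + _ + _).
    apply: eq_bigr => B /andP[/andP[BA' xB] neB].
    rewrite (card_setD_sub BA' A'm erefl) sub //.
    apply/andP; split; first by apply/card_gt0P; exists x.
    by rewrite -ltnS -A'm proper_card // properEneq neB.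
  have E := step 'I_m.+1 [set: _]; rewrite cardsT card_ord in E.
  have /addIr E1 := E erefl; split=> //.
  by have := step T A Am; rewrite -E1 => /addrI.
by case: (key 'I_n.+1 [set: _] n); rewrite ?cardsT ?card_ord.
Qed.

(** The exponential formula for pairs, in differentiated form: with exponential
 generating functions, the product of the totals is the exponential of the
 transitive totals. *)
Lemma perm_total_pairS u v n :
  perm_total u n.+1 * perm_total v n.+1 =
  \sum_(k < n.+1) 'C(n, k)%:R * (transitive_total u v k.+1 *
     (perm_total u (n - k) * perm_total v (n - k))).
Proof.
apply: (@sum_through_recursion (fun T => transitive_sum u v)
  (fun n => perm_total u n * perm_total v n)).
  by rewrite !perm_total0 mulr1.
move=> T A x xA; rewrite -!perm_sum_card (perm_sum_pair_split u v xA).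
by apply: eq_bigr => B _; rewrite !perm_sum_card.
Qed.

End ExponentialFormula.

(** * The genus of a transitive pair *)

Section Genus.
Import GroupScope.
Local Open Scope ring_scope.
Variable T : finType.
Implicit Types (s t r : {perm T}) (C : {set T}) (L : seq (T * T)).

Definition invariant_under s C := forall y, (s y \in C) = (y \in C).

Lemma invariant_porbit s C x y : invariant_under s C ->
  y \in porbit s x -> (y \in C) = (x \in C).
Proof.
move=> sC /porbitP[i ->]; elim: i => [|i IH]; first by rewrite perm1.
by rewrite expgSr permM sC.
Qed.

Lemma porbit_invariant s x : invariant_under s (porbit s x).
Proof.
move=> y; rewrite -!eq_porbit_mem; congr (_ == _).
by have := porbit_perm s 1 y; rewrite expg1.
Qed.

Lemma invariant_mul s t C : invariant_under s C -> invariant_under t C ->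
  invariant_under (s * t)%g C.
Proof. by move=> sC tC y; rewrite permM tC sC. Qed.

Lemma invariant_tperm a b C : (a \in C) = (b \in C) ->
  invariant_under (tperm a b) C.
Proof. by move=> ab y; case: tpermP => [->|->|]. Qed.

(** The edges of [L] are additional connections. They preserve connectivity when a
 transposition is removed from [t]. *)
Definition connected_with s t L :=
  forall C, invariant_under s C -> invariant_under t C ->
    (forall e, e \in L -> (e.1 \in C) = (e.2 \in C)) -> C = set0 \/ C = setT.

Lemma connected_with_swap s t s' t' L L' :
  (forall C, invariant_under s' C -> invariant_under t' C ->
     (forall e, e \in L' -> (e.1 \in C) = (e.2 \in C)) ->
     [/\ invariant_under s C, invariant_under t C &
      forall e, e \in L -> (e.1 \in C) = (e.2 \in C)]) ->
  connected_with s t L -> connected_with s' t' L'.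
Proof. by move=> sub con C s'C t'C LC; case: (sub C) => // *; apply: con. Qed.

(** Connecting [c] components takes at least [c - 1] edges. In the induction an edge
 is replaced by the multiplication of [s] with a transposition, which joins two
 cycles. *)
Lemma porbits_edges_bound s L : connected_with s 1 L ->
  (#|porbits s| <= (size L).+1)%N.
Proof.
have triv C : invariant_under 1 C by move=> y; rewrite perm1.
elim: L s => [|[a b] L IH] s con /=.
  have all x : porbit s x = setT.
    case: (con (porbit s x)) => //; first exact: porbit_invariant.
    by move/setP/(_ x); rewrite porbit_id inE.
  apply: (@leq_trans #|[set [set: T]]|); last by rewrite cards1.
  by apply: subset_leq_card; apply/subsetP => V /imsetP[x _ ->]; rewrite all inE.
have [ab|nab] := boolP (a \in porbit s b).
  apply: leqW; apply: IH; apply: connected_with_swap con => C sC _ LC; split=> // e.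
  by rewrite inE => /orP[/eqP ->|/LC //]; exact: invariant_porbit ab.
(* Once the edge has joined two cycles of [s], it connects nothing new. *)
have E1 := porbits_mul_tperm s a b; rewrite /= nab in E1.
have neab : a != b by apply: contraNneq nab => ->; rewrite porbit_id.
rewrite neab in E1.
have E2 := porbits_mul_tperm (tperm a b * s) a b.
rewrite /= mulgA tperm2 mul1g neab in E2.
have ab' : a \in porbit (tperm a b * s) b.
  by case: (a \in porbit _ _) E2 => //=; lia.
suff : (#|porbits (tperm a b * s)| <= (size L).+1)%N.
  move: E1 => /=; move: #|porbits (tperm a b * s)| #|porbits s| => x y.
  lia.
apply: IH; apply: connected_with_swap con => C sC _ LC.
have abC := invariant_porbit sC ab'.
split=> // [|e]; last by rewrite inE => /orP[/eqP ->|/LC].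
have := invariant_mul (invariant_tperm abC) sC.
by rewrite mulgA tperm2 mul1g.
Qed.

(** Induction on [#|T| - #|porbits t|], the number of transpositions in a minimal
 factorization of [t]. Write [t] as a transposition [(a b)] times [t'], where [t']
 has one cycle more. If [a] and [b] lie on one cycle of [t' * s], restoring the
 transposition splits that cycle, so the sum of the counts is the same for [t] and
 [t'], and the connectivity is unchanged. Otherwise it merges two cycles and the
 sum drops by 2, which pays for the edge [(a, b)] that is added to [L]. *)
Lemma genus_bound_edges s t L : connected_with s t L ->
  (#|porbits s| + #|porbits t| + #|porbits (t * s)| <= #|T| + 2 + (size L).*2)%N.
Proof.
have card1 : #|porbits (1 : {perm T})| = #|T|.
  rewrite card_imset // => x y.
  have p1 z : porbit 1 z = [set z].
    apply/setP => w; rewrite inE; apply/porbitP/eqP => [[i ->]|->].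
      by rewrite expg1n perm1.
    by exists 0%N; rewrite perm1.
  by rewrite !p1 => /set1_inj.
have le_porb r : (#|porbits r| <= #|T|)%N by apply: leq_imset_card.
move: {2}(#|T| - #|porbits t|)%N (leqnn (#|T| - #|porbits t|)) => m.
elim: m t L => [|m IH] t L tm con; have [t1|t1] := eqVneq t 1%g; last 2 first.
- by rewrite t1 in con *; have := porbits_edges_bound con; rewrite mul1g card1; lia.
- have [a ta] : exists a, t a != a.
    apply/existsP; apply: contraR t1 => /existsPn H; apply/eqP/permP => x.
    by rewrite perm1; apply/eqP/negPn/H.
  set b := t a; pose t' := (tperm a b * t)%g.
  have tE : t = (tperm a b * t')%g by rewrite /t' mulgA tperm2 mul1g.
  have neab : a != b by rewrite eq_sym.
  have E1 := porbits_mul_tperm t a b.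
  have abt : a \in porbit t b by rewrite porbit_sym; have := mem_porbit t 1 a.
  rewrite /= -/t' neab abt /= in E1.
  have E2 := porbits_mul_tperm (t' * s) a b.
  rewrite /= mulgA -tE neab in E2.
  have t'm : (#|T| - #|porbits t'| <= m)%N.
    move: E1 tm; rewrite -/t'; move: (le_porb t').
    by move: #|porbits t'| #|porbits t| => x y /=; lia.
  have [abr|nabr] := boolP (a \in porbit (t' * s) b).
    suff : (#|porbits s| + #|porbits t'| + #|porbits (t' * s)| <=
        #|T| + 2 + (size L).*2)%N.
      rewrite abr /= in E2; move: E1 E2; rewrite /= -/t'.
      move: #|porbits (t' * s)| #|porbits (t * s)| #|porbits s| #|porbits t|.
      by move: #|porbits t'|; lia.
    apply: IH => //; apply: connected_with_swap con => C sC t'C LC; split=> //.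
    rewrite tE; apply: invariant_mul => //; apply: invariant_tperm.
    exact: invariant_porbit (invariant_mul t'C sC) abr.
  suff : (#|porbits s| + #|porbits t'| + #|porbits (t' * s)| <=
      #|T| + 2 + (size ((a, b) :: L)).*2)%N.
    rewrite nabr /= in E2; move: E1 E2; rewrite /= -/t'.
    move: #|porbits (t' * s)| #|porbits (t * s)| #|porbits s| #|porbits t|.
    by move: #|porbits t'|; lia.
  apply: IH => //; apply: connected_with_swap con => C sC t'C LC; split=> //.
    rewrite tE; apply: invariant_mul => //; apply: invariant_tperm.
    by have := LC (a, b); apply; rewrite inE eqxx.
  by move=> e eL; apply: LC; rewrite inE eL orbT.
- by rewrite t1 in con *; have := porbits_edges_bound con; rewrite mul1g card1; lia.
case/negP: t1; apply/eqP.
have /imset_injP inj : #|porbits t| == #|T| by move: (le_porb t) tm; lia.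
apply/permP => x; rewrite perm1; apply: inj => //; apply/eqP.
by rewrite eq_porbit_mem; have := mem_porbit t 1 x.
Qed.

Lemma genus_bound s t : transitive_on setT s t ->
  (#|porbits s| + #|porbits t| + #|porbits (s * t)| <= #|T| + 2)%N.
Proof.
move=> tr; have := @genus_bound_edges t s [::].
rewrite [X in (X + _ <= _)%N]addnC addn0; apply => C tC sC _.
have [->|/set0Pn[x xC]] := eqVneq C set0; [by left | right].
apply/eqP; rewrite eqEsubset subsetT -(eqP (_ : pair_orbit s t x == setT)) //.
  by apply: pair_orbit_min => // y yC; rewrite ?tC ?sC.
by rewrite -transitive_onE // inE.
Qed.

Lemma transitive_on_mul A s t : transitive_on A s (s^-1 * t) = transitive_on A s t.
Proof.
rewrite /transitive_on (_ : <<[set s; s^-1 * t]>>%g = <<[set s; t]>>%g) //.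
have sH (r r' : {perm T}) : r \in <<[set r; r']>>%g by rewrite mem_gen ?inE ?eqxx.
have tH (r r' : {perm T}) : r' \in <<[set r; r']>>%g.
  by rewrite mem_gen ?inE ?eqxx ?orbT.
apply/eqP; rewrite eqEsubset !gen_subG !subUset !sub1set !sH /=.
apply/andP; split; first by rewrite groupM ?groupV ?sH ?tH.
by rewrite -[X in X \in _](mulKVg s) groupM ?sH ?tH.
Qed.

(** Multiplicativity of the sign, as [s] has the parity of
 [#|T| - #|porbits s|]. *)
Lemma genus_parity s t : 
  odd (#|porbits s| + #|porbits t| + #|porbits (s * t)|) = odd #|T|.
Proof.
have := odd_permM s t; rewrite /odd_perm !oddD.
by do 4 case: odd.
Qed.

(** The bound leaves at most two cycles for [r], and parity excludes a single one. *)
Lemma planar_two_cycles s r : transitive_on setT s r ->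
  (#|porbits s| + #|porbits (s^-1 * r)| = #|T|)%N -> (0 < #|T|)%N ->
  #|porbits r| = 2.
Proof.
rewrite -transitive_on_mul => tr E /card_gt0P[x _].
have := genus_bound tr; have := genus_parity s (s^-1 * r).
rewrite mulKVg E oddD; have : (0 < #|porbits r|)%N.
  by apply/card_gt0P; exists (porbit r x); rewrite imset_f.
by case: (#|porbits r|) => [|[|[|k]]] //=; case: odd => //; lia.
Qed.

End Genus.

(** * Permutations with two cycles *)

Section Conjugation.
Import GroupScope.
Local Open Scope ring_scope.
Variable T : finType.
Implicit Types (s t r g : {perm T}).

Lemma porbitJ s g x : porbit (s ^ g)%g (g x) = g @: porbit s x.
Proof.
apply/setP => y; apply/porbitP/imsetP => [[i ->]|[z /porbitP[i ->] ->]].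
  by exists ((s ^+ i)%g x); rewrite ?mem_porbit // -conjXg permJ.
by exists i; rewrite -conjXg permJ.
Qed.

Lemma porbitsJ s g : porbits (s ^ g)%g = [set g @: V | V : {set T} in porbits s].
Proof.
apply/setP => W; apply/imsetP/imsetP => [[y _ ->]|[V /imsetP[x _ ->] ->]].
  by exists (porbit s (g^-1%g y)); rewrite ?imset_f // -porbitJ permKV.
by exists (g x); rewrite // porbitJ.
Qed.

Lemma card_porbitsJ s g : #|porbits (s ^ g)%g| = #|porbits s|.
Proof. by rewrite porbitsJ card_imset //; apply: imset_inj perm_inj. Qed.

Lemma transitive_onJ s t g :
  transitive_on setT (s ^ g)%g (t ^ g)%g = transitive_on setT s t.
Proof.
have imp (a b h : {perm T}) : transitive_on setT a b -> transitive_on setT (a ^ h)%g (b ^ h)%g.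
  move=> tr; have /imsetP[x _ _] := tr.
  rewrite (transitive_onE _ _ (in_setT (h x))) eqEsubset subsetT /=.
  have: pair_orbit a b x = setT by apply/eqP; rewrite -transitive_onE ?inE.
  set O := pair_orbit _ _ (h x) => aT.
  have sub : [set: T] \subset h @^-1: O.
    rewrite -aT; apply: pair_orbit_min => [|y|y]; rewrite !inE ?pair_orbit_refl //.
      by move/pair_orbit_stable; rewrite !permJ => /andP[].
    by move/pair_orbit_stable; rewrite !permJ => /andP[].
  apply/subsetP => y _; have := subsetP sub (h^-1%g y) (in_setT _).
  by rewrite inE permKV.
apply/idP/idP => [/(imp _ _ g^-1%g)|]; last exact: imp.
by rewrite !conjgK.
Qed.

End Conjugation.

Section Annular.
Import GroupScope.
Local Open Scope ring_scope.
Variable R : numFieldType.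
Implicit Type u : nat -> R.

(** The sum over the annular non-crossing permutations, with an arbitrary
 permutation [r] in place of the one that rotates the two circles. *)
Definition planar_sum (T : finType) u (r : {perm T}) : R :=
  \sum_(s : {perm T} | transitive_on setT s r &&
       (#|porbits s| + #|porbits (s^-1 * r)| == #|T|)%N)
    cycle_weight u setT s.

Lemma cycle_weightT (T : finType) u (s : {perm T}) :
  cycle_weight u setT s = \prod_(V in porbits s) u #|V|.
Proof.
apply: eq_bigl => V; apply/imsetP/imsetP => -[x _ ->]; by exists x.
Qed.

Lemma planar_sum_annulus u (t s : nat) :
  planar_sum u (annulus_perm t s) =
  \sum_(sigma in annular_noncrossing t s) block_prod u (porbits sigma).
Proof.
apply: eq_big => [r|r _]; first by rewrite /annular_noncrossing inE card_ord.
by rewrite cycle_weightT.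
Qed.

Lemma planar_sumJ (T : finType) u (r g : {perm T}) :
  planar_sum u (r ^ g)%g = planar_sum u r.
Proof.
rewrite /planar_sum (reindex_inj (conjg_inj g)) /=; apply: eq_big => s.
  by rewrite transitive_onJ -conjVg -conjMg !card_porbitsJ.
move=> _; rewrite !cycle_weightT porbitsJ big_imset /=.
  by apply: eq_bigr => V _; rewrite card_imset //; apply: perm_inj.
by move=> V W _ _; apply: imset_inj; apply: perm_inj.
Qed.

Lemma planar_sum_eq0 (T : finType) u (r : {perm T}) : (0 < #|T|)%N ->
  #|porbits r| != 2 -> planar_sum u r = 0.
Proof.
move=> T0 r2; rewrite /planar_sum big_pred0 // => s.
apply/negP => /andP[tr /eqP E]; case/negP: r2.
by rewrite (planar_two_cycles tr E T0).
Qed.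

Lemma annulus_permXl t s (i j : nat) (ij : (i + j < t)%N) (i0 : (i < t)%N) :
  (annulus_perm t s ^+ j)%g (lshift s (Ordinal i0)) = lshift s (Ordinal ij).
Proof.
elim: j ij => [|j IH] ij.
  by rewrite perm1; congr lshift; apply: val_inj; rewrite /= addn0.
have ij' : (i + j < t)%N by lia.
rewrite expgSr permM (IH ij') permE /annulus_fun (unsplitK (inl _)).
by congr lshift; apply: val_inj; rewrite /= -addnS modn_small.
Qed.

Lemma annulus_permXr t s (i j : nat) (ij : (i + j < s)%N) (i0 : (i < s)%N) :
  (annulus_perm t s ^+ j)%g (rshift t (Ordinal i0)) = rshift t (Ordinal ij).
Proof.
elim: j ij => [|j IH] ij.
  by rewrite perm1; congr rshift; apply: val_inj; rewrite /= addn0.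
have ij' : (i + j < s)%N by lia.
rewrite expgSr permM (IH ij') permE /annulus_fun (unsplitK (inr _)).
by congr rshift; apply: val_inj; rewrite /= -addnS modn_small.
Qed.

Lemma porbit_annulus_l t s (t0 : (0 < t)%N) :
  porbit (annulus_perm t s) (lshift s (Ordinal t0)) = [set lshift s j | j : 'I_t].
Proof.
apply/setP => y; apply/porbitP/imsetP => [[i ->]|[j _ ->]].
  elim: i => [|i [j _ E]]; first by exists (Ordinal t0); rewrite ?perm1.
  exists (ordS j) => //.
  by rewrite expgSr permM E permE /annulus_fun (unsplitK (inl _)).
exists j; rewrite annulus_permXl ?add0n // => lt.
by congr lshift; apply: val_inj.
Qed.

Lemma expg_porbit_inj (T : finType) (r : {perm T}) x i j :
  (i < #|porbit r x|)%N -> (j < #|porbit r x|)%N ->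
  (r ^+ i)%g x = (r ^+ j)%g x -> i = j.
Proof.
move=> ix jx; rewrite !permX -(nth_traject r ix) -(nth_traject r jx) => /eqP.
by rewrite nth_uniq ?size_traject ?uniq_traject_porbit // => /eqP.
Qed.

Lemma card_other_porbit (T : finType) (r : {perm T}) a b :
  #|porbits r| = 2 -> b \notin porbit r a ->
  (#|porbit r a| + #|porbit r b| = #|T|)%N.
Proof.
move=> r2 ba; have neAB : porbit r a != porbit r b.
  by rewrite eq_sym eq_porbit_mem.
have E : porbits r = [set porbit r a; porbit r b].
  apply/esym/eqP; rewrite eqEcard cards2 neAB r2 leqnn andbT.
  by apply/subsetP => V /set2P[] ->; rewrite imset_f.
rewrite -cardsUI (_ : _ :&: _ = set0) ?cards0 ?addn0.
  apply: eq_card => x; rewrite !inE.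
  have: porbit r x \in porbits r by rewrite imset_f.
  by rewrite E => /set2P[] <-; rewrite porbit_id ?orbT.
apply/setP => x; rewrite !inE; apply/negP => /andP[].
rewrite -!eq_porbit_mem => /eqP Ea /eqP Eb.
by rewrite -Ea Eb eqxx in neAB.
Qed.

(** A conjugator is determined by the images [a] and [b] of the base points of the
 two circles, since it carries the cycles of the annulus permutation to those of
 [r]. Any [a] on a cycle of length [t] and [b] on the other cycle occur. *)
Lemma card_conj_annulus t s (t0 : (0 < t)%N) (s0 : (0 < s)%N)
    (r : 'S_(t + s)) : #|porbits r| = 2 ->
  #|[set g : 'S_(t + s) | (annulus_perm t s ^ g)%g == r]| =
  #|[set ab : 'I_(t + s) * 'I_(t + s) |
      (#|porbit r ab.1| == t) && (ab.2 \notin porbit r ab.1)]|.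
Proof.
move=> r2; set l0 := lshift s (Ordinal t0); set r0 := rshift t (Ordinal s0).
have gamma_l (j : 'I_t) : (annulus_perm t s ^+ j)%g l0 = lshift s j.
  by rewrite annulus_permXl ?add0n // => lt; congr lshift; apply: val_inj.
have gamma_r (j : 'I_s) : (annulus_perm t s ^+ j)%g r0 = rshift t j.
  by rewrite annulus_permXr ?add0n // => lt; congr rshift; apply: val_inj.
pose f (g : 'S_(t + s)) := (g l0, g r0).
have f_inj : {in [set g : 'S_(t + s) | (annulus_perm t s ^ g)%g == r] &, injective f}.
  move=> g h /[!inE] /eqP Eg /eqP Eh [El Er]; apply/permP => i.
  rewrite -(splitK i); case: (split i) => j /=.
    by rewrite -gamma_l -[LHS]permJ -[RHS]permJ !conjXg Eg Eh El.
  by rewrite -gamma_r -[LHS]permJ -[RHS]permJ !conjXg Eg Eh Er.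
rewrite -(card_in_imset f_inj); apply: eq_card => -[a b].
rewrite [in RHS]inE /=; apply/imsetP/andP.
  case=> g /[!inE] /eqP <- [-> ->]; rewrite porbitJ porbit_annulus_l.
  rewrite !card_imset; first last; try exact: lshift_inj; try exact: perm_inj.
  rewrite card_ord eqxx; split=> //; apply/imsetP => -[y yl /perm_inj E].
  by case/imsetP: yl E => j _ -> /eqP; rewrite eq_sym eq_lrshift.
case=> /eqP at_ ba; have := card_other_porbit r2 ba.
rewrite at_ card_ord => /addnI bs.
(* The conjugator rotates the first circle from [a] and the second from [b]. *)
pose h (i : 'I_(t + s)) := match split i with
  | inl j => (r ^+ nat_of_ord j)%g a
  | inr k => (r ^+ nat_of_ord k)%g b
  end.
have nab j k : (r ^+ j)%g a != (r ^+ k)%g b.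
  apply: contra ba => /eqP E.
  by rewrite -eq_porbit_mem -(porbit_perm r k b) -E porbit_perm.
have h_inj : injective h.
  move=> i j; rewrite /h -{2}(splitK i) -{2}(splitK j).
  case: (split i) => i'; case: (split j) => j' /= E.
  - congr lshift; apply: val_inj; apply: expg_porbit_inj E; rewrite at_ //.
  - by have := nab i' j'; rewrite E eqxx.
  - by have := nab j' i'; rewrite E eqxx.
  - congr rshift; apply: val_inj; apply: expg_porbit_inj E; rewrite bs //.
have wrap x m (j : 'I_m) : #|porbit r x| = m ->
    (r ^+ (ordS j))%g x = r ((r ^+ j)%g x).
  move=> xm; rewrite -permM -expgSr /=.
  have [lt|] := ltnP j.+1 m; first by rewrite modn_small.
  move=> le; have -> : j.+1 = m by apply/eqP; rewrite eqn_leq le ltn_ord.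
  by rewrite modnn perm1 permX -xm iter_porbit.
exists (perm h_inj).
  rewrite inE; apply/eqP/permP => x; rewrite -[x](permKV (perm h_inj)).
  rewrite permJ; move: ((perm h_inj)^-1%g x) => i; rewrite !permE /h /annulus_fun.
  by case: (split i) => j; rewrite ?(unsplitK (inl _)) ?(unsplitK (inr _)) wrap.
rewrite /f !permE /h (unsplitK (inl _)) (unsplitK (inr _)) /=.
by rewrite !perm1.
Qed.

(** Each cycle of length [l] contributes [l] times [1/l]. *)
Lemma sum_inv_porbit (T : finType) (r : {perm T}) :
  \sum_x (#|porbit r x|%:R)^-1 = #|porbits r|%:R :> R.
Proof.
rewrite -sum1_card natr_sum (partition_big (porbit r) (mem (porbits r))) /=;
  last by move=> x _; rewrite imset_f.
apply: eq_bigr => V /imsetP[y _ ->].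
rewrite (eq_bigr (fun=> (#|porbit r y|%:R)^-1)) => [|x /eqP -> //].
rewrite sumr_const -[X in X *+ _]mulr1 -mulrnAr.
rewrite (_ : #|_| = #|porbit r y|) ?mulVf ?pnatr_eq0 ?card_porbit_neq0 //.
by apply: eq_card => x; rewrite -eq_porbit_mem.
Qed.

(** Only permutations [r] with two cycles contribute, and these are the conjugates
 of the annulus permutations. Summing over conjugators counts [r] once for every
 pair of base points with cycle lengths [t] and [n - t]; divided by
 [t (n - t)] and summed over [t], these counts give the number of cycles of [r],
 which is the factor 2. *)
Lemma sum_planar_two_cycles u n : (0 < n)%N ->
  \sum_(r : 'S_n) planar_sum u r =
  (n`!)%:R / 2 * \sum_(1 <= t < n)
     planar_sum u (annulus_perm t (n - t)) / (t%:R * (n - t)%:R).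
Proof.
move=> n0.
pose c (r : 'S_n) t := #|[set ab : 'I_n * 'I_n |
      (#|porbit r ab.1| == t) && (ab.2 \notin porbit r ab.1)]|.
have step t : (0 < t < n)%N -> (n`!)%:R * planar_sum u (annulus_perm t (n - t)) =
    \sum_(r : 'S_n) planar_sum u r * (c r t)%:R.
  move=> /andP[t0 tn]; have s0 : (0 < n - t)%N by rewrite subn_gt0.
  rewrite /c; have := subnKC (ltnW tn).
  move: (n - t)%N s0 => s s0 E; subst n.
  rewrite -card_Sn -sum1_card natr_sum mulr_suml.
  under eq_bigr => g _ do rewrite mul1r -(planar_sumJ u (annulus_perm t s) g).
  rewrite (partition_big (fun g => annulus_perm t s ^ g)%g predT) //=.
  apply: eq_bigr => r _.
  have [r2|r2] := eqVneq #|porbits r| 2; last first.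
    rewrite planar_sum_eq0 ?card_ord // mul0r big1 // => g /eqP ->.
    by rewrite planar_sum_eq0 ?card_ord.
  rewrite -card_conj_annulus // (eq_bigr (fun=> planar_sum u r)) => [|g /eqP -> //].
  by rewrite sumr_const mulr_natr; congr (_ *+ _); apply: eq_card => g; rewrite inE.
rewrite mulrAC mulr_sumr.
have -> : \sum_(1 <= t < n) (n`!)%:R *
     (planar_sum u (annulus_perm t (n - t)) / (t%:R * (n - t)%:R)) =
   \sum_(1 <= t < n) \sum_(r : 'S_n) planar_sum u r * ((c r t)%:R / (t%:R * (n - t)%:R)).
  rewrite !big_nat; apply: eq_bigr => t tn; rewrite mulrA step // mulr_suml.
  by apply: eq_bigr => r _; rewrite mulrA.
rewrite exchange_big mulr_suml; apply: eq_bigr => r _ /=.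
have [r2|r2] := eqVneq #|porbits r| 2; last first.
  rewrite planar_sum_eq0 ?card_ord // big1 ?mul0r // => t _.
  by rewrite mul0r.
rewrite -mulr_sumr -mulrA.
suff -> : \sum_(1 <= t < n) (c r t)%:R / (t%:R * (n - t)%:R) = 2 :> R.
  by rewrite divff ?mulr1 // pnatr_eq0.
have orb_lt a : (0 < #|porbit r a| < n)%N.
  rewrite lt0n card_porbit_neq0 /= ltn_neqAle -[X in (_ <= X)%N]card_ord max_card.
  rewrite andbT; apply/eqP => E.
  suff : (#|porbits r| <= #|[set porbit r a]|)%N by rewrite cards1 r2.
  apply: subset_leq_card; apply/subsetP => V /imsetP[x _ ->].
  rewrite inE eq_porbit_mem.
  suff -> : porbit r a = [set: 'I_n] by rewrite inE.
  by apply/eqP; rewrite eqEcard subsetT cardsT card_ord E leqnn.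
have cE t : (c r t)%:R =
    \sum_a (#|porbit r a| == t)%:R * (n - #|porbit r a|)%:R :> R.
  rewrite /c -sum1dep_card -(pair_big_dep (fun a => #|porbit r a| == t)
    (fun a b => b \notin porbit r a) (fun _ _ => 1%N)) /= natr_sum big_mkcond /=.
  apply: eq_bigr => a _; case: ifP => _; rewrite ?mul0r // mul1r.
  rewrite sum1_card; congr (_%:R).
  rewrite -[X in (X - _)%N]card_ord -(cardC (porbit r a)) addKn.
  by apply: eq_card => b; rewrite !inE.
under eq_bigr => t _ do rewrite cE mulr_suml.
rewrite exchange_big /=; transitivity (#|porbits r|%:R : R); last by rewrite r2.
rewrite -sum_inv_porbit.
apply: eq_bigr => a _; have /andP[a0 an] := orb_lt a.
rewrite (bigD1_seq #|porbit r a|) ?mem_index_iota ?a0 ?iota_uniq //= eqxx mul1r.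
rewrite big1 ?addr0 => [|t]; last by rewrite eq_sym => /negPf ->; rewrite !mul0r.
rewrite invfM mulrCA divff ?mulr1 // pnatr_eq0 -lt0n subn_gt0 //.
Qed.

End Annular.

(** * The genus expansion of moments in cumulants *)

Section GenusExpansion.
Import GroupScope.
Local Open Scope ring_scope.
Variable R : numFieldType.
Implicit Types (d : R) (ka : nat -> R).

(** This is [d (d-1) ... (d-k+1) / d^k], up to [d^k] the factor in [D^k x^d]. *)
Definition falling_weight d k : R := \prod_(i < k) (1 - i%:R / d).

Lemma ffact_weight (d n : nat) : (0 < d)%N ->
  (d ^_ n)%:R = d%:R ^+ n * falling_weight d%:R n :> R.
Proof.
move=> d0; have dn0 : d%:R != 0 :> R by rewrite pnatr_eq0 -lt0n.
elim: n => [|n IH]; first by rewrite /falling_weight big_ord0 mulr1.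
rewrite ffactnSr natrM IH /falling_weight big_ord_recr /= exprSr.
have [nd|dn] := leqP n d; first by rewrite natrB //; field.
rewrite -IH ffact_small // mul0r.
rewrite [X in _ * _ * (X * _)](_ : _ = 0) ?mul0r ?mulr0 //.
by rewrite (bigD1 (Ordinal dn)) //= divff // subrr mul0r.
Qed.

(** By Euler's formula this is [|st| - 1 + 2 g] for a transitive pair of genus [g]. *)
Definition genus_defect n (st : 'S_n * 'S_n) : nat :=
  (n.+1 - (#|porbits st.1| + #|porbits st.2|))%N.

(** The moments whose cumulants are the constants [ka], as an expansion in the
 genus. The truncated subtraction in [genus_defect] is exact on transitive pairs. *)
Definition genus_moment (eps : R) ka (n : nat) : R :=
  if n == 0%N then 1 else
  (n.-1`!)%:R^-1 * \sum_(st : 'S_n * 'S_n | transitive_on setT st.1 st.2)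
     cycle_weight ka setT st.1 * (- eps) ^+ genus_defect st.

Lemma sum_card_porbits n (s : 'S_n) : (\sum_(V in porbits s) #|V| = n)%N.
Proof.
rewrite -[RHS]card_ord -sum1_card (partition_big (porbit s) (mem (porbits s))) /=;
  last by move=> x _; rewrite imset_f.
apply: eq_bigr => V /imsetP[y _ ->]; rewrite sum1_card.
by apply: eq_card => x; rewrite -eq_porbit_mem.
Qed.

Lemma transitive_porbits_leq n (s t : 'S_n) : (0 < n)%N ->
  transitive_on setT s t -> (#|porbits s| + #|porbits t| <= n.+1)%N.
Proof.
move=> n0 /genus_bound; rewrite card_ord => E.
have : (0 < #|porbits (s * t)|)%N.
  by apply/card_gt0P; exists (porbit (s * t) (Ordinal n0)); rewrite imset_f.
by move: E; move: #|porbits (s * t)| #|porbits s| #|porbits t|; lia.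
Qed.

(** With these weights a permutation counts as its sign times [d] to the number of
 cycles, so this is the expansion of the falling factorial by Stirling numbers. *)
Lemma perm_total_falling (d : R) n : d != 0 ->
  perm_total (fun k => (-1) ^+ k.+1 * d) n = d ^+ n * falling_weight d n.
Proof.
move=> d0; set v := fun k => _.
have step m : perm_total v m.+1 = (d - m%:R) * perm_total v m.
  case: m => [|m]; rewrite perm_totalS big_ord_recl /= bin0 subn0 fact0.
    by rewrite big_ord0 /v !perm_total0; ring.
  rewrite -(_ : - (m.+1%:R * perm_total v m.+1) =
    \sum_(i < m.+1) 'C(m.+1, bump 0 i)%:R * (((bump 0 i)`!)%:R *
      v (bump 0 i).+1 * perm_total v (m.+1 - bump 0 i))); first by rewrite /v; ring.
  rewrite {1}perm_totalS mulr_sumr -sumrN; apply: eq_bigr => i _.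
  rewrite /bump /= add1n subSS factS natrM /v.
  have := mul_bin_diag m.+1 i; move/(congr1 (fun x => x%:R : R)); rewrite !natrM => E.
  rewrite [(-1) ^+ i.+3]exprS.
  transitivity (- (m.+1%:R * 'C(m, i)%:R) * ((i`!)%:R * ((-1) ^+ i.+2 * d) *
     perm_total v (m - i))); first by ring.
  by rewrite E; ring.
elim: n => [|n IH]; first by rewrite perm_total0 /falling_weight big_ord0 mulr1.
by rewrite step IH /falling_weight big_ord_recr /= exprSr; field.
Qed.

(** The powers of [d] in the two cycle weights and in [d^-n] combine to the genus
 defect. *)
Lemma transitive_total_genus (d : R) ka n : (0 < n)%N -> d != 0 ->
  transitive_total (fun k => - d * (ka k * d^-1 ^+ k)) (fun k => (-1) ^+ k.+1 * d) n =
  - d * ((n.-1`!)%:R * genus_moment d^-1 ka n).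
Proof.
move=> n0 d0; rewrite /genus_moment -[n == _]negbK -lt0n n0 /= mulVKf; last first.
  by rewrite pnatr_eq0 -lt0n fact_gt0.
rewrite mulr_sumr /transitive_total /transitive_sum.
apply: eq_big => [st|st].
  have pT (s : 'S_n) : perm_on setT s by apply/subsetP => x; rewrite inE.
  by rewrite !pT.
case/and3P => _ _ tr; rewrite !cycle_weightT !big_split /=.
rewrite !prodr_const prodrXr sum_card_porbits.
have -> : \prod_(V in porbits st.2) (-1) ^+ #|V|.+1 =
    (-1) ^+ #|porbits st.2| * (-1) ^+ n :> R.
  rewrite -exprD prodrXr; congr (_ ^+ _).
  rewrite -[X in (_ + X)%N](sum_card_porbits st.2) -sum1_card -big_split /=.
  by apply: eq_bigr => V _; rewrite add1n.
have le := transitive_porbits_leq n0 tr; rewrite /genus_defect.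
move: le; move: #|porbits st.1| #|porbits st.2| => i j le.
have -> : - d^-1 = (- d)^-1 by rewrite invrN.
rewrite !exprVn; have nd0 : - d != 0 by rewrite oppr_eq0.
have E : (- d) ^+ i * (- d) ^+ j * (- d) ^+ (n.+1 - (i + j)) =
    - d * ((-1) ^+ n * d ^+ n).
  by rewrite -!exprD subnKC // exprS -exprMn mulN1r.
have Yj : (-1) ^+ j * d ^+ j = (- d) ^+ j by rewrite -exprMn mulN1r.
have SS : (-1) ^+ n * (-1) ^+ n = 1 :> R by rewrite -expr2 sqrr_sign.
move: (\prod_(i0 in _) _) => w.
have Z0 := expf_neq0 (n.+1 - (i + j)) nd0; have P0 := expf_neq0 n d0.
rewrite [(-1) ^+ j * _ * _]mulrAC Yj.
(* Multiplying by [Z], the power of [- d] in the denominator, avoids negative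
   exponents. *)
move: ((- d) ^+ (n.+1 - (i + j))) E Z0 => Z E Z0.
move: ((- d) ^+ i) ((- d) ^+ j) E => X Y E.
apply: (mulIf Z0); rewrite -[RHS]mulrA -[w / Z * Z]mulrA mulVf // mulr1.
transitivity (X * Y * Z * ((-1) ^+ n * w / d ^+ n)); first by ring.
rewrite E.
transitivity (- d * w * ((-1) ^+ n * (-1) ^+ n) * (d ^+ n / d ^+ n)); first by ring.
by rewrite SS divff // !mulr1.
Qed.

(** A defect of 1 says that [|s| + |t| = n], which is the condition in
 [planar_sum] for [r = s t]; so the sum over pairs is a sum over [r]. *)
Lemma genus_defect1_sum ka n : (0 < n)%N ->
  \sum_(st : 'S_n * 'S_n | transitive_on setT st.1 st.2 && (genus_defect st == 1%N))
     cycle_weight ka setT st.1 =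
  (n.-1`!)%:R * (n%:R / 2 * \sum_(1 <= t < n)
     \sum_(sigma in annular_noncrossing t (n - t))
        block_prod ka (porbits sigma) / (t%:R * (n - t)%:R)).
Proof.
move=> n0; rewrite !mulrA -natrM mulnC.
rewrite (_ : n * _ = n`!)%N; last by rewrite -{1}(prednK n0) -factS prednK.
under [in RHS]eq_bigr => t _ do rewrite -mulr_suml -planar_sum_annulus.
rewrite -sum_planar_two_cycles // /planar_sum pair_big_dep /=.
(* A pair [(r, s)] with [r = s t] against the pair [(s, t)]. *)
pose h (rs : 'S_n * 'S_n) := (rs.2, rs.2^-1 * rs.1)%g.
pose h' (st : 'S_n * 'S_n) := (st.1 * st.2, st.1)%g.
rewrite (reindex_onto h h') /=; last first.
  by move=> [s t] _; rewrite /h /h' /= mulKg.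
apply: eq_bigl => -[r s] /=; rewrite /h /h' /= mulKVg eqxx andbT transitive_on_mul.
have [tr|] //= := boolP (transitive_on _ _ _).
rewrite /genus_defect /= card_ord.
have := @transitive_porbits_leq _ s (s^-1 * r)%g n0.
rewrite transitive_on_mul => /(_ tr).
move: #|porbits s| #|porbits (s^-1 * r)| => i j ij.
by apply/eqP/eqP; lia.
Qed.

Definition genus_coef ka n e : R :=
  (n.-1`!)%:R^-1 *
  \sum_(st : 'S_n * 'S_n | transitive_on setT st.1 st.2 && (genus_defect st == e))
     cycle_weight ka setT st.1.

Lemma genus_momentE eps ka n : (0 < n)%N ->
  genus_moment eps ka n = \sum_(e < n.+2) genus_coef ka n e * (- eps) ^+ e.
Proof.
case: n => // n _; rewrite /genus_moment /genus_coef /=.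
under [in RHS]eq_bigr => e _ do rewrite -mulrA mulr_suml.
rewrite -mulr_sumr; congr (_ * _).
rewrite (partition_big (fun st => inord (genus_defect st) : 'I_n.+3) predT) //=.
apply: eq_bigr => e _; apply: eq_big => [st|st /andP[_ /eqP <-]].
  by rewrite -val_eqE /= inordK // ltnS leq_subLR leq_addl.
by rewrite inordK // ltnS leq_subLR leq_addl.
Qed.

Lemma genus_coef1 ka n : (0 < n)%N ->
  genus_coef ka n 1 = n%:R / 2 * \sum_(1 <= t < n)
     \sum_(sigma in annular_noncrossing t (n - t))
        block_prod ka (porbits sigma) / (t%:R * (n - t)%:R).
Proof.
move=> n0; rewrite /genus_coef genus_defect1_sum // mulKf //.
by rewrite pnatr_eq0 -lt0n fact_gt0.
Qed.

End GenusExpansion.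

(** * Non-crossing partitions of an interval *)

Ltac order_lia :=
  repeat match goal with
  | H : is_true (_ \in _) |- _ => clear H
  | H : is_true (_ \notin _) |- _ => clear H
  | H : is_true (_ \subset _) |- _ => clear H
  | H : is_true (~~ (_ \subset _)) |- _ => clear H
  | H : is_true [disjoint _ & _] |- _ => clear H
  | H : forall _, _ |- _ => clear H
  end; lia.

Section NoncrossingIntervals.
Variable N : nat.
Implicit Types (A V W : {set 'I_N}) (P : {set {set 'I_N}}).

Definition nc_partition A P : bool :=
  partition P A &&
  [forall V in P, forall W in P, (V != W) ==> ~~ crossing V W].

Lemma nc_partitionP A P : reflect
  [/\ set0 \notin P,
      forall V x, V \in P -> x \in V -> x \in A,
      forall x, x \in A -> exists2 V, V \in P & x \in V,
      forall V W x, V \in P -> W \in P -> x \in V -> x \in W -> V = W &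
      forall V W (i j k l : 'I_N), V \in P -> W \in P ->
        i \in V -> j \in W -> k \in V -> l \in W ->
        (i < j)%N -> (j < k)%N -> (k < l)%N -> V = W]
  (nc_partition A P).
Proof.
apply: (iffP andP) => [[partP ncP]|[P0 PA AP trP ncP]]; split.
- by rewrite (partition0 partP).
- by move=> V x /(partitionS partP)/subsetP; apply.
- by move=> x; rewrite -(cover_partition partP) => /bigcupP[V VP xV]; exists V.
- move=> V W x VP WP xV xW; have tr := partition_trivIset partP.
  by rewrite -(def_pblock tr VP xV) (def_pblock tr WP xW).
- move=> V W i j k l VP WP iV jW kV lW ij jk kl.
  have /forall_inP/(_ V VP)/forall_inP/(_ W WP) := ncP.
  case: eqP => //= _ /existsP[]; exists i; rewrite iV; apply/existsP; exists j.
  rewrite jW; apply/existsP; exists k; rewrite kV; apply/existsP; exists l.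
  by rewrite lW ij jk kl.
- apply/and3P; split=> //.
    apply/eqP/setP => x; apply/bigcupP/idP => [[V VP xV]|/AP[V VP xV]].
      exact: PA xV.
    by exists V.
  apply/trivIsetP => V W VP WP; apply: contraR => /pred0Pn[x /andP[/= xV xW]].
  by apply/eqP; apply: trP xW.
apply/forall_inP => V VP; apply/forall_inP => W WP; apply/implyP.
apply: contraNN => /existsP[i /andP[iV /existsP[j /andP[jW /existsP[k /andP[kV
  /existsP[l /andP[lW /and3P[ij jk kl]]]]]]]]].
by apply/eqP; apply: ncP iV jW kV lW ij jk kl.
Qed.

Definition ord_interval (a b : nat) : {set 'I_N} := [set i : 'I_N | (a <= i < b)%N].

Lemma in_interval a b (i : 'I_N) : (i \in ord_interval a b) = (a <= i < b)%N.
Proof. by rewrite inE. Qed.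

Section Split.
Variables (a c : 'I_N) (b : nat).
Hypotheses (ac : (a < c)%N) (cb : (c < b)%N).

(** [c] is the successor of [a] inside its block. *)
Definition next_in_block P : bool :=
  [exists V in P, [&& a \in V, c \in V & [disjoint V & ord_interval a.+1 c]]].

Definition attach W : {set 'I_N} := if c \in W then a |: W else W.

Definition glue (Q : {set {set 'I_N}} * {set {set 'I_N}}) : {set {set 'I_N}} :=
  Q.1 :|: attach @: Q.2.

Definition cut P : {set {set 'I_N}} * {set {set 'I_N}} :=
  ([set V in P | V \subset ord_interval a.+1 c],
   [set V :\ a | V in P & ~~ (V \subset ord_interval a.+1 c)]).

Section Glue.
Variables P1 P2 : {set {set 'I_N}}.
Hypotheses (ncP1 : nc_partition (ord_interval a.+1 c) P1).
Hypotheses (ncP2 : nc_partition (ord_interval c b) P2).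

Let P2range W x : W \in P2 -> x \in W -> (c <= x < b)%N.
Proof.
by have [_ PA _ _ _] := nc_partitionP _ _ ncP2; move=> /PA h /h; rewrite in_interval.
Qed.

Let P1range W x : W \in P1 -> x \in W -> (a < x < c)%N.
Proof.
by have [_ PA _ _ _] := nc_partitionP _ _ ncP1; move=> /PA h /h; rewrite in_interval.
Qed.

Lemma in_attach W x : W \in P2 ->
  (x \in attach W) = (x \in W) || ((x == a) && (c \in W)).
Proof.
rewrite /attach; case: ifP => cW WP; rewrite ?andbT ?andbF ?orbF // inE orbC.
by rewrite in_set1.
Qed.

Let a_notin W : W \in P2 -> a \notin W.
Proof. by move=> WP; apply/negP => /(P2range WP); order_lia. Qed.

Lemma attachK W : W \in P2 -> attach W :\ a = W.
Proof.
move=> WP; apply/setP => x; rewrite in_setD1 in_attach //.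
have [->|] //= := eqVneq x a; first by rewrite (negPf (a_notin WP)).
by rewrite orbF.
Qed.

Lemma attach_range W x : W \in P2 -> x \in attach W -> x = a \/ (c <= x < b)%N.
Proof.
move=> WP; rewrite in_attach // => /orP[/(P2range WP)|/andP[/eqP ->]]; by [right|left].
Qed.

Lemma glue_in V : V \in glue (P1, P2) ->
  V \in P1 \/ exists2 W, W \in P2 & V = attach W.
Proof. by rewrite inE => /orP[|/imsetP[W]]; [left | right; exists W]. Qed.

Lemma glue_nc : nc_partition (ord_interval a b) (glue (P1, P2)).
Proof.
have [P10 P1A AP1 tr1 nc1] := nc_partitionP _ _ ncP1.
have [P20 P2A AP2 tr2 nc2] := nc_partitionP _ _ ncP2.
apply/nc_partitionP; split.
- apply/negP => /glue_in[|[W WP E]]; first by apply/negP.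
  suff W0 : W = set0 by rewrite -W0 WP in P20.
  by apply/setP => x; rewrite -(attachK WP) -E !inE andbF.
- move=> V x /glue_in[VP /(P1range VP)|[W WP -> /(attach_range WP)]];
    rewrite in_interval; first by order_lia.
  by case=> [->|]; order_lia.
- move=> x; rewrite in_interval => xab.
  have [xa|xa] := eqVneq x a.
    have [|W WP cW] := AP2 c; first by rewrite in_interval; order_lia.
    exists (attach W); first by rewrite inE imset_f ?orbT.
    by rewrite in_attach // xa eqxx cW orbT.
  have [xc|cx] := ltnP x c.
    have [|W WP xW] := AP1 x; last by exists W => //; rewrite inE WP.
    by rewrite in_interval; move: xa; rewrite -val_eqE /=; order_lia.
  have [|W WP xW] := AP2 x; first by rewrite in_interval; order_lia.
  exists (attach W); first by rewrite inE imset_f ?orbT.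
  by rewrite in_attach // xW.
- move=> V W x /glue_in[VP|[V' VP ->]] /glue_in[WP|[W' WP ->]].
  + exact: tr1.
  + by move=> /(P1range VP) + xW; case: (attach_range WP xW) => [->|]; order_lia.
  + by move=> xV /(P1range WP); case: (attach_range VP xV) => [->|]; order_lia.
  + rewrite !in_attach // => /orP[xV|/andP[/eqP -> cV]] /orP[xW|/andP[/eqP xa cW]].
    * by rewrite (tr2 _ _ _ VP WP xV xW).
    * by move: xV; rewrite xa (negPf (a_notin VP)).
    * by rewrite (negPf (a_notin WP)) in xW.
    * by rewrite (tr2 _ _ _ VP WP cV cW).
move=> V W i j k l /glue_in[VP|[V' VP ->]] /glue_in[WP|[W' WP ->]].
- exact: nc1.
- move=> /(P1range VP) ir /(attach_range WP)[->|jr] /(P1range VP) kr _; order_lia.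
- move=> /(attach_range VP)[->|ir] /(P1range WP) jr
     /(attach_range VP)[->|kr] /(P1range WP) lr; order_lia.
rewrite !(in_attach _ VP) !(in_attach _ WP) => iV jW kV lW ij jk kl.
(* Both blocks come from [P2]. Since [a] lies to the left of all other points, it
   can only be [i]; then [c] takes its place in the crossing. *)
have ia : (a <= i)%N.
  case/orP: iV => [/(P2range VP)/andP[+ _]|/andP[/eqP -> _]] //.
  exact: leq_trans (ltnW ac).
have {}kV : k \in V'.
  case/orP: kV => // /andP[/eqP ka _].
  by have := ltn_trans ij jk; rewrite ka ltnNge ia.
have {}jW : j \in W'.
  by case/orP: jW => // /andP[/eqP ja _]; move: ij; rewrite ja ltnNge ia.
have {}lW : l \in W'.
  case/orP: lW => // /andP[/eqP la _].
  by have := ltn_trans ij (ltn_trans jk kl); rewrite la ltnNge ia.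
congr attach; case/orP: iV => [iV|/andP[_ cV]].
  exact: nc2 iV jW kV lW ij jk kl.
have [jc|jc] := eqVneq j c; first by apply: tr2 cV _ => //; rewrite -jc.
apply: (nc2 _ _ _ _ _ _ VP WP cV jW kV lW _ jk kl).
have /andP[cj _] := P2range WP jW; rewrite ltn_neqAle cj andbT eq_sym.
by rewrite val_eqE.
Qed.

Lemma glue_next : next_in_block (glue (P1, P2)).
Proof.
have [_ _ AP2 _ _] := nc_partitionP _ _ ncP2.
have [|W WP cW] := AP2 c; first by rewrite in_interval; order_lia.
apply/existsP; exists (attach W); rewrite inE imset_f ?orbT //=.
rewrite !in_attach // eqxx cW !orbT /=; apply/pred0P => x /=.
apply/negP => /andP[/(attach_range WP)[->|]]; rewrite in_interval; order_lia.
Qed.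

Lemma glueK : cut (glue (P1, P2)) = (P1, P2).
Proof.
have [P10 P1A AP1 tr1 nc1] := nc_partitionP _ _ ncP1.
have [P20 P2A AP2 tr2 nc2] := nc_partitionP _ _ ncP2.
have sub1 V : V \in P1 -> V \subset ord_interval a.+1 c.
  by move=> VP; apply/subsetP => x; apply: P1A.
have nsub2 W : W \in P2 -> ~~ (attach W \subset ord_interval a.+1 c).
  move=> WP; have /set0Pn[x xW] : W != set0 by apply: contraNneq P20 => <-.
  apply/negP => /subsetP/(_ x); rewrite in_attach // xW => /(_ isT).
  by have := P2range WP xW; rewrite in_interval; order_lia.
congr pair; apply/setP => V.
  rewrite inE; apply/andP/idP => [[/glue_in[//|[W WP ->]]]|VP].
    by rewrite (negPf (nsub2 W WP)).
  by rewrite inE VP sub1.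
apply/imsetP/idP => [[W /[!inE] /andP[/orP[WP|/imsetP[W' WP ->]] nW] ->]|VP].
- by rewrite sub1 in nW.
- by rewrite attachK.
exists (attach V); last by rewrite attachK.
by rewrite !inE imset_f ?orbT ?nsub2.
Qed.

End Glue.

Section Cut.
Variable P : {set {set 'I_N}}.
Hypotheses (ncP : nc_partition (ord_interval a b) P) (nextP : next_in_block P).

(** A further block that has a point between [a] and [c] and also one outside would
 cross the block of [a] and [c]. *)
Lemma cut_trichotomy V : V \in P ->
  [\/ V \subset ord_interval a.+1 c, a \in V /\ c \in V |
      [/\ V \subset ord_interval c b, a \notin V & c \notin V]].
Proof.
have [P0 PA AP tr nc] := nc_partitionP _ _ ncP.
have /existsP[Va /andP[VaP /and3P[aVa cVa dVa]]] := nextP => VP.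
have [aV|aV] := boolP (a \in V).
  by constructor 2; rewrite (tr _ _ _ VP VaP aV aVa).
have cV : c \notin V by apply: contra aV => cV; rewrite (tr _ _ _ VP VaP cV cVa).
have neV x : x \in V -> (x != a) && (x != c).
  by move=> xV; apply/andP; split; [apply: contraNneq aV|apply: contraNneq cV] => <-.
have [sub|/subsetPn[y yV]] := boolP (V \subset ord_interval a.+1 c); first by constructor 1.
rewrite in_interval => yr; constructor 3; split=> //; apply/subsetP => x xV.
have := PA _ _ VP yV; have := PA _ _ VP xV; rewrite !in_interval => xr yr'.
have /andP[xa xc] := neV x xV; have /andP[ya yc] := neV y yV.
have [cx|xc'] := leqP c x; first by order_lia.
(* [x] lies between [a] and [c] and [y] beyond [c], so [a < x < c < y] crosses. *)
case/negP: aV; rewrite (_ : V = Va) //; apply/esym.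
move: xa xc ya yc; rewrite -!val_eqE /= => xa xc ya yc.
apply: (nc Va V a x c y) => //; order_lia.
Qed.

(** No block leaves the gap between [a] and its successor [c], because
 of [cut_trichotomy]. *)
Lemma cut_nc1 : nc_partition (ord_interval a.+1 c) (cut P).1.
Proof.
have [P0 PA AP tr nc] := nc_partitionP _ _ ncP.
apply/nc_partitionP; split.
- by rewrite inE (negPf P0).
- by move=> V x /[!inE] /andP[_ /subsetP sub] /sub; rewrite in_interval.
- move=> x; rewrite in_interval => xr.
  have [|V VP xV] := AP x; first by rewrite in_interval; order_lia.
  exists V => //; rewrite inE VP /=.
  case: (cut_trichotomy VP) => [//|[aV cV]|[/subsetP/(_ x xV)]].
    have /existsP[Va /andP[VaP /and3P[aVa cVa dVa]]] := nextP.
    have E := tr _ _ _ VP VaP aV aVa; move/pred0P: dVa => /(_ x) /=.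
    by rewrite -E xV in_interval xr.
  by rewrite in_interval; order_lia.
- by move=> V W x /[!inE] /andP[VP _] /andP[WP _]; apply: tr.
by move=> V W i j k l /[!inE] /andP[VP _] /andP[WP _]; apply: nc.
Qed.

Lemma cut_nc2 : nc_partition (ord_interval c b) (cut P).2.
Proof.
have [P0 PA AP tr nc] := nc_partitionP _ _ ncP.
have /existsP[Va /andP[VaP /and3P[aVa cVa dVa]]] := nextP.
have sub V x : V \in P -> ~~ (V \subset ord_interval a.+1 c) -> x \in V :\ a ->
    x \in ord_interval c b.
  move=> VP nV; rewrite in_setD1 => /andP[xa xV].
  case: (cut_trichotomy VP) => [s|[aV cV]|[/subsetP/(_ x xV)] //].
    by rewrite s in nV.
  have E := tr _ _ _ VP VaP aV aVa; move/pred0P: dVa => /(_ x) /=.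
  have := PA _ _ VP xV; rewrite -E xV !in_interval => xab /negbT.
  by move: xa xab; rewrite -val_eqE /=; order_lia.
apply/nc_partitionP; split.
- apply/imsetP => -[V /[!inE] /andP[VP nV] /esym E].
  case: (cut_trichotomy VP) => [s|[aV cV]|[_ aV cV]].
  + by rewrite s in nV.
  + by have := in_set0 c; rewrite -E in_setD1 cV andbT -val_eqE /=; order_lia.
  + suff V0 : V = set0 by rewrite -V0 VP in P0.
    apply/setP => x; rewrite -E in_setD1 andbC; case: eqP => [->|_].
      by rewrite (negPf aV).
    by rewrite andbT.
- by move=> _ x /imsetP[V /[!inE] /andP[VP nV] ->] xV; rewrite -in_interval; apply: sub xV.
- move=> x; rewrite in_interval => xr.
  have [|V VP xV] := AP x; first by rewrite in_interval; order_lia.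
  have xa : x != a by rewrite -val_eqE /=; order_lia.
  exists (V :\ a); last by rewrite in_setD1 xa.
  apply/imsetP; exists V => //; rewrite inE VP /=.
  by apply/negP => /subsetP/(_ x xV); rewrite in_interval; order_lia.
- move=> _ _ x /imsetP[V /[!inE] /andP[VP _] ->] /imsetP[W /[!inE] /andP[WP _] ->].
  by rewrite !in_setD1 => /andP[_ xV] /andP[_ xW]; rewrite (tr _ _ _ VP WP xV xW).
move=> _ _ i j k l /imsetP[V /[!inE] /andP[VP _] ->] /imsetP[W /[!inE] /andP[WP _] ->].
rewrite !in_setD1 => /andP[_ iV] /andP[_ jW] /andP[_ kV] /andP[_ lW] ij jk kl.
by rewrite (nc _ _ _ _ _ _ VP WP iV jW kV lW ij jk kl).
Qed.

Lemma cutK : glue (cut P) = P.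
Proof.
have [P0 PA AP tr nc] := nc_partitionP _ _ ncP.
have attachE V : V \in P -> ~~ (V \subset ord_interval a.+1 c) -> attach (V :\ a) = V.
  move=> VP nV; have ca : c != a by rewrite -val_eqE /=; order_lia.
  rewrite /attach in_setD1 ca /=.
  case: (cut_trichotomy VP) => [s|[aV cV]|[_ aV cV]]; first by rewrite s in nV.
    by rewrite cV setD1K.
  rewrite (negPf cV); apply/setP => x; rewrite in_setD1.
  by case: eqP => // ->; rewrite (negPf aV).
apply/setP => V; rewrite inE; apply/orP/idP => [[]|VP].
- by rewrite inE => /andP[].
- by case/imsetP => _ /imsetP[W /[!inE] /andP[WP nW] ->] ->; rewrite attachE.
have [s|nV] := boolP (V \subset ord_interval a.+1 c); first by left; rewrite inE VP.
right; apply/imsetP; exists (V :\ a); last by rewrite attachE.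
by apply/imsetP; exists V; rewrite // inE VP.
Qed.

End Cut.
End Split.
End NoncrossingIntervals.

(** * Splitting off the first point *)

Section FirstBlock.
Variable N : nat.
Implicit Types (A V W : {set 'I_N}) (P Q : {set {set 'I_N}}).

Lemma nc_partition_add1 (a : 'I_N) b Q : (a < b)%N ->
  nc_partition (ord_interval N a.+1 b) Q ->
  ([set a] \notin Q) && nc_partition (ord_interval N a b) ([set a] |: Q).
Proof.
move=> ab ncQ; have [Q0 QA AQ tr nc] := nc_partitionP _ _ ncQ.
have aQ V : V \in Q -> a \notin V.
  by move=> VQ; apply/negP => /(QA _ _ VQ); rewrite in_interval; order_lia.
rewrite andbC; apply/andP; split; last first.
  by apply/negP => /aQ; rewrite in_set1 eqxx.
apply/nc_partitionP; split.
- rewrite in_setU1 (negPf Q0) orbF eq_sym; apply/set0Pn; exists a.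
  by rewrite in_set1.
- move=> V x /setU1P[->|VQ]; first by rewrite in_set1 in_interval => /eqP ->; lia.
  by move/(QA _ _ VQ); rewrite !in_interval; order_lia.
- move=> x; rewrite in_interval => xr; have [->|xa] := eqVneq x a.
    by exists [set a]; rewrite ?setU11 ?in_set1.
  have [|V VQ xV] := AQ x; last by exists V; rewrite // inE VQ orbT.
  by rewrite in_interval; move: xa; rewrite -val_eqE /=; order_lia.
- move=> V W x /setU1P[->|VQ] /setU1P[->|WQ]; rewrite ?in_set1 //.
  + by move=> /eqP -> aW; case/negP: (aQ W WQ).
  + by move=> aV /eqP xa; case/negP: (aQ V VQ); rewrite -xa.
  + exact: tr.
move=> V W i j k l /setU1P[->|VQ] /setU1P[->|WQ]; rewrite ?in_set1 //.
- by move=> /eqP -> _ /eqP -> _; order_lia.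
- move=> /(QA _ _ VQ) + /eqP ->; rewrite in_interval; order_lia.
- exact: nc.
Qed.

Lemma nc_partition_del1 (a : 'I_N) b P : nc_partition (ord_interval N a b) P ->
  [set a] \in P -> nc_partition (ord_interval N a.+1 b) (P :\ [set a]).
Proof.
move=> ncP aP; have [P0 PA AP tr nc] := nc_partitionP _ _ ncP.
have aV V : V \in P :\ [set a] -> a \notin V.
  move=> /setD1P[Va VP]; apply: contra Va => aV; apply/eqP.
  by apply: tr aV _ => //; rewrite in_set1.
apply/nc_partitionP; split.
- by rewrite in_setD1 (negPf P0) andbF.
- move=> V x VP xV; have /setD1P[_ VP'] := VP.
  have := PA _ _ VP' xV; have : x != a by apply: contraNneq (aV V VP) => <-.
  by rewrite !in_interval -val_eqE /=; order_lia.
- move=> x; rewrite in_interval => xr.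
  have [|V VP xV] := AP x; first by rewrite in_interval; order_lia.
  exists V => //; rewrite in_setD1 VP andbT; apply: contraTneq xV => ->.
  by rewrite in_set1 -val_eqE /=; order_lia.
- by move=> V W x /setD1P[_ VP] /setD1P[_ WP]; apply: tr.
by move=> V W i j k l /setD1P[_ VP] /setD1P[_ WP]; apply: nc.
Qed.

Lemma next_in_block_exists (a : 'I_N) b P : (a < b)%N ->
  nc_partition (ord_interval N a b) P -> [set a] \notin P ->
  exists2 c : 'I_N, (a < c < b)%N & next_in_block a c P.
Proof.
move=> ab ncP aP; have [P0 PA AP tr nc] := nc_partitionP _ _ ncP.
have [|V VP aV] := AP a; first by rewrite in_interval leqnn.
have /subsetPn[x xV] : ~~ (V \subset [set a]).
  apply: contra aP => sub; suff -> : [set a] = V by [].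
  by apply/esym/eqP; rewrite eqEsubset sub sub1set.
rewrite in_set1 => xa.
have xVa : x \in V :\ a by rewrite in_setD1 xa.
case: (arg_minnP (fun i : 'I_N => nat_of_ord i) xVa) => c /setD1P[ca cV] cmin.
have := PA _ _ VP cV; rewrite in_interval => cr.
have ac : (a < c)%N by move: ca; rewrite -val_eqE /=; order_lia.
exists c; first by order_lia.
apply/existsP; exists V; rewrite VP aV cV /=; apply/pred0P => y /=.
apply/negP => /andP[yV]; rewrite in_interval => yr.
have yVa : y \in V :\ a by rewrite in_setD1 yV andbT -val_eqE /=; order_lia.
by have := cmin y yVa; order_lia.
Qed.

Lemma next_in_block_unique (a : 'I_N) b P (c c' : 'I_N) :
  nc_partition (ord_interval N a b) P -> (a < c)%N -> (a < c')%N ->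
  next_in_block a c P -> next_in_block a c' P -> c = c'.
Proof.
move=> ncP ac ac'; have [P0 PA AP tr nc] := nc_partitionP _ _ ncP.
move=> /existsP[V /andP[VP /and3P[aV cV dV]]].
move=> /existsP[W /andP[WP /and3P[aW cW dW]]].
have E := tr _ _ _ VP WP aV aW; subst W; apply/val_inj => /=.
move/pred0P: dV => /(_ c') /=; rewrite cW in_interval => /negbT h1.
move/pred0P: dW => /(_ c) /=; rewrite cV in_interval => /negbT h2.
by order_lia.
Qed.

Lemma next_in_block_bound (a : 'I_N) b P (c : 'I_N) :
  nc_partition (ord_interval N a b) P -> (a < c)%N -> next_in_block a c P ->
  (c < b)%N && ([set a] \notin P).
Proof.
move=> ncP ac; have [P0 PA AP tr nc] := nc_partitionP _ _ ncP.
move=> /existsP[V /andP[VP /and3P[aV cV dV]]].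
have := PA _ _ VP cV; rewrite in_interval => /andP[_ -> /=].
apply/negP => aP; have E := tr _ _ _ VP aP aV; move: cV; rewrite E ?in_set1 //.
by rewrite -val_eqE /=; order_lia.
Qed.

Section Sums.
Variable R : comNzRingType.
Variable u : nat -> R.

Definition nc_sum A : R := \sum_(P | nc_partition A P) \prod_(V in P) u #|V|.

(** The block of [a] counts [j] additional points: those of the same block that
 were split off on the left of [a]. *)
Definition nc_sum_at (a : 'I_N) j A : R :=
  \sum_(P | nc_partition A P) \prod_(V in P) u (#|V| + (if a \in V then j else 0))%N.

Lemma nc_sum_at0 a A : nc_sum_at a 0 A = nc_sum A.
Proof.
apply: eq_bigr => P _; apply: eq_bigr => V _; by rewrite if_same addn0.
Qed.

(** The partitions in which [c] follows [a] in its block are pairs of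
 a partition of the gap between [a] and [c] and a partition from [c] on, whose
 first block remembers one more point. *)
Lemma nc_sum_at_glue (a c : 'I_N) b j : (a < c)%N -> (c < b)%N ->
  \sum_(P | nc_partition (ord_interval N a b) P && next_in_block a c P)
     \prod_(V in P) u (#|V| + (if a \in V then j else 0))%N =
  nc_sum (ord_interval N a.+1 c) * nc_sum_at c j.+1 (ord_interval N c b).
Proof.
move=> ac cb; rewrite /nc_sum /nc_sum_at big_distrlr /= pair_big /=.
rewrite (reindex_onto (glue a c) (cut a c)) /=; last first.
  by move=> P /andP[ncP nx]; apply: (cutK ac cb ncP nx).
apply: eq_big => [[P1 P2] /=|[P1 P2] /=].
  apply/idP/idP => [/andP[/andP[ncP nx] /eqP E]|/andP[nc1 nc2]].
    by have := cut_nc1 ac cb ncP nx; have := cut_nc2 ac cb ncP nx; rewrite E /= => -> ->.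
  by rewrite (glue_nc ac cb nc1 nc2) (glue_next ac cb nc1 nc2)
             (glueK ac cb nc1 nc2) eqxx.
case/andP => /andP[ncP nx] /eqP cutE.
have nc1 : nc_partition (ord_interval N a.+1 c) P1.
  by have := cut_nc1 ac cb ncP nx; rewrite cutE.
have nc2 : nc_partition (ord_interval N c b) P2.
  by have := cut_nc2 ac cb ncP nx; rewrite cutE.
have [P10 P1A AP1 tr1 _] := nc_partitionP _ _ nc1.
have [P20 P2A AP2 tr2 _] := nc_partitionP _ _ nc2.
have a2 W : W \in P2 -> a \notin W.
  by move=> WP; apply/negP => /(P2A _ _ WP); rewrite in_interval; order_lia.
have a1 V : V \in P1 -> a \notin V.
  by move=> VP; apply/negP => /(P1A _ _ VP); rewrite in_interval; order_lia.
rewrite (eq_bigl [predU P1 & attach a c @: P2]); last first.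
  by move=> V; rewrite !inE.
rewrite bigU /=; last first.
  rewrite disjoint_subset; apply/subsetP => V VP; rewrite inE.
  apply/imsetP => -[W WP E].
  have /set0Pn[x xW] : W != set0 by apply: contraNneq P20 => <-.
  have xV : x \in V by rewrite E (in_attach _ _ _ WP) xW.
  have := P1A _ _ VP xV; have := P2A _ _ WP xW; rewrite !in_interval; order_lia.
congr (_ * _).
  by apply: eq_bigr => V VP; rewrite (negPf (a1 V VP)) addn0.
rewrite big_imset /=; last first.
  move=> V W VP WP E; by rewrite -(attachK ac cb nc1 nc2 VP) E (attachK ac cb nc1 nc2).
apply: eq_bigr => W WP; rewrite (in_attach _ _ _ WP) eqxx (negPf (a2 W WP)) /=.
rewrite /attach; case: ifP => cW; last by rewrite !addn0.
by rewrite cardsU1 a2 //= add1n addSn addnS.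
Qed.

Lemma nc_sum_at_singleton (a : 'I_N) b j : (a < b)%N ->
  \sum_(P | nc_partition (ord_interval N a b) P && ([set a] \in P))
     \prod_(V in P) u (#|V| + (if a \in V then j else 0))%N =
  u j.+1 * nc_sum (ord_interval N a.+1 b).
Proof.
move=> ab; rewrite (reindex_onto (fun Q => [set a] |: Q) (fun P => P :\ [set a])) /=;
  last by move=> P /andP[_ aP]; rewrite setD1K.
rewrite /nc_sum mulr_sumr; apply: eq_big => [Q|Q].
  apply/idP/idP => [/andP[/andP[ncP aP] /eqP <-]|ncQ].
    exact: nc_partition_del1.
  have /andP[aQ ->] := nc_partition_add1 ab ncQ.
  by rewrite setU11 setU1K //= eqxx.
case/andP => /andP[ncP aP] /eqP EQ.
have aQ : [set a] \notin Q by rewrite -EQ !inE eqxx.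
rewrite big_setU1 //= cards1 in_set1 eqxx add1n; congr (_ * _).
apply: eq_bigr => V VQ; suff /negPf -> : a \notin V by rewrite addn0.
have [P0 PA AP tr nc] := nc_partitionP _ _ ncP.
apply/negP => aV; have E := tr V [set a] a; move: aQ.
by rewrite -E ?VQ // ?in_setU1 ?VQ ?orbT ?eqxx // in_set1.
Qed.

(** Either [a] is the last point of its block, hence a singleton here, or it has a
 successor [c]. *)
Lemma nc_sum_at_rec (a : 'I_N) b j : (a < b)%N ->
  nc_sum_at a j (ord_interval N a b) = u j.+1 * nc_sum (ord_interval N a.+1 b) +
   \sum_(c : 'I_N | (a < c < b)%N)
      nc_sum (ord_interval N a.+1 c) * nc_sum_at c j.+1 (ord_interval N c b).
Proof.
move=> ab; rewrite {1}/nc_sum_at (bigID (fun P => [set a] \in P)) /=.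
rewrite nc_sum_at_singleton //; congr (_ + _).
pose nx P := odflt a [pick c : 'I_N | (a < c)%N && next_in_block a c P].
have nxP P (c : 'I_N) : nc_partition (ord_interval N a b) P -> (a < c)%N -> next_in_block a c P ->
    nx P = c.
  move=> ncP ac ncx; rewrite /nx; case: pickP => [c' /andP[ac' nx']|/(_ c)] /=.
    exact: next_in_block_unique ncP _ _ nx' ncx.
  by rewrite ac ncx.
rewrite (partition_big nx (fun c : 'I_N => (a < c < b)%N)) /=; last first.
  move=> P /andP[ncP aP]; have [c acb cP] := next_in_block_exists ab ncP aP.
  by rewrite (nxP P c) //; case/andP: acb.
apply: eq_bigr => c /andP[ac cb]; rewrite -nc_sum_at_glue //; apply: eq_bigl => P.
have [ncP|] //= := boolP (nc_partition _ P).
apply/idP/idP => [/andP[aP /eqP <-]|cP].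
  have [c' /andP[ac' _] cP] := next_in_block_exists ab ncP aP.
  by rewrite (nxP P c').
by rewrite (nxP P c) // eqxx andbT; case/andP: (next_in_block_bound ncP ac cP).
Qed.

End Sums.
End FirstBlock.

(** * The recursion for sums over non-crossing partitions *)

Section NoncrossingRecursion.
Variable R : fieldType.
Variable u : nat -> R.

Fixpoint conv_power (m : nat -> R) (k l : nat) : R :=
  if k is j.+1 then \sum_(i < l.+1) m i * conv_power m j (l - i)%N
  else (l == 0%N)%:R.

Definition nc_total n : R := \sum_(P in noncrossing_partitions n) block_prod u P.

Lemma nc_totalE n : nc_total n = nc_sum u (ord_interval n 0 n).
Proof.
apply: eq_bigl => P; rewrite !inE /nc_partition.
rewrite (_ : ord_interval n 0 n = [set: 'I_n]) //.
by apply/setP => i; rewrite in_interval ltn_ord inE.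
Qed.

Lemma nc_sum_empty N a b : (b <= a)%N -> nc_sum u (ord_interval N a b) = 1.
Proof.
move=> ba; have -> : ord_interval N a b = finset.set0.
  by apply/setP => i; rewrite in_interval !inE; lia.
rewrite /nc_sum (big_pred1 finset.set0) => [|P]; first by rewrite big_set0.
change (nc_partition finset.set0 P = (P == finset.set0)).
rewrite /nc_partition partition_set0; have [->|_] := eqVneq P finset.set0; last by rewrite andFb.
by rewrite andTb; apply/forall_inP => V; rewrite inE.
Qed.

(** A first block of [k + 1] points leaves [k + 1] gaps, which carry independent
 non-crossing partitions. As the recursion sees the length of an interval only,
 induction on this length also yields that the sums are invariant under
 translation. *)
Lemma nc_sum_at_formula L N (a : 'I_N) b j : (0 < L)%N -> (b <= N)%N ->
  (a + L = b)%N ->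
  nc_sum_at u a j (ord_interval N a b) =
  \sum_(k < L) u (k.+1 + j)%N * conv_power nc_total k.+1 (L - k.+1)%N.
Proof.
have [M] := ubnP L; elim: M L N a b j => // M IH L N a b j LM L0 bN ab.
have tot N' a' b' : (b' - a' < L)%N -> (b' <= N')%N ->
    nc_sum u (ord_interval N' a' b') = nc_total (b' - a').
  move=> lt le; have [ba|ab'] := leqP b' a'.
    by rewrite nc_sum_empty // nc_totalE (eqP ba) nc_sum_empty.
  have a'N : (a' < N')%N by lia.
  have l0 : (0 < b' - a')%N by lia.
  rewrite nc_totalE -(nc_sum_at0 u (Ordinal a'N)) -(nc_sum_at0 u (Ordinal l0)).
  rewrite (IH (b' - a')%N _ (Ordinal a'N)) //=; try lia.
  by rewrite (IH (b' - a')%N _ (Ordinal l0)) //=; lia.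
case: L L0 LM ab tot => // L _ LM ab tot.
rewrite nc_sum_at_rec; last by lia.
rewrite tot; [|lia|lia].
rewrite big_ord_recl /= addSn subSS subn0.
congr (_ + _).
  rewrite add0n; congr (_ * _); rewrite (_ : b - a.+1 = L)%N; last by lia.
  rewrite (bigD1 ord_max) //= subnn eqxx mulr1 big1 ?addr0 // => i.
  by rewrite -val_eqE /= subn_eq0 => iL; rewrite leqNgt ltn_neqAle iL -ltnS ltn_ord mulr0.
(* The sums over the successor [c] and the remaining points of its block are
   exchanged to exhibit the power of one higher order. *)
pose H c := nc_total (c - a.+1)%N *
  \sum_(k < b - c) u (k.+1 + j.+1)%N * conv_power nc_total k.+1 (b - c - k.+1)%N.
transitivity (\sum_(c < N | (a < c < b)%N) H c).
  apply: eq_bigr => c /andP[ac cb]; rewrite /H tot; [|lia|lia].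
  by rewrite (IH (b - c)%N) //; lia.
rewrite -(big_mkord (fun c => a < c < b)%N H).
have -> : \sum_(0 <= c < N | (a < c < b)%N) H c = \sum_(a.+1 <= c < b) H c.
  rewrite [RHS](big_nat_widen _ _ N) // [RHS](big_nat_widenl _ 0) //.
  by apply: eq_bigl => c; rewrite andbC.
rewrite -[a.+1]add0n big_addn big_mkord (_ : b - a.+1 = L)%N; last by lia.
transitivity (\sum_(i < L) \sum_(k < L | (i + k < L)%N)
   nc_total i * (u (k.+2 + j)%N * conv_power nc_total k.+1 (L - i - k.+1)%N)).
  apply: eq_bigr => i _; rewrite /H addnK mulr_sumr.
  rewrite (_ : b - (i + a.+1) = L - i)%N; last by lia.
  rewrite (big_ord_widen_cond L xpredT (fun k => nc_total i *
    (u (k.+1 + j.+1)%N * conv_power nc_total k.+1 (L - i - k.+1)%N))) ?leq_subr //=.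
  apply: eq_big => k; first by have := ltn_ord i; lia.
  by move=> _; rewrite addnS addSn.
rewrite (exchange_big_dep xpredT) //=; apply: eq_bigr => k _.
rewrite /bump /= add1n mulr_sumr.
rewrite (_ : (L - k.+1).+1 = L - k)%N; last by have := ltn_ord k; lia.
rewrite (big_ord_widen_cond L xpredT (fun i => u (k.+2 + j)%N *
   (nc_total i * conv_power nc_total k.+1 (L - k.+1 - i)%N))) ?leq_subr //=.
apply: eq_big => i; first by have := ltn_ord k; lia.
move=> ik; rewrite mulrCA (_ : L - i - k.+1 = L - k.+1 - i)%N //; lia.
Qed.

Lemma nc_total_recursion n :
  nc_total n.+1 = \sum_(k < n.+1) u k.+1 * conv_power nc_total k.+1 (n - k)%N.
Proof.
rewrite nc_totalE -(nc_sum_at0 u (ord0 : 'I_n.+1)).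
rewrite (@nc_sum_at_formula n.+1 n.+1 ord0) //.
by apply: eq_bigr => k _; rewrite addn0 subSS.
Qed.

Lemma nc_total0 : nc_total 0 = 1.
Proof. by rewrite nc_totalE nc_sum_empty. Qed.

End NoncrossingRecursion.

(** * Partition sums and logarithms *)

Section PartitionSums.
Variables (R : comNzRingType).

(** A partition with a marked block is a block together with a partition of the
 complement. *)
Lemma sum_partition_block (T : finType) (A : {set T})
    (h : {set T} -> {set {set T}} -> R) :
  \sum_(P | partition P A) \sum_(V in P) h V (P :\ V) =
  \sum_(V : {set T} | (V \subset A) && (V != set0))
    \sum_(P | partition P (A :\: V)) h V P.
Proof.
rewrite !pair_big_dep /=.
rewrite (reindex_onto (fun VP : {set T} * {set {set T}} => (VP.1 |: VP.2, VP.1))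
   (fun PV => (PV.2, PV.1 :\ PV.2))) /=; last first.
  by move=> [P V] /= /andP[_ VP]; rewrite setD1K.
apply: eq_big => [[V P] /=|[V P] /= /andP[_ /eqP [->]] //].
rewrite setU11 andbT xpair_eqE eqxx /=.
apply/idP/idP => [/andP[partP /eqP E]|/andP[/andP[VA V0] partP]].
  have VP : V \in V |: P by rewrite setU11.
  rewrite (partitionS partP VP) (partition_neq0 partP VP) /=.
  by have := partitionD1 partP VP; rewrite E.
have dis : [disjoint V & A :\: V].
  by rewrite -setI_eq0; apply/eqP/setP => x; rewrite !inE; case: (x \in V).
have := partitionU1 partP V0 dis.
rewrite -[X in partition _ X](_ : A = _); last first.
  by apply/setP => x; rewrite !inE; case: (boolP (x \in V)) => //= /(subsetP VA).
move=> ->; rewrite setU1K ?eqxx //; apply/negP => VP.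
have /set0Pn[x xV] := V0.
by have := subsetP (partitionS partP VP) x xV; rewrite inE xV.
Qed.

Variable e : nat -> R.
Hypothesis e0 : e 0%N = 1.

(** With [E] the exponential generating function of the [e n] for [n > 0], and [W]
 that of the [w n], these are the coefficients of the composition [W(E)]. *)
Definition partition_sum (w : nat -> R) (T : finType) (A : {set T}) : R :=
  \sum_(P | partition P A) w #|P| * \prod_(V in P) e #|V|.

(** These weights compose to [1 / (1 + E)]. *)
Definition inverse_weight n : R := (-1) ^+ n * (n`!)%:R.
(** In positive degree these weights compose to [log (1 + E)]. *)
Definition log_weight n : R := (-1) ^+ n.-1 * (n.-1`!)%:R.

Lemma big_block (T : finType) (P : {set {set T}}) (V : {set T}) : V \in P ->
  \prod_(W in P) e #|W| = e #|V| * \prod_(W in P :\ V) e #|W|.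
Proof. by move=> VP; rewrite (big_setD1 V). Qed.

Lemma card_block (T : finType) (P : {set {set T}}) (V : {set T}) : V \in P ->
  #|P| = #|P :\ V|.+1.
Proof. by move=> VP; rewrite (cardsD1 V) VP. Qed.

(** The derivative of [log (1 + E)] is [E' / (1 + E)]; differentiation marks the
 block of a point. *)
Lemma log_sum_block (T : finType) (A : {set T}) x : x \in A ->
  partition_sum log_weight A =
  \sum_(B : {set T} | (B \subset A) && (x \in B))
     e #|B| * partition_sum inverse_weight (A :\: B).
Proof.
move=> xA; have := sum_partition_block A (fun V P =>
   (x \in V)%:R * (e #|V| * (inverse_weight #|P| * \prod_(W in P) e #|W|))).
rewrite [X in _ = X](_ : _ = \sum_(B : {set T} | (B \subset A) && (x \in B))
     e #|B| * partition_sum inverse_weight (A :\: B)) => [<-|].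
  apply: eq_bigr => P partP.
  have xP : x \in cover P by rewrite (cover_partition partP).
  have VP := pblock_mem xP.
  rewrite [RHS](bigD1 (pblock P x)) //= mem_pblock xP mul1r [X in _ = _ + X]big1 ?addr0; last first.
    move=> V /andP[VP' neV]; case: (boolP (x \in V)) => [xV|]; last by rewrite mul0r.
    by rewrite -(def_pblock (partition_trivIset partP) VP' xV) eqxx in neV.
  rewrite (big_block VP) (card_block VP).
  by rewrite -[log_weight _.+1]/(inverse_weight _) mulrCA.
rewrite [RHS]big_mkcond [LHS]big_mkcond; apply: eq_bigr => V _.
have [VA|] //= := boolP (V \subset A).
have [xV|xV] := boolP (x \in V); last first.
  by rewrite big1 ?if_same // => P _; rewrite mul0r.
rewrite (_ : V != set0); last by apply/set0Pn; exists x.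
by rewrite /partition_sum mulr_sumr; apply: eq_bigr => P _; rewrite mul1r.
Qed.

(** This is [(1 + E) (1 + E)^-1 = 1]. The partitions with a marked block, the first
 factor, cancel those without one, as the [#|P|] choices of the block turn
 [(#|P| - 1)!] into [#|P|!]. *)
Lemma inverse_sum_convolution (T : finType) (A : {set T}) :
  \sum_(B : {set T} | B \subset A) e #|B| * partition_sum inverse_weight (A :\: B)
  = (A == set0)%:R.
Proof.
rewrite (bigD1 set0) ?sub0set //= cards0 e0 mul1r setD0.
have := sum_partition_block A (fun V P =>
   e #|V| * (inverse_weight #|P| * \prod_(W in P) e #|W|)).
rewrite [X in _ = X -> _](_ : _ = \sum_(B : {set T} | (B \subset A) && (B != set0))
     e #|B| * partition_sum inverse_weight (A :\: B)) => [<-|]; last first.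
  by apply: eq_bigr => V _; rewrite mulr_sumr.
rewrite -big_split /=.
have [->|A0] := eqVneq A set0.
  rewrite (eq_bigl (pred1 set0)) => [|P]; last by rewrite partition_set0.
  by rewrite big_pred1_eq !big_set0 cards0 /inverse_weight expr0 fact0 mulr1 ?mul1r ?mulr1 addr0.
apply: big1 => P partP.
have P0 : P != set0.
  apply: contraNneq A0 => P0; by rewrite -(cover_partition partP) P0 /cover big_set0.
rewrite [X in _ + X](eq_bigr (fun=> inverse_weight #|P|.-1 * \prod_(W in P) e #|W|)); last first.
  by move=> V VP; rewrite (big_block VP) (card_block VP) mulrCA.
rewrite sumr_const -mulr_natl /inverse_weight.
have : (0 < #|P|)%N by rewrite card_gt0.
case: #|P| => // n _ /=; rewrite factS natrM exprS; ring.
Qed.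

(** This is [E' = (log (1 + E))' (1 + E)], obtained from the two preceding
 identities. *)
Lemma partition_log_split (T : finType) (A : {set T}) x : x \in A ->
  e #|A| = \sum_(B : {set T} | (B \subset A) && (x \in B))
              partition_sum log_weight B * e #|A :\: B|.
Proof.
move=> xA.
transitivity (\sum_(D : {set T} | (D \subset A) && (x \in D))
   e #|D| * (A :\: D == set0)%:R).
  rewrite (bigD1 A) ?subxx //= setDv eqxx mulr1 big1 ?addr0 // => D.
  rewrite setD_eq0 => /andP[/andP[DA _] neD].
  case: (boolP (A \subset D)) => AD; last by rewrite mulr0.
  by case/eqP: neD; apply/eqP; rewrite eqEsubset DA.
transitivity (\sum_(D : {set T} | (D \subset A) && (x \in D))
  \sum_(B : {set T} | (B \subset A) && (D \subset B))
     e #|D| * partition_sum inverse_weight (B :\: D) * e #|A :\: B|).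
  apply: eq_bigr => D /andP[DA xD]; rewrite -inverse_sum_convolution mulr_sumr.
  rewrite [RHS](reindex_onto (fun C : {set T} => A :\: C) (fun B => A :\: B)) /=; last first.
    by move=> B /andP[BA _]; rewrite setDDr setDv set0U (setIidPr BA).
  apply: eq_big => [C|C CAD].
    rewrite subsetDl /= setDDr setDv set0U subsetD subsetD.
    rewrite [D \subset A]DA /= disjoint_sym andbC; congr (_ && _).
    by apply/idP/eqP => [/setIidPr //|<-]; rewrite subsetIl.
  have /andP[CA dCD] : (C \subset A) && [disjoint C & D] by rewrite -subsetD.
  rewrite [A :\: (A :\: C)]setDDr setDv set0U (setIidPr CA).
  by rewrite !setDDl [C :|: D]setUC -!mulrA; congr (_ * _); rewrite mulrC.
rewrite (exchange_big_dep (fun B : {set T} => (B \subset A) && (x \in B))) /=; last first.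
  by move=> D B /andP[_ xD] /andP[-> /subsetP]; apply.
apply: eq_bigr => B /andP[BA xB]; rewrite (log_sum_block xB) mulr_suml.
apply: eq_bigl => D; rewrite BA /=; apply/idP/idP => [/andP[/andP[_ ->] ->] //|].
by move=> /andP[DB ->]; rewrite DB (subset_trans DB BA).
Qed.

Lemma partition_log_recursion n :
  e n.+1 = \sum_(k < n.+1) 'C(n, k)%:R *
    (partition_sum log_weight [set: 'I_k.+1] * e (n - k)%N).
Proof.
exact: (@sum_through_recursion _ (fun T => @partition_sum log_weight T) e e0
  partition_log_split).
Qed.

End PartitionSums.

(** * Roots and polar derivatives *)

Section Laguerre.
Local Open Scope complex_scope.
Variable R : rcfType.
Implicit Types (z w : R[i]) (s : R).

Lemma ImD z w : complex.Im (z + w) = complex.Im z + complex.Im w.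
Proof. by case: z w => [a b] [c d]. Qed.
Lemma ReD z w : complex.Re (z + w) = complex.Re z + complex.Re w.
Proof. by case: z w => [a b] [c d]. Qed.
Lemma ImN z : complex.Im (- z) = - complex.Im z.
Proof. by case: z. Qed.

(** Inversion maps the half-plane [Im z >= s] into the disc
 [s |w|^2 <= - Im w], which is convex. *)
Definition in_disc s w : Prop :=
  s * (complex.Re w ^+ 2 + complex.Im w ^+ 2) <= - complex.Im w.

Lemma inv_in_disc s z : 0 < s -> s <= complex.Im z -> in_disc s z^-1.
Proof.
case: z => [a b] /= s0 sb; rewrite /in_disc /=.
have n0 : 0 < a ^+ 2 + b ^+ 2 by rewrite ltr_wpDl ?sqr_ge0 ?exprn_gt0 // (lt_le_trans s0).
rewrite [X in s * X](_ : _ = (a ^+ 2 + b ^+ 2)^-1); last by field; rewrite gt_eqF.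
by rewrite opprK ler_pM2r // invr_gt0.
Qed.

(** The mean of points of the disc lies in it, by convexity. In the
 inductive step the defect of the inequality is a sum of squares. *)
Lemma sum_in_disc s (ws : seq R[i]) : 0 < s -> (forall w, w \in ws -> in_disc s w) ->
  let W := \sum_(w <- ws) w in
  s * (complex.Re W ^+ 2 + complex.Im W ^+ 2) <= (size ws)%:R * - complex.Im W.
Proof.
move=> s0; elim: ws => [|w ws IH] H; first by rewrite big_nil /= expr0n /= addr0 mulr0 mul0r.
have {IH} := IH (fun v vws => H v (@mem_behead _ (w :: ws) v vws)).
have := H w (mem_head _ _); rewrite /in_disc big_cons ImD ReD.
case: ws {H} => [|w' ws] /=.
  by rewrite big_nil /= !addr0 mul1r.
move: (\sum_(_ <- _) _) => [X Y]; case: w => x y /=.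
rewrite -[(size ws).+2%:R]natr1; move: (size ws).+1%:R (ltr0Sn R (size ws)) => N N0 ha hb.
rewrite -(ler_pM2l N0) -subr_ge0.
(* The last term measures the distance of [w] from the mean of the others. *)
have -> : N * ((N + 1) * - (y + Y)) - N * (s * ((x + X) ^+ 2 + (y + Y) ^+ 2)) =
  N * (N + 1) * (- y - s * (x ^+ 2 + y ^+ 2)) + (N + 1) * (N * - Y - s * (X ^+ 2 + Y ^+ 2))
  + s * ((N * x - X) ^+ 2 + (N * y - Y) ^+ 2) by ring.
have N1 : 0 <= N + 1 by rewrite addr_ge0 // ltW.
rewrite !addr_ge0 // mulr_ge0 ?subr_ge0 ?mulr_ge0 ?addr_ge0 ?sqr_ge0 //; exact: ltW.
Qed.

Lemma deriv_prod_XsubC (zs : seq R[i]) x : (forall z, z \in zs -> x != z) ->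
  (\prod_(z <- zs) ('X - z%:P))^`().[x] =
  (\prod_(z <- zs) ('X - z%:P)).[x] * \sum_(z <- zs) (x - z)^-1.
Proof.
elim: zs => [|z zs IH] H; first by rewrite !big_nil derivC horner0 mulr0.
rewrite !big_cons derivM derivXsubC hornerD !hornerM !hornerE ?mul1r.
rewrite IH => [|v vz]; last by apply: H; rewrite inE vz orbT.
have xz : x - z != 0 by rewrite subr_eq0 H ?mem_head.
by field.
Qed.

(** In this normalization of the coefficients the polar derivative acts by
 [c k |-> c k + ze * c k.+1]. *)
Definition binomial_poly n (c : nat -> R[i]) : {poly R[i]} :=
  \poly_(k < n.+1) (c k *+ 'C(n, k)).

Definition roots_below (p : {poly R[i]}) := forall x, root p x -> complex.Im x <= 0.

Lemma binomial_polyS n c : binomial_poly n.+1 c =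
  binomial_poly n c + 'X * binomial_poly n (fun k => c k.+1).
Proof.
apply/polyP => k; rewrite coefD coefXM !coef_poly.
case: k => [|k]; first by rewrite !bin0 addr0.
rewrite /= !ltnS binS mulrnDr.
case: (ltngtP k n) => [kn|kn|->].
- by [].
- by rewrite addr0.
- by rewrite bin_small // mulr0n.
Qed.

Lemma deriv_binomial_poly n c : (binomial_poly n.+1 c)^`() =
  n.+1%:R *: binomial_poly n (fun k => c k.+1).
Proof.
apply/polyP => k; rewrite coef_deriv coefZ !coef_poly ltnS.
case: ifP => kn; last by rewrite mul0rn mulr0.
rewrite mulr_natl -!mulrnA; congr (_ *+ _).
by rewrite mulnC -(mul_bin_diag n.+1 k) mulnC.
Qed.

Lemma binomial_poly_polar n c ze :
  binomial_poly n (fun k => c k + ze * c k.+1) =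
  binomial_poly n c + ze *: binomial_poly n (fun k => c k.+1).
Proof.
apply/polyP => k; rewrite coefD coefZ !coef_poly; case: ifP => _.
  by rewrite mulrnDl mulrnAr.
by rewrite mulr0 addr0.
Qed.

Lemma lead_coef_binomial_poly n c : c n != 0 ->
  size (binomial_poly n c) = n.+1 /\ lead_coef (binomial_poly n c) = c n.
Proof.
move=> cn; have sz : size (binomial_poly n c) = n.+1.
  by rewrite size_poly_eq // binn.
by split=> //; rewrite lead_coefE sz /= coef_poly ltnSn binn.
Qed.

(** Let [p] have its roots in the closed lower half-plane and let [ze] and [x] lie
 in the open upper one. If the polar derivative vanished at [x], then
 [n.+1 p(x) = (x - ze) p'(x)], that is, the mean of the [1 / (x - z)] over the
 roots [z] would be [1 / (x - ze)]. This mean lies in the disc of the inverses of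
 the half-plane above [x], so [Im (x - ze) >= Im x], a contradiction. The leading
 coefficient cannot vanish, for then the mean of the roots would be [ze]. *)
Lemma laguerre n (c : nat -> R[i]) ze : c n.+1 != 0 -> roots_below (binomial_poly n.+1 c) ->
  0 < complex.Im ze ->
  (c n + ze * c n.+1 != 0) /\
  roots_below (binomial_poly n (fun k => c k + ze * c k.+1)).
Proof.
move=> cn low ze0; have [sz ld] := lead_coef_binomial_poly cn.
set p := binomial_poly n.+1 c in low sz ld *.
have [zs pE] := closed_field_poly_normal p; rewrite ld in pE.
have zsn : size zs = n.+1.
  by move: sz; rewrite pE size_scale // size_prod_XsubC => -[].
have zslow z : z \in zs -> complex.Im z <= 0.
  by move=> zzs; apply: low; rewrite pE rootZ // root_prod_XsubC.
have sumlow (s : seq R[i]) : (forall z, z \in s -> complex.Im z <= 0) ->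
   complex.Im (\sum_(z <- s) z) <= 0.
  elim: s => [|z s IH] H; first by rewrite big_nil.
  have h1 := H z (mem_head _ _).
  have h2 := IH (fun v vs => H v (@mem_behead _ (z :: s) v vs)).
  by rewrite big_cons ImD; lra.
have natIm (m : nat) z : complex.Im (m%:R * z) = m%:R * complex.Im z.
  by elim: m => [|m IH]; rewrite ?mul0r // -!natr1 !mulrDl !mul1r ImD IH.
split.
  apply/eqP => E; have := congr1 (fun q : {poly R[i]} => q`_n) pE.
  rewrite coef_poly leqnSn binSn coefZ.
  have -> : n = (size zs).-1 by rewrite zsn.
  rewrite coefPn_prod_XsubC zsn //= => E2.
  have E3 : \sum_(z <- zs) z = n.+1%:R * ze.
    apply: (mulfI cn); apply: (@addrI _ (c n *+ n.+1)).
    have -> : c n *+ n.+1 + c n.+1 * \sum_(z <- zs) z = 0.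
      by rewrite E2 mulrN addNr.
    transitivity (n.+1%:R * (c n + ze * c n.+1)); first by rewrite E mulr0.
    ring.
  have := sumlow zs zslow; rewrite E3 natIm leNgt.
  by rewrite mulr_gt0 ?ltr0Sn.
move=> x; rewrite leNgt binomial_poly_polar; set Q1 := binomial_poly n (fun k => c k.+1) => rx.
apply/negP => x0; have pQ : p = binomial_poly n c + 'X * Q1 by apply: binomial_polyS.
have dp : p^`() = n.+1%:R *: Q1 by apply: deriv_binomial_poly.
have xz z : z \in zs -> x != z.
  by move=> /zslow; apply: contraTneq => <-; rewrite -ltNge.
(* Here [Q1] is [p' / n.+1], and the polar derivative is [p - (x - ze) Q1] at [x]. *)
have px : p.[x] = (x - ze) * Q1.[x].
  move/rootP: rx; rewrite pQ !hornerE => /eqP; rewrite addr_eq0 => /eqP ->; ring.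
have px0 : p.[x] != 0.
  by apply: contraTneq x0 => /rootP/low; rewrite -leNgt.
have W : p^`().[x] = p.[x] * \sum_(z <- zs) (x - z)^-1.
  by rewrite pE derivZ !hornerZ deriv_prod_XsubC // mulrA.
have xze : x - ze != 0 by apply: contraNneq px0; rewrite px => ->; rewrite mul0r.
have Q10 : Q1.[x] != 0 by apply: contraNneq px0; rewrite px => ->; rewrite mulr0.
have {}W : \sum_(z <- zs) (x - z)^-1 = n.+1%:R * (x - ze)^-1.
  apply: (mulfI px0); rewrite -W dp hornerZ px; by field.
have disc w : w \in [seq (x - z)^-1 | z <- zs] -> in_disc (complex.Im x) w.
  case/mapP=> z zzs ->.
  by apply: inv_in_disc => //; rewrite ImD ImN lerDl oppr_ge0 zslow.
have /= := sum_in_disc x0 disc.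
rewrite big_map W size_map zsn natIm.
have natRe (m : nat) z : complex.Re (m%:R * z) = m%:R * complex.Re z.
  by elim: m => [|m IH]; rewrite ?mul0r // -!natr1 !mulrDl !mul1r ReD IH.
rewrite natRe; have := xze; have : complex.Im (x - ze) < complex.Im x.
  by rewrite ImD ImN gtrDl oppr_lt0.
move: (x - ze) (complex.Im x) x0 => [a b] s s0 /= bs.
rewrite eq_complex /= negb_and => ab0.
have n0 : 0 < a ^+ 2 + b ^+ 2.
  by rewrite lt_def addr_ge0 ?sqr_ge0 // andbT paddr_eq0 ?sqr_ge0 // !sqrf_eq0 negb_and.
have N0 := ltr0Sn R n; move: n.+1%:R N0 => N N0.
apply/negP; rewrite -ltNge.
have -> : N * - (N * - (b / (a ^+ 2 + b ^+ 2))) = N ^+ 2 / (a ^+ 2 + b ^+ 2) * b.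
  by field; rewrite gt_eqF.
have -> : s * ((N * (a / (a ^+ 2 + b ^+ 2))) ^+ 2 + (N * - (b / (a ^+ 2 + b ^+ 2))) ^+ 2)
   = N ^+ 2 / (a ^+ 2 + b ^+ 2) * s by field; rewrite gt_eqF.
by rewrite ltr_pM2l // divr_gt0 // exprn_gt0.
Qed.

(** The sum is the polar form of the polynomial at the points [zes]. Each point
 applies one polar derivative, and [laguerre] keeps the hypotheses alive until a
 nonzero constant is left. *)
Lemma grace n (c : nat -> R[i]) (zes : seq R[i]) : size zes = n -> c n != 0 ->
  roots_below (binomial_poly n c) -> (forall z, z \in zes -> 0 < complex.Im z) ->
  \sum_(j < n.+1) (\prod_(z <- zes) (1 + z *: 'X))`_j * c j != 0.
Proof.
elim: n c zes => [|n IH] c [|ze zes] //=.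
  by move=> _ c0 _ _; rewrite big_nil big_ord1 coef1 mul1r.
case=> zn cn low up.
have [l1 low1] := laguerre cn low (up ze (mem_head _ _)).
have := IH _ zes zn l1 low1; set S := \sum_(_ < n.+1) _.
have up' z : z \in zes -> 0 < complex.Im z by move=> zz; apply: up; rewrite inE zz orbT.
move=> /(_ up'); suff -> : \sum_(j < n.+2) (\prod_(z <- ze :: zes) (1 + z *: 'X))`_j * c j = S by [].
rewrite /S big_cons; set F := \prod_(z <- zes) _.
have Fn : F`_n.+1 = 0.
  apply: nth_default; rewrite -zn /F; elim: (zes) => [|z s IHs]; first by rewrite big_nil size_poly1.
  rewrite big_cons; apply: (leq_trans (size_polyMleq _ _)) => /=.
  have : (size (1 + z *: 'X : {poly R[i]})%R <= 2)%N.
    rewrite (leq_trans (size_polyD _ _)) // geq_max size_poly1 /=.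
    by rewrite (leq_trans (size_scale_leq _ _)) // size_polyX.
  by move=> h; rewrite -subn1 leq_subLR (leq_trans (leq_add h IHs)).
have coefF j : ((1 + ze *: 'X) * F)`_j = F`_j + (if j is i.+1 then ze * F`_i else 0).
  by rewrite mulrDl mul1r coefD -scalerAl coefZ coefXM; case: j; rewrite ?mulr0.
under eq_bigr => j _ do rewrite coefF mulrDl.
rewrite big_split /= big_ord_recr /= Fn mul0r addr0 [X in _ + X]big_ord_recl /= mul0r add0r.
by rewrite -big_split; apply: eq_bigr => j _ /=; ring.
Qed.

End Laguerre.

(** * Real-rootedness of the finite free convolution *)

Section Walsh.
Local Open Scope complex_scope.
Variable R : realType.
Implicit Types (p q : {poly R}).

Lemma bin_trinomial m i j :
  ('C(m + i + j, i + j) * 'C(i + j, i) = 'C(m + i + j, j) * 'C(m + i, i))%N.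
Proof.
apply/eqP; rewrite -(eqn_pmul2r (fact_gt0 m)) -(eqn_pmul2r (fact_gt0 i)).
rewrite -(eqn_pmul2r (fact_gt0 j)) -(eqn_pmul2r (fact_gt0 (i + j))).
rewrite -(eqn_pmul2r (fact_gt0 (m + i))); apply/eqP.
have := @bin_fact (m + i + j) (i + j); rewrite -addnA leq_addl addnK => /(_ isT) h1.
have := @bin_fact (i + j) i; rewrite leq_addr addKn => /(_ isT) h2.
have := @bin_fact (m + i + j) j; rewrite leq_addl addnK -addnA => /(_ isT) h3.
have := @bin_fact (m + i) i; rewrite leq_addl addnK => /(_ isT) h4.
move: h1 h2 h3 h4; rewrite ?addnA.
move: 'C(_, i + j) 'C(i + j, i) 'C(_, j) 'C(m + i, i) (m + i + j)`! (m + i)`! (i + j)`! i`! j`! m`!.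
move=> a b c e A B C I J M h1 h2 h3 h4.
transitivity (A * B * C)%N; [rewrite -h1 -h2 | rewrite -h3 -h4]; ring.
Qed.

Lemma coef_finite_free_add d p q m : (m <= d)%N ->
  (finite_free_add d p q)`_m = (-1) ^+ (d - m) * 'C(d, d - m)%:R *
     \sum_(i < (d - m).+1) 'C(d - m, i)%:R * ecoef d p i * ecoef d q (d - m - i)%N.
Proof.
move=> md; rewrite /finite_free_add coef_sum.
have dmd : (d - m < d.+1)%N by rewrite ltnS leq_subr.
rewrite (bigD1 (Ordinal dmd)) //= coefZ coefXn subKn // eqxx mulr1 [X in _ + X]big1 ?addr0 //.
move=> k kn; rewrite coefZ coefXn; case: eqP; rewrite ?mulr0 // => mk.
by case/eqP: kn; apply: val_inj; rewrite /= mk subKn // -ltnS.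
Qed.

Lemma size_finite_free_add d p q : (size (finite_free_add d p q) <= d.+1)%N.
Proof.
apply: (leq_trans (size_sum _ _ _)); apply/bigmax_leqP => k _.
by rewrite (leq_trans (size_scale_leq _ _)) // size_polyXn ltnS leq_subr.
Qed.

(** The convolution applies to [q] the differential operator whose coefficients are
 those of [p]. *)
Lemma finite_free_addE d p q : (size q <= d.+1)%N ->
  finite_free_add d p q = \sum_(i < d.+1) (p`_(d - i) / 'C(d, i)%:R) *: q^`N(i).
Proof.
move=> sq; apply/polyP => m; rewrite [RHS]coef_sum.
have [md|dm] := leqP m d; last first.
  rewrite nth_default ?(leq_trans (size_finite_free_add _ _ _)) //.
  rewrite big1 // => i _; rewrite coefZ coef_nderivn [q`_(_ + _)]nth_default ?mul0rn ?mulr0 //.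
  by rewrite (leq_trans sq) // ltn_addl.
rewrite coef_finite_free_add //.
rewrite [RHS](bigID (fun i : 'I_d.+1 => (i < (d - m).+1)%N)) /=.
rewrite [X in _ = _ + X]big1 ?addr0; last first.
  move=> i; rewrite -leqNgt => h; rewrite coefZ coef_nderivn [q`_(_ + _)]nth_default ?mul0rn ?mulr0 //.
  by rewrite (leq_trans sq) //; lia.
rewrite -(big_ord_widen _ (fun i => ((p`_(d - i) / 'C(d, i)%:R) *: q^`N(i))`_m));
  last by rewrite ltnS leq_subr.
rewrite mulr_sumr; apply: eq_bigr => i _.
have := ltn_ord i; rewrite ltnS; move: (nat_of_ord i) => {}i idm.
rewrite coefZ coef_nderivn /ecoef; set j := (d - m - i)%N.
have dE : d = (m + i + j)%N by rewrite /j; lia.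
have kE : (d - m = i + j)%N by rewrite /j; lia.
have -> : (d - j = i + m)%N by rewrite /j; lia.
have bn a b : (b <= a)%N -> 'C(a, b)%:R != 0 :> R.
  by move=> ba; rewrite pnatr_eq0 -lt0n bin_gt0.
have b1 : 'C(d, i)%:R != 0 :> R by apply: bn; lia.
have b2 : 'C(d, j)%:R != 0 :> R by apply: bn; lia.
have := congr1 (fun n => n%:R : R) (bin_trinomial m i j).
rewrite !natrM -dE -kE => E; rewrite (_ : 'C(i + m, i) = 'C(m + i, i)); last by rewrite addnC.
rewrite -[q`_(i + m) *+ _]mulr_natr.
have S : (-1) ^+ (d - m) * ((-1) ^+ i * (-1) ^+ j) = 1 :> R.
  by rewrite kE -!exprD -signr_odd oddD addbb.
transitivity ((-1) ^+ (d - m) * ((-1) ^+ i * (-1) ^+ j) * ('C(d, d - m)%:R * 'C(d - m, i)%:R)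
  * p`_(d - i) / 'C(d, i)%:R * q`_(i + m) / 'C(d, j)%:R).
  by field; rewrite b1 b2.
by rewrite S E; field; rewrite b1 b2.
Qed.

(** Taylor expansion of [q] at [x]: the coefficients of [q (x + y)], read in
 reverse, form the product of the factors [1 + (x - z) y]. *)
Lemma nderivn_prod_horner (s : seq R[i]) x i : (i <= size s)%N ->
  (\prod_(z <- s) ('X - z%:P))^`N(i).[x] =
  (\prod_(z <- [seq x - z | z <- s]) (1 + z *: 'X))`_(size s - i).
Proof.
rewrite big_map.
elim: s i => [|z s IH] i.
  by rewrite leqn0 => /eqP ->; rewrite !big_nil nderivn0 hornerE coef1.
have szF : (\prod_(z <- s) (1 + (x - z) *: 'X))`_(size s).+1 = 0.
  apply: nth_default; elim: (s) => [|y r IHs]; first by rewrite big_nil size_poly1.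
  rewrite big_cons; apply: (leq_trans (size_polyMleq _ _)) => /=.
  have : (size (1 + (x - y) *: 'X : {poly R[i]})%R <= 2)%N.
    rewrite (leq_trans (size_polyD _ _)) // geq_max size_poly1 /=.
    by rewrite (leq_trans (size_scale_leq _ _)) // size_polyX.
  by move=> h; rewrite -subn1 leq_subLR (leq_trans (leq_add h IHs)).
rewrite !big_cons /=; set F := \prod_(z <- s) (1 + _) in szF IH *.
set Q := \prod_(z <- s) _ in IH *.
have coefF j : ((1 + (x - z) *: 'X) * F)`_j = F`_j + (if j is i.+1 then (x - z) * F`_i else 0).
  by rewrite mulrDl mul1r coefD -scalerAl coefZ coefXM; case: j; rewrite ?mulr0.
have QE : ('X - z%:P) * Q = Q * 'X + 0%:P - z *: Q.
  by rewrite mulrBl mul_polyC addr0 mulrC.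
case: i => [_|i].
  rewrite nderivn0 subn0 coefF szF add0r hornerM hornerXsubC; congr (_ * _).
  by have := IH 0%N; rewrite nderivn0 subn0; apply.
rewrite ltnS subSS => il; rewrite coefF QE nderivnB nderivnZ nderivnMXaddC.
rewrite hornerD hornerN hornerZ hornerD hornerMX IH //.
rewrite -addrA; congr (_ + _).
case: ltngtP il => // [il|->] _.
  have -> : (size s - i = (size s - i.+1).+1)%N by lia.
  by rewrite IH //; ring.
rewrite subnn [Q^`N(_)]nderivn_poly0 ?horner0; first by ring.
by rewrite /Q size_prod_XsubC.
Qed.

Lemma real_rooted_monic d p : real_rooted d p -> size p = d.+1 /\ p`_d = 1.
Proof.
case=> s sd ->; rewrite size_prod_XsubC sd; split=> //.
have := monic_prod_XsubC s xpredT id; rewrite monicE lead_coefE size_prod_XsubC sd /=.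
by move/eqP.
Qed.

Lemma finite_free_add_monic d p q : real_rooted d p -> real_rooted d q ->
  size (finite_free_add d p q) = d.+1 /\ (finite_free_add d p q)`_d = 1.
Proof.
move=> /real_rooted_monic[sp pd] /real_rooted_monic[sq qd].
have E : (finite_free_add d p q)`_d = 1.
  by rewrite coef_finite_free_add // subnn big_ord1 /ecoef !bin0 !subn0 pd qd expr0 !mulr1 invr1 !mulr1.
split=> //; apply/eqP; rewrite eqn_leq size_finite_free_add ltnNge.
by apply/negP => /leq_sizeP/(_ d (leqnn d)) /eqP; rewrite E oner_eq0.
Qed.

(** By [finite_free_addE] and Taylor expansion, the value at [x] is the polar form
 of [p] at the points [x - y], for [y] the roots of [q]. As the [y] are real,
 these points lie in the upper half-plane with [x]. *)
Lemma finite_free_add_no_upper_root d p q x :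
  real_rooted d p -> real_rooted d q -> 0 < complex.Im x ->
  (map_poly (real_complex R) (finite_free_add d p q)).[x] != 0.
Proof.
move=> rp rq x0; have [sp pd] := real_rooted_monic rp.
have [sq qd] := real_rooted_monic rq.
have [s sd pE] := rp; have [t td qE] := rq.
rewrite finite_free_addE ?sq // rmorph_sum horner_sum /=.
(* The coefficients of [p] in the binomial normalization. *)
pose c j := (p`_j / 'C(d, d - j)%:R)%:C.
have cE : binomial_poly d c = map_poly (real_complex R) p.
  apply/polyP => j; rewrite coef_poly coef_map /=; case: ltnP => jd.
    rewrite /c -[_ *+ _]mulr_natr -(rmorph_nat (real_complex R)) -rmorphM /=.
    by rewrite bin_sub // divfK // pnatr_eq0 -lt0n bin_gt0.
  by rewrite nth_default ?sp.
have low : roots_below (binomial_poly d c).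
  move=> z; rewrite cE pE rmorph_prod /=.
  rewrite (eq_bigr (fun y : R => 'X - (y%:C)%:P)) => [|y _]; last by rewrite rmorphB /= map_polyX map_polyC.
  rewrite -(big_map (real_complex R) xpredT (fun y => 'X - y%:P)) root_prod_XsubC.
  by case/mapP => y _ ->.
have up z : z \in [seq x - y%:C | y <- t] -> 0 < complex.Im z.
  by case/mapP => y _ ->; rewrite ImD ImN /= oppr0 addr0.
have cd : c d != 0 by rewrite /c pd subnn bin0 invr1 mulr1 oner_eq0.
have := grace _ cd low up; rewrite size_map => /(_ td).
rewrite (reindex_inj rev_ord_inj) /=; apply: contraNneq => E.
apply/eqP; rewrite -[RHS]E.
have term (i : 'I_d.+1) : (map_poly (real_complex R) ((p`_(d - i) / 'C(d, i)%:R) *: q^`N(i))).[x]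
   = (\prod_(z <- [seq x - y%:C | y <- t]) (1 + z *: 'X))`_(d.+1 - i.+1) * c (d.+1 - i.+1)%N.
  rewrite map_polyZ hornerZ subSS mulrC /c.
  have id : (i <= d)%N by rewrite -ltnS.
  rewrite subKn //; congr (_ * _).
  rewrite -nderivn_map qE rmorph_prod /=.
  under eq_bigr => y _ do rewrite rmorphB /= map_polyX map_polyC.
  rewrite -(big_map (real_complex R) xpredT (fun y => 'X - y%:P)).
  by rewrite nderivn_prod_horner size_map td // -map_comp.
by rewrite (eq_bigr _ (fun i _ => term i)).
Qed.

(** Complex conjugation permutes the roots, so none lies in the lower half-plane
 either. *)
Lemma finite_free_add_real_rooted d p q :
  real_rooted d p -> real_rooted d q -> real_rooted d (finite_free_add d p q).
Proof.
move=> rp rq; set P := finite_free_add d p q.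
have [sP Pd] := finite_free_add_monic rp rq; rewrite -/P in sP Pd.
pose PC := map_poly (real_complex R) P.
have real_root z : root PC z -> complex.Im z = 0.
  move=> rz; case: (ltrgtP (complex.Im z) 0) => // h.
    have: root PC z^*.
      have <- : map_poly conjc PC = PC.
        rewrite -map_poly_comp; apply: eq_map_poly => y /=; exact: conjc_real.
      by rewrite complex_root_conj conjcK.
    rewrite rootE (negPf (finite_free_add_no_upper_root rp rq _)) //.
    by case: z h {rz} => a b /=; rewrite oppr_gt0.
  by move: rz; rewrite rootE (negPf (finite_free_add_no_upper_root rp rq _)).
have [zs PCE] := closed_field_poly_normal PC.
have ld : lead_coef PC = 1.
  by rewrite lead_coef_map /= lead_coefE sP /= Pd.
rewrite ld scale1r in PCE.
have zsE : zs = [seq (y%:C)%C | y <- [seq complex.Re z | z <- zs]].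
  rewrite -map_comp -[LHS]map_id; apply/eq_in_map => z zzs /=.
  have : root PC z by rewrite PCE root_prod_XsubC.
  by move/real_root; case: z {zzs} => a b /= ->.
have E : P = \prod_(y <- [seq complex.Re z | z <- zs]) ('X - y%:P).
  apply: (map_poly_inj (real_complex R)); rewrite -/PC PCE {1}zsE !big_map rmorph_prod /=.
  by apply: eq_bigr => y _; rewrite rmorphB /= map_polyX map_polyC.
exists [seq complex.Re z | z <- zs] => //.
by move: sP; rewrite E size_prod_XsubC => -[].
Qed.

End Walsh.

(** * Finite free cumulants *)

Section FiniteFreeCumulants.
Variable R : realType.
Implicit Types (p q : {poly R}).

(** The logarithm turns the coefficients [e] of an exponential generating function
 into its cumulants. *)
Definition classical_cumulant (e : nat -> R) n : R :=
  partition_sum e (@log_weight R) [set: 'I_n].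

Lemma finite_free_cumulantE d p n : finite_free_cumulant d p n =
  (- d%:R) ^+ n.-1 / (n.-1)`!%:R * classical_cumulant (ecoef d p) n.
Proof.
congr (_ * _); apply: eq_big => [P|P _]; first by rewrite /partitions inE.
by [].
Qed.

Lemma classical_cumulant_recursion (e : nat -> R) n : e 0%N = 1 ->
  e n.+1 = \sum_(k < n.+1) 'C(n, k)%:R * (classical_cumulant e k.+1 * e (n - k)%N).
Proof. by move=> e0; apply: partition_log_recursion. Qed.

Lemma ecoef0 d p : real_rooted d p -> ecoef d p 0 = 1.
Proof.
by move=> /real_rooted_monic[_ pd]; rewrite /ecoef expr0 subn0 bin0 mul1r pd divr1.
Qed.

Lemma ecoef_finite_free_add d p q k : (k <= d)%N ->
  ecoef d (finite_free_add d p q) k =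
  \sum_(i < k.+1) 'C(k, i)%:R * ecoef d p i * ecoef d q (k - i)%N.
Proof.
move=> kd; rewrite {1}/ecoef coef_finite_free_add ?leq_subr // subKn //.
have b0 : 'C(d, k)%:R != 0 :> R by rewrite pnatr_eq0 -lt0n bin_gt0.
have S : (-1) ^+ k * (-1) ^+ k = 1 :> R by rewrite -exprD -signr_odd oddD addbb.
move: (\sum_(_ < _) _) => X.
transitivity ((-1) ^+ k * (-1) ^+ k * X); last by rewrite S mul1r.
by field.
Qed.

End FiniteFreeCumulants.

From mathcomp Require Import all_classical all_reals all_analysis.
Import numFieldNormedType.Exports.
Local Open Scope classical_set_scope.
Local Open Scope ring_scope.

(** * The ring of formal power series *)

(** An alias, because plain functions already carry the pointwise product. *)
Definition fps (R : realType) := nat -> R.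

Section SeriesRing.
Variable R : realType.
Implicit Types a b c : fps R.

HB.instance Definition _ := GRing.Zmodule.on (fps R).

Definition fps_trunc (N : nat) a : {poly R} := \poly_(i < N) a i.

(** The ring laws of series follow from those of their truncations, which are
 polynomials. *)
Lemma coef_fs_mul N a b k : (k < N)%N ->
  fs_mul a b k = (fps_trunc N a * fps_trunc N b)`_k.
Proof.
move=> kN; rewrite coefM; apply: eq_bigr => i _; rewrite !coef_poly.
by rewrite (leq_ltn_trans _ kN) ?leq_ord // (leq_ltn_trans (leq_subr _ _) kN).
Qed.

Lemma fs_mulC : commutative (@fs_mul R).
Proof.
by move=> a b; apply/funext => k; rewrite !(@coef_fs_mul k.+1) // mulrC.
Qed.

Lemma fs_mulA : associative (@fs_mul R).
Proof.
move=> a b c; apply/funext => k.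
transitivity ((fps_trunc k.+1 a * fps_trunc k.+1 b * fps_trunc k.+1 c)`_k).
  rewrite -mulrA coefM; apply: eq_bigr => i _.
  rewrite coef_poly ltn_ord; congr (_ * _).
  by rewrite (@coef_fs_mul k.+1) // ltnS leq_subr.
rewrite coefM; apply: eq_bigr => i _.
rewrite coef_poly ltnS leq_subr; congr (_ * _).
by rewrite (@coef_fs_mul k.+1).
Qed.

Lemma fs_mul1 : left_id (@fs_one R) (@fs_mul R).
Proof.
move=> a; apply/funext => k; rewrite /fs_mul big_ord_recl /= mul1r subn0 big1 ?addr0 //.
by move=> i _; rewrite mul0r.
Qed.

Lemma fs_mulDl : left_distributive (@fs_mul R) (fun a b => a + b : fps R).
Proof.
move=> a b c; apply/funext => k; rewrite /fs_mul.
transitivity (\sum_(i < k.+1) (a i * c (k - i)%N + b i * c (k - i)%N)).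
  by apply: eq_bigr => i _; rewrite -mulrDl.
by rewrite big_split.
Qed.

Lemma fs_one_neq0 : (@fs_one R : fps R) != 0.
Proof. by apply/eqP => /(congr1 (fun f : fps R => f 0%N)) /eqP; rewrite oner_eq0. Qed.

HB.instance Definition _ := GRing.Zmodule_isComNzRing.Build (fps R)
  fs_mulA fs_mulC fs_mul1 fs_mulDl fs_one_neq0.

Lemma fs_expE a j : fs_exp a j = (a : fps R) ^+ j.
Proof. by elim: j => //= j IH; rewrite exprS -IH. Qed.

Lemma fpsM a b k : (a * b) k = \sum_(i < k.+1) a i * b (k - i)%N.
Proof. by []. Qed.

Lemma fpsD a b k : (a + b) k = a k + b k.
Proof. by []. Qed.
Lemma fps0 k : (0 : fps R) k = 0.
Proof. by []. Qed.
Lemma fps1 k : (1 : fps R) k = (k == 0)%:R.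
Proof. by []. Qed.
Lemma fpsB a b k : (a - b) k = a k - b k.
Proof. by []. Qed.
Lemma fpsN a k : (- a) k = - a k.
Proof. by []. Qed.

Lemma fpsMn a j k : (a *+ j) k = a k *+ j.
Proof. by elim: j => [|j IH]; rewrite ?mulr0n // !mulrS fpsD IH. Qed.

Definition fps_const (c : R) : fps R := fun n => if n == 0%N then c else 0.
Definition fps_shift j a : fps R := fun n => if (j <= n)%N then a (n - j)%N else 0.
(** The derivation [z d/dz]. *)
Definition fps_euler a : fps R := fun n => n%:R * a n.

Lemma fps_const0 : fps_const 0 = 0.
Proof. by apply/funext => n; rewrite /fps_const if_same. Qed.

Lemma fps_constM (c : R) a n : (fps_const c * a) n = c * a n.
Proof.
rewrite fpsM big_ord_recl /= subn0 big1 ?addr0 // => i _.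
by rewrite mul0r.
Qed.

Lemma fps_constMM (c d : R) : fps_const c * fps_const d = fps_const (c * d).
Proof.
by apply/funext => n; rewrite fps_constM /fps_const; case: ifP; rewrite ?mulr0.
Qed.

Lemma fps_shiftE j a : fps_shift j a = fps_shift j 1 * a.
Proof.
apply/funext => n; rewrite fpsM /fps_shift; case: leqP => [jn|nj].
  rewrite (bigD1 (Ordinal (jn : (j < n.+1)%N))) //= leqnn subnn mul1r.
  rewrite big1 ?addr0 // => i /eqP ij; case: leqP => [ji|]; last by rewrite mul0r.
  rewrite fps1 subn_eq0 leqNgt ltn_neqAle ji andbT.
  by case: eqP => [E|_]; rewrite ?mul0r //; case: ij; apply: val_inj.
rewrite big1 // => i _; rewrite leqNgt (leq_ltn_trans _ nj) ?mul0r //.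
by rewrite -ltnS.
Qed.

Lemma fps_shiftMr j a b : a * fps_shift j b = fps_shift j (a * b).
Proof. by rewrite [LHS]mulrC fps_shiftE [RHS]fps_shiftE -mulrA [b * a]mulrC. Qed.

Lemma fps_shift_shift i j a : fps_shift i (fps_shift j a) = fps_shift (i + j) a.
Proof.
apply/funext => n; rewrite /fps_shift -subnDA; case: (leqP i n) => [lein|ltni].
  by rewrite leq_subRL.
by rewrite leqNgt (leq_trans ltni) ?leq_addr.
Qed.

Lemma fps_shift_euler j a :
  fps_euler (fps_shift j a) =
  fps_shift j (fps_euler a + a *+ j).
Proof.
apply/funext => n; rewrite /fps_euler /fps_shift; case: leqP => jn; last by rewrite mulr0.
rewrite fpsD fpsMn -[X in _ = _ + X]mulr_natl -mulrDl -natrD subnK //.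
Qed.

Lemma fps_eulerM a b :
  fps_euler (a * b) = fps_euler a * b + a * fps_euler b.
Proof.
apply/funext => n; rewrite /fps_euler fpsD !fpsM mulr_sumr -big_split /=.
apply: eq_bigr => i _; have in_ : (i <= n)%N by rewrite -ltnS.
rewrite natrB //; ring.
Qed.

(** Series with constant coefficient 1 are regular. *)
Lemma fps_mulI a b c : a 0%N = 1 -> a * b = a * c -> b = c.
Proof.
move=> a0 E; apply/funext => n; elim: n {-2}n (leqnn n) => [|N IH] n nN.
  move: nN; rewrite leqn0 => /eqP ->.
  have := congr1 (fun f : fps R => f 0%N) E.
  by rewrite !fpsM !big_ord1 a0 !mul1r.
have := congr1 (fun f : fps R => f n) E.
rewrite !fpsM !big_ord_recl /= a0 !mul1r subn0 => E'.
apply: (@addIr _ (\sum_(i < n) a (bump 0 i) * b (n - bump 0 i)%N)).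
rewrite E'; congr (_ + _); apply: eq_bigr => i _; rewrite IH //.
by have := ltn_ord i; rewrite /bump; lia.
Qed.

(** The formal sum of the [z^(k+1) F_k], which has finitely many terms in each
 degree. *)
Definition diag_sum (F : nat -> fps R) : fps R :=
  fun n => \sum_(k < n) F k (n - k.+1)%N.

Lemma diag_sum_shift F n N : (n <= N)%N ->
  diag_sum F n = (\sum_(k < N) fps_shift k.+1 (F k)) n.
Proof.
move=> nN; rewrite /diag_sum.
have -> : (\sum_(k < N) fps_shift k.+1 (F k)) n =
  \sum_(k < N) fps_shift k.+1 (F k) n.
  by elim/big_ind2: _ => // x a y b <- <-.
rewrite [RHS](bigID (fun k : 'I_N => k < n)%N) /= [X in _ + X]big1 ?addr0.
  rewrite -(big_ord_widen_cond _ xpredT (fun k => fps_shift k.+1 (F k) n)) //.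
  by apply: eq_bigr => k _; rewrite /fps_shift ltn_ord.
by move=> k /negPf kn; rewrite /fps_shift kn.
Qed.

Lemma fps_mul_local a b c n : (forall k, (k <= n)%N -> b k = c k) ->
  (a * b) n = (a * c) n.
Proof. by move=> E; rewrite !fpsM; apply: eq_bigr => i _; rewrite E // leq_subr. Qed.

Lemma mul_diag_sum a F : a * diag_sum F = diag_sum (fun k => a * F k).
Proof.
apply/funext => n; rewrite (fps_mul_local _ (c := \sum_(k < n) fps_shift k.+1 (F k))).
  rewrite (@diag_sum_shift _ n n) // mulr_sumr; congr (_ n).
  by apply: eq_bigr => k _; rewrite fps_shiftMr.
by move=> k kn; apply: diag_sum_shift.
Qed.

Lemma diag_sumD F G : diag_sum F + diag_sum G = diag_sum (fun k => F k + G k).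
Proof. by apply/funext => n; rewrite fpsD /diag_sum -big_split. Qed.

Lemma diag_sumB F G : diag_sum F - diag_sum G = diag_sum (fun k => F k - G k).
Proof.
apply/funext => n; rewrite fpsB /diag_sum -sumrB; apply: eq_bigr => k _.
by rewrite fpsB.
Qed.

Lemma euler_diag_sum F : fps_euler (diag_sum F) =
  diag_sum (fun k => fps_euler (F k) + F k *+ k.+1).
Proof.
apply/funext => n; rewrite /fps_euler /diag_sum mulr_sumr.
apply: eq_bigr => k _; have := congr1 (fun f : fps R => f n) (fps_shift_euler k.+1 (F k)).
by rewrite /fps_euler /fps_shift ltn_ord.
Qed.

End SeriesRing.

(** * The moment-cumulant equation *)

Section System.
Variable R : realType.
Implicit Types (a b m ka : fps R) (eps d : R).

(** For the moments [m] of a polynomial [p] of degree [d] and [eps = 1/d], the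
 series [z^-k M_k(1/z)] is [p^(k) / (d^k p)]; the recursion is the quotient rule.
 For [eps = 0] it is the power [m ^+ k]. *)
Fixpoint cauchy_power eps m k : fps R :=
  if k is j.+1 then
    m * cauchy_power eps m j
      - fps_const eps * (cauchy_power eps m j *+ j
                            + fps_euler (cauchy_power eps m j))
  else 1.

Lemma cauchy_power0 m k : cauchy_power 0 m k = m ^+ k.
Proof.
elim: k => [|k IH]; first by rewrite expr0.
by rewrite /= exprS -IH fps_const0 mul0r subr0.
Qed.

Lemma cauchy_powerS eps m k n : cauchy_power eps m k.+1 n =
  (m * cauchy_power eps m k) n - eps * ((k + n)%:R * cauchy_power eps m k n).
Proof.
rewrite /= fpsB fps_constM fpsD fpsMn.
by rewrite -[X in X + fps_euler _ _]mulr_natl natrD mulrDl.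
Qed.

Definition cumulant_equation eps ka m : Prop :=
  m = 1 + diag_sum (fun k => fps_const (ka k.+1) * cauchy_power eps m k.+1).

Lemma cumulant_equation0 eps ka m : cumulant_equation eps ka m -> m 0%N = 1.
Proof. by move=> H; rewrite H fpsD fps1 /diag_sum big_ord0 addr0. Qed.

(** The series [a] and [b] are, up to the normalization of the coefficients, the
 polynomial [p] and the operator [P(D)] with [p = P(D) x^d]: the hypothesis on
 [fps_euler a] is Newton's identities and the last one says that the cumulants
 are the coefficients of [log P]. Multiplying the equation by [a] turns [M_k]
 into the [k]-th derivative of [p], that is, into the product [aM] below, and
 leaves the recursion for the coefficients of [b]. *)
Lemma cumulant_equation_of_newton d a b m ka : d != 0 -> a 0%N = 1 -> m 0%N = 1 ->
  (forall n, a n = d ^+ n * falling_weight d n * b n) ->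
  fps_euler a = - (fps_const d * (m - 1) * a) ->
  (forall n, n%:R * b n = - (d * \sum_(k < n) ka k.+1 * d^-1 ^+ k.+1 * b (n - k.+1)%N)) ->
  cumulant_equation d^-1 ka m.
Proof.
move=> d0 a0 m0 ab eulera eulerb; set M := cauchy_power d^-1 m.
have dK : fps_const d^-1 * fps_const d = 1.
  by rewrite fps_constMM mulVf //; apply/funext => n; rewrite /fps_const fps1; case: n.
(* [a M_k] is [p^(k)] up to [d^k]: differentiation multiplies the coefficient of
   [x^(d-n)] by [d - n], then [d - n - 1], and so on. *)
have aM k n : (a * M k) n = a n * \prod_(i < k) (1 - (n + i)%:R / d).
  elim: k n => [|k IH] n; first by rewrite big_ord0 /M /= !mulr1.
  have -> : a * M k.+1 = a * M k - fps_const d^-1 * ((a * M k) *+ k +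
              fps_euler (a * M k)).
    rewrite fps_eulerM eulera /M /= -/(M k).
    have -> : - (fps_const d * (m - 1) * a) * M k =
      - (fps_const d * ((m - 1) * a * M k)) by ring.
    rewrite [fps_const d^-1 * (_ *+ k + (_ + _))]mulrDr.
    rewrite [in RHS]mulrDr.
    rewrite [fps_const d^-1 * - _]mulrN [fps_const _ * (_ * (_ * _))]mulrA dK.
    rewrite -[M k *+ k]mulr_natr -[(a * M k) *+ k]mulr_natr. ring.
  rewrite fpsB fps_constM fpsD fpsMn /fps_euler big_ord_recr /= !IH.
  by rewrite natrD; field.
apply: (@fps_mulI _ a) => //.
rewrite mulrDr mulr1 mul_diag_sum.
apply/funext => n.
have -> : a * m = a + (m - 1) * a by ring.
rewrite !fpsD; congr (_ + _).
have -> : (m - 1) * a = - (fps_const d^-1 * fps_euler a).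
  by rewrite eulera mulrN opprK !mulrA dK mul1r.
rewrite fpsN fps_constM /fps_euler ab.
have -> : - (d^-1 * (n%:R * (d ^+ n * falling_weight d n * b n))) =
    - (d^-1 * (d ^+ n * falling_weight d n) * (n%:R * b n)) by ring.
rewrite eulerb mulrN opprK !mulr_sumr.
apply: eq_bigr => k _.
rewrite [a * _]mulrCA fps_constM -/(M _) aM ab.
have kn : (k.+1 <= n)%N := ltn_ord k.
have -> : falling_weight d n = falling_weight d (n - k.+1) *
     \prod_(i < k.+1) (1 - (n - k.+1 + i)%:R / d).
  rewrite /falling_weight -[in LHS](subnK kn) big_split_ord /=.
  by [].
have -> : d ^+ n = d ^+ (n - k.+1) * d ^+ k.+1 by rewrite -exprD subnK.
rewrite exprVn; field.
by rewrite d0 expf_neq0.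
Qed.
End System.

(** * The genus expansion solves the equation *)

Section GenusEquation.
Variable R : realType.
Implicit Types (ka : fps R).

(** In terms of exponential generating functions: [z Phi' = z Ga' Phi]. *)
Lemma egf_recursion (phi ga : nat -> R) n :
  phi n.+1 = \sum_(k < n.+1) 'C(n, k)%:R * (ga k.+1 * phi (n - k)%N) ->
  n.+1%:R * (phi n.+1 / (n.+1`!)%:R) =
  \sum_(k < n.+1) ga k.+1 / (k`!)%:R * (phi (n - k)%N / ((n - k)`!)%:R).
Proof.
have f0 m : (m`!)%:R != 0 :> R by rewrite pnatr_eq0 -lt0n fact_gt0.
move=> E; have -> : n.+1%:R * (phi n.+1 / (n.+1`!)%:R) = phi n.+1 / (n`!)%:R.
  have n0 : n.+1%:R != 0 :> R by rewrite pnatr_eq0.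
  by rewrite factS natrM; move: n.+1%:R n0 => x x0; field; rewrite f0 x0.
rewrite E mulr_suml.
apply: eq_bigr => k _; have kn : (k <= n)%N by rewrite -ltnS.
apply: (mulIf (f0 n)); rewrite divfK // -(bin_fact kn) !natrM.
by field; rewrite !f0.
Qed.

(** Take [b] and [a] to be the exponential generating functions of permutations,
 respectively pairs of permutations, with cycle weights for which the second
 permutation contributes the falling factorial. Their logarithms sum over
 cycles, which gives the cumulants, respectively over transitive pairs, which
 gives the moments. *)
Lemma genus_cumulant_equation (d : nat) ka : (0 < d)%N ->
  cumulant_equation d%:R^-1 ka (genus_moment d%:R^-1 ka).
Proof.
move=> d0; have dn0 : d%:R != 0 :> R by rewrite pnatr_eq0 -lt0n.
pose u k : R := - d%:R * (ka k * d%:R^-1 ^+ k).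
pose v k : R := (-1) ^+ k.+1 * d%:R.
pose b : fps R := fun n => perm_total u n / (n`!)%:R.
pose a : fps R := fun n => perm_total u n * perm_total v n / (n`!)%:R.
have fact0' m : (m`!)%:R != 0 :> R by rewrite pnatr_eq0 -lt0n fact_gt0.
apply: (@cumulant_equation_of_newton _ d%:R a b) => //.
- by rewrite /a !perm_total0 fact0; field.
- by move=> n; rewrite /a /b perm_total_falling //; ring.
- apply/funext => -[|n].
    rewrite /fps_euler mul0r fpsN -mulrA fps_constM fpsM big_ord1 fpsB fps1.
    by rewrite /genus_moment /= subrr mul0r mulr0 oppr0.
  rewrite /fps_euler fpsN -mulrA fps_constM fpsM big_ord_recl fpsB fps1.
  rewrite [genus_moment _ _ _]/genus_moment /= subrr mul0r add0r mulr_sumr -sumrN.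
  rewrite /a (egf_recursion (phi := fun n => perm_total u n * perm_total v n)
    (perm_total_pairS u v n)); apply: eq_bigr => k _.
  rewrite /bump /= add1n subSS fpsB fps1 subr0 transitive_total_genus //=.
  by field; rewrite !fact0'.
- move=> [|n]; first by rewrite big_ord0 mul0r mulr0 oppr0.
rewrite /b (egf_recursion (phi := perm_total u) (ga := fun k => ((k.-1)`!)%:R * u k)); last first.
  by rewrite perm_totalS.
rewrite mulr_sumr -sumrN; apply: eq_bigr => k _.
rewrite subSS /u /=; field.
by rewrite !fact0' ?dn0.
Qed.

End GenusEquation.

(** * First-order expansions in 1/d *)

Section Expansion.
Variable R : realType.
Implicit Types (f g : nat -> R) (x y : R).

(** The expansion [f d = x + y / d + o(1/d)]. Such pairs [(x, y)] calculate like
 dual numbers. *)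
Definition expands f x y : Prop := d%:R * (f d - x) @[d --> \oo] --> y.

Lemma expands_eq f x y x' y' : expands f x y -> x = x' -> y = y' ->
  expands f x' y'.
Proof. by move=> ? <- <-. Qed.

Lemma expands_near f g x y : (forall d, (0 < d)%N -> f d = g d) ->
  expands f x y -> expands g x y.
Proof.
move=> fg; apply: cvg_trans; apply: near_eq_cvg; near=> d.
rewrite fg //; near: d; exact: nbhs_infty_gt.
Unshelve. all: by end_near. Qed.

Lemma expands_near_inf f g x y : (\forall d \near \oo, f d = g d) ->
  expands f x y -> expands g x y.
Proof.
move=> fg; apply: cvg_trans; apply: near_eq_cvg; near=> d.
by congr (_ * (_ - _)); near: d.
Unshelve. all: by end_near. Qed.

Lemma cvg_inv_nat : d%:R^-1 @[d --> \oo] --> (0 : R).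
Proof. by rewrite -(cvg_shiftS (fun d => d%:R^-1 : R)); exact: cvg_harmonic. Qed.

Lemma expands_cvg f x y : expands f x y -> f d @[d --> \oo] --> x.
Proof.
move=> fxy.
have H : x + d%:R^-1 * (d%:R * (f d - x)) @[d --> \oo] --> x.
  rewrite -[X in _ --> X]addr0 -[X in _ + X](mul0r y).
  by apply: cvgD; [exact: cvg_cst | apply: cvgM => //; exact: cvg_inv_nat].
apply: cvg_trans H; apply: near_eq_cvg; near=> d.
have d0 : (0 < d)%N by near: d; exact: nbhs_infty_gt.
by rewrite mulKf ?pnatr_eq0 -?lt0n // addrC subrK.
Unshelve. all: by end_near. Qed.

Lemma expands_unique f x y x' y' : expands f x y -> expands f x' y' ->
  x = x' /\ y = y'.
Proof.
move=> fxy fxy'; have E : x = x'.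
  by apply: (cvg_unique _ (expands_cvg fxy) (expands_cvg fxy')).
split=> //; subst x'; exact: (cvg_unique _ fxy fxy').
Qed.

Lemma expandsD f g x y x' y' : expands f x y -> expands g x' y' ->
  expands (fun d => f d + g d) (x + x') (y + y').
Proof.
move=> fx gx; apply: cvg_trans (cvgD fx gx); apply: near_eq_cvg; near=> d.
by rewrite !fctE /=; ring.
Unshelve. all: by end_near. Qed.

Lemma expands_cst x : expands (fun=> x) x 0.
Proof.
rewrite /expands; under eq_fun do rewrite subrr mulr0; exact: cvg_cst.
Qed.

Lemma expandsM f g x y x' y' : expands f x y -> expands g x' y' ->
  expands (fun d => f d * g d) (x * x') (x * y' + y * x').
Proof.
move=> fx gx; apply: cvg_trans (cvgD (cvgM (expands_cvg fx) gx) (cvgM fx (cvg_cst x'))).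
apply: near_eq_cvg; near=> d.
by rewrite !fctE /=; ring.
Unshelve. all: by end_near. Qed.

Lemma expandsN f x y : expands f x y -> expands (fun d => - f d) (- x) (- y).
Proof.
move=> fx; apply: cvg_trans (cvgN fx); apply: near_eq_cvg; near=> d.
by rewrite !fctE /=; ring.
Unshelve. all: by end_near. Qed.

Lemma expandsB f g x y x' y' : expands f x y -> expands g x' y' ->
  expands (fun d => f d - g d) (x - x') (y - y').
Proof. by move=> fx gx; apply: expandsD => //; apply: expandsN. Qed.

Lemma expands_inv : expands (fun d => d%:R^-1) 0 1.
Proof.
have H : (fun=> 1 : R) d @[d --> \oo] --> (1 : R) by exact: cvg_cst.
apply: cvg_trans H; apply: near_eq_cvg; near=> d.
by rewrite subr0 mulfV // pnatr_eq0 -lt0n; near: d; exact: nbhs_infty_gt.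
Unshelve. all: by end_near. Qed.

Lemma expandsV f x y : x != 0 -> expands f x y ->
  expands (fun d => (f d)^-1) x^-1 (- (y / x ^+ 2)).
Proof.
move=> x0 fx; have fc := expands_cvg fx.
rewrite expr2 invfM.
apply: cvg_trans (cvgN (cvgM fx (cvgM (cvgV x0 fc) (cvg_cst x^-1)))); apply: near_eq_cvg; near=> d.
have fd0 : f d != 0.
  near: d; exact: (cvgr_neq0 _ fc x0).
by rewrite !fctE /=; field; rewrite fd0 x0.
Unshelve. all: by end_near. Qed.

Lemma expands_sum (I : Type) (s : seq I) (F : nat -> I -> R) (X Y : I -> R) :
  (forall i, expands (F ^~ i) (X i) (Y i)) ->
  expands (fun d => \sum_(i <- s) F d i) (\sum_(i <- s) X i) (\sum_(i <- s) Y i).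
Proof.
move=> H; elim: s => [|i s IH].
  rewrite !big_nil; apply: expands_near (expands_cst 0) => d _; by rewrite big_nil.
rewrite !big_cons; apply: expands_near (expandsD (H i) IH) => d _; by rewrite big_cons.
Qed.

End Expansion.

(** * Expanding the moment-cumulant equation *)

Section FirstOrder.
Variable R : realType.
Implicit Types (a b m r : fps R) (f g : nat -> fps R).

Definition expands_upto N f a b :=
  forall n, (n <= N)%N -> expands (fun d => f d n) (a n) (b n).

Lemma expands_uptoM N f g a b a' b' :
  expands_upto N f a b -> expands_upto N g a' b' ->
  expands_upto N (fun d => f d * g d) (a * a') (a * b' + b * a').
Proof.
move=> fa ga n nN; rewrite fpsD !fpsM -big_split /=.
apply: (@expands_sum _ _ _ (fun d (i : 'I_n.+1) => f d i * g d (n - i)%N)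
   (fun i => a i * a' (n - i)%N) (fun i => a i * b' (n - i)%N + b i * a' (n - i)%N)).
move=> i; apply: expandsM; [apply: fa | apply: ga]; have := ltn_ord i; lia.
Qed.

(** Minus the derivative of [cauchy_power] in [eps] at [0]. *)
Fixpoint power_correction m k : fps R :=
  if k is j.+1 then m * power_correction m j + (m ^+ j *+ j + fps_euler (m ^+ j))
  else 0.

(** The first-order term collects the variation of [m] and that of the parameter
 [1/d]. *)
Lemma expands_cauchy_power N f m m' k : expands_upto N f m m' ->
  expands_upto N (fun d => cauchy_power d%:R^-1 (f d) k) (m ^+ k)
    (m ^+ k.-1 * m' *+ k - power_correction m k).
Proof.
move=> fm; elim: k => [|k IH].
  move=> n _; rewrite expr0 mulr0n subr0 fps0; exact: expands_cst.
have H := expands_uptoM fm IH => n nN; rewrite exprS.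
have -> : m ^+ k.+1.-1 * m' *+ k.+1 - power_correction m k.+1 =
   (m * (m ^+ k.-1 * m' *+ k - power_correction m k) + m' * m ^+ k)
   - (m ^+ k *+ k + fps_euler (m ^+ k)).
  case: k {IH H} => [|k] /=; first by rewrite mulr1n !expr0 !mulr0n; ring.
  by rewrite [m ^+ k.+1]exprS; ring.
apply: expands_near => [d d0|]; first by rewrite cauchy_powerS.
have E := expandsM (@expands_inv R) (expandsM (expands_cst (k + n)%:R) (IH n nN)).
apply: expands_eq (expandsB (H n nN) E) _ _; first by ring.
rewrite !(fpsB, fpsD, fpsMn) /fps_euler natrD; ring.
Qed.

Lemma cumulant_equationS eps ka m n : cumulant_equation eps ka m ->
  m n.+1 = \sum_(k < n.+1) ka k.+1 * cauchy_power eps m k.+1 (n - k)%N.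
Proof.
move=> H; rewrite [in LHS]H fpsD fps1 add0r /diag_sum.
by apply: eq_bigr => k _; rewrite fps_constM subSS.
Qed.

Section Sequence.
Variables (ka m : nat -> fps R).
Hypothesis eq_km : forall d, (0 < d)%N -> cumulant_equation d%:R^-1 (ka d) (m d).

(** The coefficient of degree [n + 1] in the equation involves the moments up to
 [n] only. *)
Lemma expands_moments (r r' : fps R) :
  (forall n, expands (fun d => ka d n.+1) (r n.+1) (r' n.+1)) ->
  exists a a' : fps R, forall n, expands (fun d => m d n) (a n) (a' n).
Proof.
move=> kar.
have H N : exists a a' : fps R, expands_upto N m a a'.
  elim: N => [|N [a [a' IH]]].
    exists 1, 0 => n; rewrite leqn0 => /eqP ->; rewrite fps0 fps1.
    apply: expands_near (expands_cst 1) => d d0.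
    by rewrite (cumulant_equation0 (eq_km d0)).
  pose X := \sum_(k < N.+1) r k.+1 * (a ^+ k.+1) (N - k)%N.
  pose Y := \sum_(k < N.+1) (r k.+1 * (a ^+ k.+1.-1 * a' *+ k.+1
     - power_correction a k.+1) (N - k)%N + r' k.+1 * (a ^+ k.+1) (N - k)%N).
  exists (fun n => if n == N.+1 then X else a n).
  exists (fun n => if n == N.+1 then Y else a' n) => n.
  rewrite leq_eqVlt; case: eqP => [-> _ /=|_ /=]; last by rewrite ltnS; apply: IH.
  rewrite /X /Y.
  apply: expands_near => [d d0|].
    rewrite (cumulant_equationS _ (eq_km d0)); reflexivity.
  apply: (@expands_sum _ _ _ (fun d (k : 'I_N.+1) => ka d k.+1 *
     cauchy_power d%:R^-1 (m d) k.+1 (N - k)%N)) => k.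
  by apply: expandsM; [exact: kar | exact: (expands_cauchy_power IH (leq_subr k N))].
have /choice[xy xyP] : forall n, exists xy : R * R, expands (fun d => m d n) xy.1 xy.2.
  by move=> n; have [a [a' /(_ n (leqnn n)) E]] := H n; exists (a n, a' n).
by exists (fun n => (xy n).1), (fun n => (xy n).2).
Qed.

(** In degree [n + 1] the equation contains [kappa_(n+1)] with the factor
 [(M_(n+1))(0)]. This factor vanishes for small [d], but it tends to 1, so that
 it can be inverted for large [d]. *)
Lemma expands_cumulants (a a' : fps R) :
  (forall n, expands (fun d => m d n) (a n) (a' n)) ->
  exists r r' : fps R, forall n, expands (fun d => ka d n.+1) (r n.+1) (r' n.+1).
Proof.
move=> ma; have a0 : a 0%N = 1.
  have [] // := expands_unique (ma 0%N) (expands_near _ (expands_cst 1)).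
  by move=> d d0; rewrite (cumulant_equation0 (eq_km d0)).
have maN N : expands_upto N m a a' by move=> n _; apply: ma.
have H n : exists xy : R * R, expands (fun d => ka d n.+1) xy.1 xy.2.
  have [N] := ubnP n; elim: N n => // N IH n nN.
  have /choice[xy xyP] : forall k, exists xy : R * R, (k < n)%N ->
      expands (fun d => ka d k.+1) xy.1 xy.2.
    move=> k; case: (ltnP k n) => [kn|_]; last by exists (0, 0).
    by have [|xy xyP] := IH k; [lia | exists xy].
  (* All terms of the equation in degree [n.+1] but the one of [ka d n.+1]. *)
  pose S d := \sum_(k < n) ka d k.+1 * cauchy_power d%:R^-1 (m d) k.+1 (n - k)%N.
  have [x [y Sxy]] : exists x y, expands S x y.
    eexists; eexists.
    apply: (@expands_sum _ _ _ (fun d (k : 'I_n) => ka d k.+1 *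
       cauchy_power d%:R^-1 (m d) k.+1 (n - k)%N)) => k.
    apply: expandsM; first by apply: xyP; apply: ltn_ord.
    exact: (expands_cauchy_power (maN n) (leq_subr _ _)).
  have top := expands_cauchy_power (k := n.+1) (maN 0%N) (leqnn 0).
  have top1 : (a ^+ n.+1) 0%N != 0.
    suff -> : (a ^+ n.+1) 0%N = 1 by rewrite oner_eq0.
    elim: n.+1 => [|k IHk]; first by rewrite expr0 fps1.
    by rewrite exprS fpsM big_ord1 a0 IHk mul1r.
  have Q := expandsM (expandsB (ma n.+1) Sxy) (expandsV top1 top).
  eexists (_, _); apply: expands_near_inf Q; near=> d.
  have d0 : (0 < d)%N by near: d; exact: nbhs_infty_gt.
  have E0 : cauchy_power d%:R^-1 (m d) n.+1 0%N != 0.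
    near: d; exact: (cvgr_neq0 _ (expands_cvg top) top1).
  rewrite (cumulant_equationS _ (eq_km d0)) big_ord_recr /= -/(S d) subnn.
  by rewrite [S d + _]addrC addrK mulfK.
have /choice[xy xyP] := H.
by exists (fun n => (xy n.-1).1), (fun n => (xy n.-1).2).
Unshelve. all: by end_near. Qed.

(** Comparison of the coefficients of [1] and of [1/d]. *)
Lemma expands_limit_equation (r r' a a' : fps R) :
  (forall n, expands (fun d => ka d n.+1) (r n.+1) (r' n.+1)) ->
  (forall n, expands (fun d => m d n) (a n) (a' n)) ->
  cumulant_equation 0 r a /\
  a' = diag_sum (fun k => fps_const (r' k.+1) * a ^+ k.+1
        + fps_const (r k.+1) * (a ^+ k * a' *+ k.+1 - power_correction a k.+1)).
Proof.
move=> kar ma.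
have [a0 a'0] : a 0%N = 1 /\ a' 0%N = 0.
  apply: (expands_unique (ma 0%N) (expands_near _ (expands_cst 1))).
  by move=> d d0; rewrite (cumulant_equation0 (eq_km d0)).
have maN N : expands_upto N m a a' by move=> n _; apply: ma.
have S n : a n.+1 = \sum_(k < n.+1) r k.+1 * (a ^+ k.+1) (n - k)%N /\
   a' n.+1 = \sum_(k < n.+1) (r k.+1 * (a ^+ k.+1.-1 * a' *+ k.+1
     - power_correction a k.+1) (n - k)%N + r' k.+1 * (a ^+ k.+1) (n - k)%N).
  apply: (expands_unique (ma n.+1)); apply: expands_near => [d d0|].
    rewrite (cumulant_equationS _ (eq_km d0)); reflexivity.
  apply: (@expands_sum _ _ _ (fun d (k : 'I_n.+1) => ka d k.+1 *
     cauchy_power d%:R^-1 (m d) k.+1 (n - k)%N)) => k.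
  apply: expandsM; first exact: kar.
  exact: (expands_cauchy_power (maN n) (leq_subr _ _)).
split; apply/funext => -[|n].
- by rewrite a0 fpsD fps1 /diag_sum big_ord0 addr0.
- rewrite (S n).1 fpsD fps1 add0r; apply: eq_bigr => k _.
  by rewrite cauchy_power0 fps_constM subSS.
- by rewrite a'0 /diag_sum big_ord0.
rewrite (S n).2; apply: eq_bigr => k _.
by rewrite [RHS]fpsD !fps_constM subSS addrC.
Qed.

End Sequence.

Lemma cumulant_equation_moments_unique eps r (a b : fps R) :
  cumulant_equation eps r a -> cumulant_equation eps r b -> a = b.
Proof.
move=> ea eb.
have loc k n : (forall i, (i <= n)%N -> a i = b i) ->
    forall i, (i <= n)%N -> cauchy_power eps a k i = cauchy_power eps b k i.
  move=> ab; elim: k => [//|k IH] i lein; rewrite !cauchy_powerS IH //; congr (_ - _).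
  by rewrite !fpsM; apply: eq_bigr => j _; have := ltn_ord j => ji; rewrite ab ?IH //; lia.
apply/funext => n; have [N] := ubnP n; elim: N n => // N IH [|n] nN.
  by rewrite (cumulant_equation0 ea) (cumulant_equation0 eb).
rewrite (cumulant_equationS n ea) (cumulant_equationS n eb).
apply: eq_bigr => k _; congr (_ * _); apply: (loc _ n); last exact: leq_subr.
by move=> i lein; apply: IH; lia.
Qed.

Lemma cumulant_equation_cumulants_unique r s (a : fps R) :
  cumulant_equation 0 r a -> cumulant_equation 0 s a -> forall n, r n.+1 = s n.+1.
Proof.
move=> er es n; have [N] := ubnP n; elim: N n => // N IH n nN.
have := cumulant_equationS n er; rewrite (cumulant_equationS n es) !big_ord_recr /=.
rewrite (eq_bigr (fun k : 'I_n => r k.+1 * cauchy_power 0 a k.+1 (n - k)%N)) => [|k _].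
  have a1 : cauchy_power 0 a n.+1 0%N = 1.
    rewrite cauchy_power0; elim: n.+1 => [|k IHk]; first by rewrite expr0 fps1.
    by rewrite exprS fpsM big_ord1 IHk (cumulant_equation0 er) mul1r.
  by rewrite subnn -/(cauchy_power 0 a n.+1) a1 !mulr1 => /addrI.
by rewrite IH //; have := ltn_ord k; lia.
Qed.

Lemma fps_eulerX a k : fps_euler (a ^+ k.+1) = a ^+ k * fps_euler a *+ k.+1.
Proof.
elim: k => [|k IH]; first by rewrite expr0 mul1r mulr1n expr1.
rewrite exprS fps_eulerM IH [a ^+ k.+1]exprS; ring.
Qed.

(** With [A] and [B] as in the proof, [de = A m + B de]. Applying [z d/dz] to the
 equation for [m] gives [z m' = B (m + z m')], so that [m + z m'] is the inverse
 of [1 - B] up to the factor [m]. *)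
Lemma linear_response r rho (m de : fps R) : cumulant_equation 0 r m ->
  de = diag_sum (fun k => fps_const (rho k.+1) * m ^+ k.+1
         + fps_const (r k.+1) * (m ^+ k * de *+ k.+1)) ->
  de = diag_sum (fun k => fps_const (rho k.+1) * m ^+ k) * (m + fps_euler m).
Proof.
move=> em ede.
pose A := diag_sum (fun k => fps_const (rho k.+1) * m ^+ k).
pose B := diag_sum (fun k => fps_const (r k.+1) * (m ^+ k *+ k.+1)).
have E1 : de = A * m + B * de.
  rewrite [A * m]mulrC [B * de]mulrC !mul_diag_sum diag_sumD [LHS]ede.
  congr diag_sum; apply/funext => k.
  by rewrite [m ^+ k.+1]exprS; ring.
have const_euler c b : fps_euler (fps_const c * b) = fps_const c * fps_euler b.
  by apply/funext => n; rewrite /fps_euler !fps_constM; ring.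
have E2 : fps_euler m = B * (m + fps_euler m).
  rewrite mulrC mul_diag_sum.
  have E3 : fps_euler m = fps_euler (diag_sum (fun k => fps_const (r k.+1) * m ^+ k.+1)).
    rewrite {1}em; apply/funext => n; rewrite /fps_euler fpsD fps1.
    case: n => [|n]; rewrite ?mul0r // add0r; congr (_ * diag_sum _ _).
    by apply/funext => k; rewrite cauchy_power0.
  rewrite [LHS]E3 euler_diag_sum; congr diag_sum; apply/funext => k.
  rewrite const_euler fps_eulerX [m ^+ k.+1]exprS; ring.
have B0 : (1 - B) 0%N = 1 by rewrite fpsB fps1 /B /diag_sum big_ord0 subr0.
apply: (fps_mulI B0); rewrite -/A.
transitivity (A * m); first by rewrite mulrBl mul1r {1}E1 addrK.
have -> : (1 - B) * (A * (m + fps_euler m)) =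
  A * (m + (fps_euler m - B * (m + fps_euler m))) by ring.
by rewrite -E2 subrr addr0.
Qed.

End FirstOrder.

(** * The equation for real-rooted polynomials *)

Section FiniteFreeEquation.
Variable R : realType.
Implicit Types (p q : {poly R}) (e : nat -> R).

Lemma fact_neq0 n : (n`!)%:R != 0 :> R.
Proof. by rewrite pnatr_eq0 -lt0n fact_gt0. Qed.

Definition egf e : fps R := fun n => e n / (n`!)%:R.

Definition cumulant_egf e : fps R := fun n =>
  if n is k.+1 then classical_cumulant e k.+1 / (k`!)%:R else 0.

(** The cumulants are the coefficients of the logarithmic derivative. *)
Lemma euler_egf e : e 0%N = 1 -> fps_euler (egf e) = cumulant_egf e * egf e.
Proof.
move=> e0; apply/funext => -[|n]; rewrite /fps_euler fpsM.
  by rewrite mul0r big_ord1 mul0r.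
rewrite big_ord_recl mul0r add0r /egf (egf_recursion (ga := classical_cumulant e)).
  by apply: eq_bigr => k _; rewrite /bump /= ?add1n subSS.
exact: classical_cumulant_recursion.
Qed.

(** Up to degree [d] the generating function of the [ecoef] is multiplicative, so
 its logarithmic derivative is additive. *)
Lemma finite_free_cumulant_add d p q n : real_rooted d p -> real_rooted d q ->
  (0 < n <= d)%N ->
  finite_free_cumulant d (finite_free_add d p q) n =
  finite_free_cumulant d p n + finite_free_cumulant d q n.
Proof.
move=> rp rq /andP[n0 nd]; rewrite !finite_free_cumulantE -mulrDr; congr (_ * _).
set e := ecoef d _; set e1 := ecoef d p; set e2 := ecoef d q.
have e0 : e 0%N = 1 by apply: ecoef0; apply: finite_free_add_real_rooted.
have e10 : e1 0%N = 1 by apply: ecoef0.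
have e20 : e2 0%N = 1 by apply: ecoef0.
pose f : fps R := egf e1 * egf e2.
have fE k : (k <= d)%N -> egf e k = f k.
  move=> kd; rewrite /f fpsM /egf {1}/e ecoef_finite_free_add // mulr_suml.
  apply: eq_bigr => i _; have ik : (i <= k)%N by rewrite -ltnS.
  rewrite -/e1 -/e2 -(bin_fact ik) !natrM; field.
  by rewrite !fact_neq0 pnatr_eq0 -lt0n bin_gt0 ik.
have eulf : fps_euler f = (cumulant_egf e1 + cumulant_egf e2) * f.
  by rewrite /f fps_eulerM !euler_egf //; ring.
have f0 : f 0%N = 1 by rewrite -fE // /egf e0 fact0 divr1.
have key k : (k <= d)%N -> cumulant_egf e k = cumulant_egf e1 k + cumulant_egf e2 k.
  have [N] := ubnP k; elim: N k => // N IH [|k] kN kd; first by rewrite addr0.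
  have E1 := congr1 (fun g : fps R => g k.+1) (euler_egf e0).
  have E2 := congr1 (fun g : fps R => g k.+1) eulf.
  rewrite /= !fpsM /fps_euler fE // in E1 E2; rewrite E1 in E2.
  move: E2; rewrite big_ord_recr [in RHS]big_ord_recr /= subnn fE // f0 !mulr1.
  rewrite (eq_bigr (fun i : 'I_k.+1 => (cumulant_egf e1 + cumulant_egf e2) i * f (k.+1 - i)%N)).
    by move/addrI.
  move=> i _; have := ltn_ord i => ik; rewrite fE; last by lia.
  by rewrite IH //; lia.
have := key n nd; case: n n0 {nd} => // n _ /= E.
by apply: (mulIf (invr_neq0 (fact_neq0 n))); rewrite E mulrDl.
Qed.

Definition power_sum_fps (s : seq R) : fps R :=
  fun n => if n == 0%N then 0 else \sum_(x <- s) x ^+ n.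

Definition root_fps (s : seq R) : fps R :=
  fun n => if (n <= size s)%N then (\prod_(x <- s) ('X - x%:P))`_(size s - n) else 0.

Lemma root_fps_cons x s :
  root_fps (x :: s) = root_fps s - fps_shift 1 (fps_const x * root_fps s).
Proof.
apply/funext => n; rewrite fpsB /fps_shift /root_fps /= big_cons.
set Q := \prod_(y <- s) _; have sQ : size Q = (size s).+1 by rewrite size_prod_XsubC.
have coefQ i : (('X - x%:P) * Q)`_i = (if i is j.+1 then Q`_j else 0) - x * Q`_i.
  by rewrite mulrBl mul_polyC coefB coefXM coefZ; case: i.
case: n => [|n]; first by rewrite !subn0 coefQ /= subr0 [Q`_(size s).+1]nth_default ?sQ ?mulr0 // subr0.
rewrite /= fps_constM subSS subn1 /= ltnS coefQ.
case: (ltngtP n (size s)) => [ns|ns|->].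
- by rewrite -(subnSK ns).
- by rewrite mulr0 subr0.
by rewrite subnn.
Qed.

Lemma geometric_fps x :
  power_sum_fps [:: x] * (1 - fps_shift 1 (fps_const x)) = fps_shift 1 (fps_const x).
Proof.
have -> : fps_shift 1 (fps_const x) = fps_const x * fps_shift 1 1.
  by rewrite fps_shiftMr mulr1.
rewrite mulrBr mulr1 mulrCA [power_sum_fps _ * _]fps_shiftMr mulr1.
apply/funext => n; rewrite fpsB !fps_constM /fps_shift /power_sum_fps !big_seq1.
case: n => [|[|n]] /=; rewrite ?mulr0 ?subr0 ?subnn ?subSS ?subn0 ?fps1 //=.
  by rewrite expr1 mulr1.
by rewrite -exprS subrr.
Qed.

(** The logarithmic derivative of a product of factors [1 - x z]. *)
Lemma newton_fps s : fps_euler (root_fps s) = - (power_sum_fps s * root_fps s).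
Proof.
elim: s => [|x s IH].
  apply/funext => n; rewrite fpsN fpsM big1 => [|i _].
    rewrite oppr0 /fps_euler /root_fps big_nil /=; case: n => [|n]; rewrite ?mul0r ?mulr0 //.
  by rewrite /power_sum_fps big_nil if_same mul0r.
set y := fps_shift 1 (fps_const x).
have E : root_fps (x :: s) = (1 - y) * root_fps s.
  rewrite root_fps_cons mulrBl mul1r /y; congr (_ - _).
  by rewrite [fps_const x * _]mulrC -fps_shiftMr mulrC.
have Ey : fps_euler y = y.
  apply/funext => n; rewrite /fps_euler /y /fps_shift /fps_const.
  by case: n => [|[|n]]; rewrite /= ?mul0r ?mul1r ?mulr0.
have Ps : power_sum_fps (x :: s) = power_sum_fps [:: x] + power_sum_fps s.
  apply/funext => n; rewrite fpsD /power_sum_fps big_cons big_seq1.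
  by case: eqP; rewrite ?addr0.
rewrite E fps_eulerM IH Ps.
have -> : fps_euler (1 - y) = - y.
  rewrite -[in RHS]Ey; apply/funext => n; rewrite fpsN /fps_euler fpsB fps1.
  by case: n => [|n]; rewrite ?mul0r ?oppr0 //= sub0r mulrN.
have := geometric_fps x; rewrite -/y => G.
have -> : - ((power_sum_fps [:: x] + power_sum_fps s) * ((1 - y) * root_fps s)) =
  - (power_sum_fps [:: x] * (1 - y)) * root_fps s + (1 - y) * - (power_sum_fps s * root_fps s) by ring.
by rewrite G.
Qed.

Lemma root_seqP d p : real_rooted d p ->
  size (root_seq p) = d /\ p = \prod_(x <- root_seq p) ('X - x%:P).
Proof.
move=> rp; have [s sd pE] := rp.
have E : p = \prod_(x <- root_seq p) ('X - x%:P).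
  exact: (@xgetPex _ [::] [set s | p = \prod_(x <- s) ('X - x%:P)] (ex_intro _ s pE)).
split=> //; have [sp _] := real_rooted_monic rp.
by move: sp; rewrite {1}E size_prod_XsubC => -[].
Qed.

Lemma poly_moment0 d p : (0 < d)%N -> real_rooted d p -> poly_moment d p 0 = 1.
Proof.
move=> d0 /root_seqP[sd _]; rewrite /poly_moment (eq_bigr (fun=> 1)) => [|x _]; last exact: expr0.
by rewrite big_const_seq count_predT sd iter_addr_0 mulVf // pnatr_eq0 -lt0n.
Qed.

(** Newton's identities, and the definition of the cumulants as the coefficients of
 a logarithm, are the hypotheses of [cumulant_equation_of_newton]. *)
Lemma finite_free_equation d p : (0 < d)%N -> real_rooted d p ->
  cumulant_equation d%:R^-1 (finite_free_cumulant d p) (poly_moment d p).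
Proof.
move=> d0 rp; have [sd pE] := root_seqP rp.
have dn0 : d%:R != 0 :> R by rewrite pnatr_eq0 -lt0n.
have e0 := ecoef0 rp; set e := ecoef d p in e0.
(* The operator is [P(D) = \sum_n (-1)^n e_n D^n / n!]. *)
pose b : fps R := fun n => (-1) ^+ n * egf e n.
apply: (@cumulant_equation_of_newton _ d%:R (root_fps (root_seq p)) b) => //.
- rewrite /root_fps /= subn0 sd -pE; by have [] := real_rooted_monic rp.
- exact: poly_moment0.
- move=> n; rewrite -ffact_weight // /root_fps sd -pE /b /egf /e /ecoef.
  case: leqP => nd; last by rewrite ffact_small // mul0r.
  rewrite -bin_ffact natrM.
  have S : (-1) ^+ n * (-1) ^+ n = 1 :> R by rewrite -exprD -signr_odd oddD addbb.
  have b0 : 'C(d, n)%:R != 0 :> R by rewrite pnatr_eq0 -lt0n bin_gt0.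
  transitivity ((-1) ^+ n * (-1) ^+ n * p`_(d - n)); first by rewrite S mul1r.
  by field; rewrite b0 fact_neq0.
- rewrite newton_fps; congr (- (_ * _)); apply/funext => n.
  rewrite fps_constM fpsB fps1 /power_sum_fps.
  case: eqP => [->|/eqP n0]; first by rewrite poly_moment0 // subrr mulr0.
  by rewrite subr0 /poly_moment mulVKf.
case=> [|n]; first by rewrite big_ord0 mul0r mulr0 oppr0.
have E : n.+1%:R * egf e n.+1 =
    \sum_(k < n.+1) classical_cumulant e k.+1 / (k`!)%:R * egf e (n - k)%N.
  exact: egf_recursion (classical_cumulant_recursion n e0).
rewrite /b mulrCA E !mulr_sumr -sumrN; apply: eq_bigr => k _.
rewrite finite_free_cumulantE -/e subSS /egf /=.
have kn : (k <= n)%N by rewrite -ltnS.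
have -> : (-1) ^+ n.+1 = (-1) ^+ k.+1 * (-1) ^+ (n - k) :> R.
  by rewrite -exprD addSn subnKC.
have -> : (- d%:R) ^+ k = (-1) ^+ k * d%:R ^+ k :> R by rewrite -exprMn mulN1r.
rewrite exprVn !exprS; field.
by rewrite !fact_neq0 dn0 expf_neq0.
Qed.

End FiniteFreeEquation.

(** * Infinitesimal distribution of the convolution *)

Section Assembly.
Variable R : realType.

Lemma expands_powN e : expands (fun d => (- d%:R^-1) ^+ e : R)
  (e == 0%N)%:R (- (e == 1%N)%:R).
Proof.
elim: e => [|e IH].
  by apply: expands_eq (expands_cst 1) _ _; rewrite ?oppr0.
apply: expands_near => [d _|]; first by rewrite exprS; reflexivity.
apply: expands_eq (expandsM (expandsN (@expands_inv R)) IH) _ _.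
  by rewrite oppr0 mul0r.
by rewrite oppr0 mul0r add0r mulN1r.
Qed.

Definition annular_number (ka : nat -> R) n : R :=
  if (2 <= n)%N then n%:R / 2 * \sum_(1 <= t < n)
     \sum_(sigma in annular_noncrossing t (n - t))
        block_prod ka (porbits sigma) / (t%:R * (n - t)%:R) else 0.

(** The sign is that of [(-1/d)^1]. *)
Lemma expands_genus_moment (ka : fps R) : exists x : fps R,
  forall n, expands (fun d => genus_moment d%:R^-1 ka n) (x n)
                    (- annular_number ka n).
Proof.
exists (fun n => if n == 0%N then 1 else genus_coef ka n 0) => -[|n].
  by apply: expands_eq (expands_cst 1) _ _; rewrite ?oppr0.
apply: expands_near => [d _|]; first by rewrite genus_momentE //; reflexivity.
apply: expands_eq.
  apply: (@expands_sum _ _ _ (fun d (e : 'I_n.+3) => genus_coef ka n.+1 e * (- d%:R^-1) ^+ e)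
    (fun e : 'I_n.+3 => genus_coef ka n.+1 e * (e == 0%N :> nat)%:R)
    (fun e : 'I_n.+3 => genus_coef ka n.+1 e * - (e == 1%N :> nat)%:R
                        + 0 * (e == 0%N :> nat)%:R)) => e.
  exact: expandsM (expands_cst _) (@expands_powN e).
- rewrite big_ord_recl /= mulr1 big1 ?addr0 // => i _; by rewrite mulr0.
have n1 : (1 < n.+3)%N by [].
rewrite (bigD1 (Ordinal n1)) //= [X in _ + X]big1 => [|i]; last first.
  by rewrite -val_eqE /= => /negPf ->; rewrite oppr0 mulr0 mul0r addr0.
rewrite !mul0r !addr0 mulrN mulr1 genus_coef1 // /annular_number.
by case: n {n1} => [|n] //; rewrite big_geq // mulr0.
Qed.

Lemma conv_powerE (m : fps R) k l : conv_power m k l = (m ^+ k) l.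
Proof.
elim: k l => [|k IH] l; first by rewrite expr0.
rewrite exprS fpsM; apply: eq_bigr => i _. by rewrite -IH.
Qed.

(** Summation over the size of the first block of a non-crossing partition. *)
Lemma free_cumulant_equation (m : fps R) : m 0%N = 1 ->
  cumulant_equation 0 (free_cumulant m) m.
Proof.
move=> m0; have mE n : m n = nc_total (free_cumulant m) n.
  case: n => [|n]; first by rewrite nc_total0.
  exact: moment_free_cumulant.
apply/funext => -[|n]; first by rewrite fpsD fps1 /diag_sum big_ord0 addr0 m0.
rewrite mE nc_total_recursion fpsD fps1 add0r; apply: eq_bigr => k _.
rewrite fps_constM cauchy_power0 subSS -conv_powerE; congr (_ * conv_power _ _ _).
by apply/funext => i.
Qed.

Lemma mu_moment0 (mu : probability (measurableTypeR R) R) : mu_moment mu 0 = 1.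
Proof.
rewrite /mu_moment /Rintegral; under eq_integral do rewrite expr0.
rewrite integral_cst // mul1e; exact: (congr1 fine (probability_setT mu)).
Qed.

(** Expansions are unique, so the chosen value is the coefficient. *)
Lemma cumulant_fluctuationE (p : nat -> {poly R})
    (mu : probability (measurableTypeR R) R) n c :
  expands (fun d => finite_free_cumulant d (p d) n) (mu_free_cumulant mu n) c ->
  cumulant_fluctuation p mu n = c.
Proof.
move=> pc.
have H c' : ((fun d : nat => finite_free_cumulant d (p d) n - mu_free_cumulant mu n
                    - d%:R^-1 * c')
    =o_\oo (fun d : nat => d%:R^-1 : R)) <->
    expands (fun d => finite_free_cumulant d (p d) n) (mu_free_cumulant mu n) c'.
  rewrite eqoP; split=> [lo|ex eps eps0].
    apply/cvgrPdist_le => eps eps0; near=> d.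
    have d0 : (0 < d)%N by near: d; exact: nbhs_infty_gt.
    have dR : (0 : R) < d%:R by rewrite ltr0n.
    have : `|finite_free_cumulant d (p d) n - mu_free_cumulant mu n
                    - d%:R^-1 * c'| <= eps * `|d%:R^-1|.
      by near: d; exact: lo.
    rewrite normfV (gtr0_norm dR) ler_pdivlMr // -{2}(gtr0_norm dR) -normrM distrC.
    congr (_ <= _); congr `|_|; field; exact: lt0r_neq0.
  near=> d.
  have d0 : (0 < d)%N by near: d; exact: nbhs_infty_gt.
  have dR : (0 : R) < d%:R by rewrite ltr0n.
  rewrite normfV (gtr0_norm dR) ler_pdivlMr // -{2}(gtr0_norm dR) -normrM.
  have : `|c' - d%:R * (finite_free_cumulant d (p d) n - mu_free_cumulant mu n)| <= eps.
    near: d; move/cvgrPdist_le: ex; apply=> //.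
  rewrite distrC; congr (_ <= _); congr `|_|; field; exact: lt0r_neq0.
rewrite /cumulant_fluctuation; apply: get_unique; first exact/H.
by move=> c' /H pc'; case: (expands_unique pc' pc).
Unshelve. all: by end_near. Qed.

Definition monomial_functional (a : nat -> R) (p : {poly R}) : R :=
  \sum_(i < size p) p`_i * a i.

Lemma monomial_functional_widen a (p : {poly R}) N : (size p <= N)%N ->
  monomial_functional a p = \sum_(i < N) p`_i * a i.
Proof.
move=> pN; rewrite /monomial_functional (big_ord_widen_cond N xpredT (fun i => p`_i * a i)) //.
rewrite [LHS]big_mkcond /=; apply: eq_bigr => i _; case: ltnP => // h.
by rewrite nth_default // mul0r.
Qed.

Lemma monomial_functional_is_linear a : linear_for *%R (monomial_functional a).
Proof.
move=> c p q; set N := maxn (size (c *: p + q)) (maxn (size p) (size q)).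
rewrite !(@monomial_functional_widen a _ N) ?leq_max ?leqnn ?orbT //.
rewrite mulr_sumr -big_split; apply: eq_bigr => i _ /=.
by rewrite coefD coefZ mulrDl mulrA.
Qed.

HB.instance Definition _ a := GRing.isLinear.Build R {poly R} R *%R
  (monomial_functional a) (monomial_functional_is_linear a).

Lemma monomial_functionalX a n : monomial_functional a 'X^n = a n.
Proof.
rewrite /monomial_functional size_polyXn big_ord_recr /= coefXn eqxx mul1r.
by rewrite big1 ?add0r // => i _; rewrite coefXn ltn_eqF ?mul0r.
Qed.

Section OnePolynomialSequence.
Variables (p : nat -> {poly R}) (mu : probability (measurableTypeR R) R)
  (mu' : {scalar {poly R}}).
Hypothesis p_rooted : forall d : nat, (0 < d)%N -> real_rooted d (p d).
Hypothesis p_distr : infinitesimal_distribution p mu mu'.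

(** The equation transfers the expansion of the moments to the cumulants. Its limit
 is the equation of free cumulants, whose solution is unique. *)
Lemma expands_fluctuation n :
  expands (fun d => finite_free_cumulant d (p d) n.+1)
    (mu_free_cumulant mu n.+1) (cumulant_fluctuation p mu n.+1).
Proof.
have [_ _ _ H] := p_distr.
have ma k : expands (fun d => poly_moment d (p d) k) (mu_moment mu k)
    (if k == 0%N then 0 else mu' 'X^k).
  case: k => [|k]; last exact: H.
  rewrite mu_moment0; apply: expands_near (expands_cst 1) => d d0.
  by rewrite (poly_moment0 d0 (p_rooted d0)).
have eqs d : (0 < d)%N -> cumulant_equation d%:R^-1
    (finite_free_cumulant d (p d)) (poly_moment d (p d)).
  by move=> d0; apply: finite_free_equation d0 (p_rooted d0).
have [r [r' kar]] := expands_cumulants eqs ma.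
have [er _] := expands_limit_equation eqs kar ma.
have rE k : r k.+1 = mu_free_cumulant mu k.+1.
  apply: cumulant_equation_cumulants_unique er _ k.
  exact/free_cumulant_equation/mu_moment0.
have E : expands (fun d => finite_free_cumulant d (p d) n.+1)
    (mu_free_cumulant mu n.+1) (r' n.+1) by rewrite -rE.
by rewrite (cumulant_fluctuationE E).
Qed.

End OnePolynomialSequence.

(** Translation into the variable of the Cauchy transform:
 [G = z^-1 m(1/z)] and [- G' = z^-2 (m + z m')(1/z)]. *)
Lemma response_series (rho : probability (measurableTypeR R) R) (f : nat -> R) :
  fps_shift 1 (diag_sum (fun k => fps_const (f k.+1) * (mu_moment rho : fps R) ^+ k)
     * ((mu_moment rho : fps R) + fps_euler (mu_moment rho))) =
  - fs_mul (fs_comp (fun k => f k.+1) (cauchy_measure rho))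
      (fs_deriv_z (cauchy_measure rho)) :> fps R.
Proof.
set m : fps R := mu_moment rho.
have GE : cauchy_measure rho = fps_shift 1 m.
  by apply/funext => -[|k]; rewrite /fps_shift //= subn1.
have Gk k : (cauchy_measure rho : fps R) ^+ k = fps_shift k (m ^+ k).
  elim: k => [|k IH].
    by rewrite !expr0; apply/funext => n; rewrite /fps_shift subn0.
  rewrite exprS IH fps_shiftMr GE [_ * m ^+ k]mulrC fps_shiftMr.
  by rewrite [m ^+ k * m]mulrC -exprS fps_shift_shift addn1.
have -> : diag_sum (fun k => fps_const (f k.+1) * m ^+ k) =
    fps_shift 1 (fs_comp (fun k => f k.+1) (cauchy_measure rho)).
  apply/funext => -[|n]; first by rewrite /diag_sum big_ord0.
  rewrite /fps_shift subn1 /fs_comp; apply: eq_bigr => k _.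
  by rewrite fps_constM fs_expE Gk /fps_shift -ltnS ltn_ord subSS.
have -> : (fs_deriv_z (cauchy_measure rho) : fps R) =
    - fps_shift 1 (fps_shift 1 (m + fps_euler m)).
  rewrite GE; apply/funext => -[|[|n]]; rewrite fpsN /fps_shift /= ?oppr0 ?mul0r ?mulr0 ?oppr0 //.
  by rewrite !subn1 /= fpsD /fps_euler -natr1; ring.
rewrite -[fs_mul _ _]/((fs_comp (fun k => f k.+1) (cauchy_measure rho) : fps R) * _).
rewrite mulrN opprK fps_shiftMr; congr fps_shift.
by rewrite mulrC !fps_shiftMr mulrC.
Qed.

End Assembly.

Theorem theorem4p6 (R : realType) (p q : nat -> {poly R})
    (mu nu rho : probability (measurableTypeR R) R)
    (mu' nu' : {scalar {poly R}})
    (p_real_rooted : forall d : nat, (0 < d)%N -> real_rooted d (p d))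
    (q_real_rooted : forall d : nat, (0 < d)%N -> real_rooted d (q d))
    (mu_determinate : moment_determinate mu)
    (nu_determinate : moment_determinate nu)
    (p_distr : infinitesimal_distribution p mu mu')
    (q_distr : infinitesimal_distribution q nu nu')
    (rhoE : free_add_convolution mu nu rho) :
  exists rho' : {scalar {poly R}},
    infinitesimal_distribution (fun d => finite_free_add d (p d) (q d)) rho rho'
    /\ cauchy_functional rho' =
         - fs_mul (fs_comp (fluctuation_R_transform p mu) (cauchy_measure rho))
                  (fs_deriv_z (cauchy_measure rho))
         - fs_mul (fs_comp (fluctuation_R_transform q nu) (cauchy_measure rho))
                  (fs_deriv_z (cauchy_measure rho))
         - annular_series rho.
Proof.
have [rho_mom rho_cum] := rhoE.
pose pq d := finite_free_add d (p d) (q d).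
have pq_rooted d : (0 < d)%N -> real_rooted d (pq d).
  by move=> d0; apply: finite_free_add_real_rooted; [apply: p_real_rooted|apply: q_real_rooted].
pose r : fps R := mu_free_cumulant rho.
pose f n := cumulant_fluctuation p mu n + cumulant_fluctuation q nu n.
have pq_cum n : expands (fun d => finite_free_cumulant d (pq d) n.+1) (r n.+1) (f n.+1).
  rewrite /r rho_cum //.
  have Q := expandsD (expands_fluctuation (n := n) p_real_rooted p_distr)
    (expands_fluctuation (n := n) q_real_rooted q_distr).
  apply: expands_near_inf Q.
  (* Finite free cumulants are additive up to the order [d] only. *)
  near=> d; have nd : (n < d)%N by near: d; exact: nbhs_infty_gt.
  have d0 : (0 < d)%N by apply: leq_trans nd.
  by rewrite (finite_free_cumulant_add (p_real_rooted d d0) (q_real_rooted d d0)).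
have pq_eq d : (0 < d)%N -> cumulant_equation d%:R^-1
    (finite_free_cumulant d (pq d)) (poly_moment d (pq d)).
  by move=> d0; apply: finite_free_equation d0 (pq_rooted d d0).
have [a [a' pq_mom]] := expands_moments pq_eq pq_cum.
have [eq_a a'E] := expands_limit_equation pq_eq pq_cum pq_mom.
have eq_rho : cumulant_equation 0 r (mu_moment rho).
  exact/free_cumulant_equation/mu_moment0.
have aE : a = mu_moment rho by apply: cumulant_equation_moments_unique eq_a eq_rho.
(* The comparison solution, whose cumulants do not vary with [d]: it has the same
   limit, and the first-order term [- h]. *)
have [x gen_mom] := expands_genus_moment r.
pose h : fps R := annular_number r.
have gen_cum n : expands (fun=> r n.+1) (r n.+1) ((0 : fps R) n.+1).
  exact: expands_cst.
have [eq_x hE] := @expands_limit_equation R (fun=> r) _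
  (fun d d0 => genus_cumulant_equation r d0) r 0 x (- h) gen_cum gen_mom.
have xE : x = a by apply: cumulant_equation_moments_unique eq_x eq_a.
(* Subtracting the two first-order equations removes [power_correction]. *)
have deE : a' + h = diag_sum (fun k => fps_const (f k.+1) * a ^+ k.+1
         + fps_const (r k.+1) * (a ^+ k * (a' + h) *+ k.+1)).
  rewrite -{1}[h]opprK [X in X - _]a'E [X in _ - X]hE diag_sumB; congr diag_sum.
  apply/funext => k; rewrite fps0 fps_const0 xE; ring.
have := linear_response eq_a deE; rewrite aE => resp.
exists (monomial_functional a' : {scalar {poly R}}); split.
  split=> //.
  - by move=> n; rewrite -aE; apply: expands_cvg (pq_mom n).
  - rewrite -(expr0 'X) /= monomial_functionalX.
    have a0 d : (0 < d)%N -> 1 = poly_moment d (pq d) 0 :> R.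
      by move=> d0; rewrite (poly_moment0 d0 (pq_rooted d d0)).
    by case: (expands_unique (pq_mom 0%N) (expands_near a0 (expands_cst 1))).
  - by move=> n _; rewrite /= monomial_functionalX -aE; apply: pq_mom.
have -> : cauchy_functional (monomial_functional a' : {scalar {poly R}}) =
    fps_shift 1 (a' + h) - annular_series rho.
  apply/funext => -[|n]; rewrite fpsB /fps_shift /= ?subr0 // subn1.
  by rewrite monomial_functionalX fpsD addrK.
rewrite resp response_series; congr (_ - _).
rewrite -opprD; congr (- _); apply/funext => n.
rewrite fpsD /fs_mul -big_split /=; apply: eq_bigr => i _.
rewrite -mulrDl; congr (_ * _); rewrite /fs_comp -big_split; apply: eq_bigr => j _.
by rewrite /f mulrDl.
Unshelve. all: by end_near. Qed.
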